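(* Let $d\ge1$, let $\alpha\in DC(\tau)\subset\mathbb T^d$ for some $\tau>1$, and let $f:\mathbb T^d\to\mathbb T^d$, $f(\theta)=\theta+\alpha$. Let $\phi:\mathbb T^d\to\mathbb R$ be piecewise Hölder, and suppose that the Lyapunov exponent $L(E)$ is continuous in $E\in\mathbb R$ and $L(E)>0$ for every $E\in\mathbb R$. Then $\beta^+_\theta(p)=0$ for all $\theta\in\mathbb T^d$ and all $p>0$.
   Context: $\mathbb T^d=\mathbb R^d/\mathbb Z^d$ with the flat metric $\mathrm{dist}$ and Lebesgue measure $m$; $\|x\|_{\mathbb R/\mathbb Z}$ is the distance from $x$ to the nearest integer. Diophantine condition: $DC(\tau)=\bigcup_{c>0}DC(c,\tau)$, where $DC(c,\tau)$ is the set of $\alpha=(\alpha_1,\dots,\alpha_d)$ with $\|\langle\vec h,\alpha\rangle\|_{\mathbb R/\mathbb Z}\ge c\,r(\vec h)^{-\tau}$ for all $\vec h\in\mathbb Z^d\setminus\{\vec 0\}$, $r(\vec h)=\prod_{i=1}^d\max(|h_i|,1)$. Piecewise Hölder: for $\gamma>0$, $L_\gamma(\mathbb T^d)$ is the space of functions with $\|\phi\|_\infty+\sup_{\theta_1\ne\theta_2}\frac{|\phi(\theta_1)-\phi(\theta_2)|}{\mathrm{dist}(\theta_1,\theta_2)^\gamma}<\infty$. $\phi$ is piecewise Hölder if there are $\gamma>0$, $K\in\mathbb N$, $\phi_1,\dots,\phi_K\in L_\gamma(\mathbb T^d)$ and sets $S_1,\dots,S_K\subset\mathbb T^d$ whose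 boundaries $\partial S_j$ are smooth $(d-1)$-dimensional submanifolds of finite $(d-1)$-dimensional volume, such that $\phi=\sum_{j=1}^K\chi_{S_j}\phi_j$. Operator: $H_\theta$ acts on $\ell^2(\mathbb Z)$ by $(H_\theta u)(n)=u(n+1)+u(n-1)+\phi(f^n\theta)u(n)$. Lyapunov exponent: $A(\theta,z)=\begin{pmatrix}z-\phi(\theta)&-1\\1&0\end{pmatrix}$, $A_k(\theta,z)=A(f^{k-1}\theta,z)\cdots A(\theta,z)$ for $k\ge1$, and $L(z)=\lim_{k\to\infty}\frac1k\int_{\mathbb T^d}\ln\|A_k(\theta,z)\|\,dm(\theta)$. Transport exponent: $a_\theta(n,t)=|\langle e^{-itH_\theta}\delta_0,\delta_n\rangle|^2$, $\langle|X|^p_\theta(t)\rangle=\sum_{n\in\mathbb Z}(1+|n|)^pa_\theta(n,t)$, $\beta^+_\theta(p)=\limsup_{t\to\infty}\frac{\ln\langle|X|^p_\theta(t)\rangle}{p\ln t}$. *)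

(* Defs.v *)
From HB Require Import structures.
From mathcomp Require Import all_boot all_order all_algebra.
From mathcomp Require Import all_classical all_reals all_analysis.
From mathcomp Require Import complex.

Set Implicit Arguments.
Unset Strict Implicit.
Unset Printing Implicit Defensive.

Import Order.TTheory GRing.Theory Num.Theory.
Import numFieldNormedType.Exports.
Import ComplexField.Normc.

Local Open Scope classical_set_scope.
Local Open Scope complex_scope.
Local Open Scope ring_scope.

(** Conventions.  The torus T^d = R^d / Z^d is handled through lifts: a point
    of T^d is given by a representative in ['rV[R]_d], a function on T^d is a
    Z^d-periodic function on R^d, a subset of T^d is a Z^d-periodic subset of
    R^d.  Integrals and volumes over T^d are taken over the fundamental domain
    [[0, 1[^d]. *)

Section torus.
Context {R : realType} {d : nat}.
Implicit Types (x y : 'rV[R]_d) (k h : 'rV[int]_d).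

Definition zvec k : 'rV[R]_d := map_mx intr k.

Definition zperiodic {T : Type} (g : 'rV[R]_d -> T) :=
  forall x k, g (x + zvec k) = g x.

Definition zperiodic_set (S : set 'rV[R]_d) :=
  forall x k, S (x + zvec k) <-> S x.

(** Equality of the classes of [x] and [y] in T^d. *)
Definition torus_eq x y := exists k, x = y + zvec k.

Definition unit_cube : set 'rV[R]_d :=
  [set x | forall i, 0 <= x ord0 i < 1].

Definition l2norm x : R := Num.sqrt (\sum_i x ord0 i ^+ 2).

(** The flat (quotient Euclidean) metric; the infimum is a minimum. *)
Definition torus_dist x y : R := inf [set l2norm (x - y + zvec k) | k in setT].

(** [rotation alpha n] is the n-th iterate, n in Z, of theta |-> theta + alpha. *)
Definition rotation (alpha : 'rV[R]_d) (n : int) (theta : 'rV[R]_d) : 'rV[R]_d :=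
  theta + alpha *~ n.

Definition dist_int (t : R) : R := inf [set `|t - m%:~R| | m in [set: int]].

Definition pairing h (alpha : 'rV[R]_d) : R :=
  \sum_i (h ord0 i)%:~R * alpha ord0 i.

Definition r_height h : R := \prod_i Num.max `|(h ord0 i)%:~R| 1.

Definition DC_const (c tau : R) : set 'rV[R]_d :=
  [set alpha | forall h, h != 0 ->
     c * r_height h `^ (- tau) <= dist_int (pairing h alpha)].

Definition DC (tau : R) : set 'rV[R]_d :=
  \bigcup_(c in [set c : R | 0 < c]) DC_const c tau.

End torus.

Section piecewise_holder.
Context {R : realType} {d : nat}.
Implicit Types (g phi : 'rV[R]_d -> R) (M U V S : set 'rV[R]_d).
Local Open Scope ereal_scope.

Definition holder_norm (gamma : R) g : \bar R :=
  ereal_sup [set `|g x|%:E | x in setT] +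
  ereal_sup [set q | exists x y, ~ torus_eq x y /\
     q = (`|g x - g y| / torus_dist x y `^ gamma)%:E].

Definition holder_space (gamma : R) : set ('rV[R]_d -> R) :=
  [set g | zperiodic g /\ holder_norm gamma g < +oo].

(** All iterated partial derivatives up to order [n] exist and are continuous
    at every point of [U]; only used for open [U]. *)
Fixpoint Cn_on (n : nat) U (g : 'rV[R]_d -> R) : Prop :=
  (forall x, U x -> {for x, continuous g}) /\
  if n is n'.+1 then
    forall i : 'I_d, (forall x, U x -> derivable g x (delta_mx ord0 i)) /\
                     Cn_on n' U (fun x => 'D_(delta_mx ord0 i) g x)
  else True.

Definition smooth_map_on U (F : 'rV[R]_d -> 'rV[R]_d) :=
  forall (j : 'I_d) n, Cn_on n U (fun x => F x ord0 j).

(** Embedded [k]-dimensional smooth submanifold of R^d, by the local slice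
    condition: near each of its points, [M] is straightened to
    [R^k x {0}] by a smooth diffeomorphism [F : U -> V] with inverse [G]. *)
Definition smooth_submanifold (k : nat) M :=
  forall p, M p -> exists U V (F G : 'rV[R]_d -> 'rV[R]_d),
    [/\ open U /\ U p, open V /\ F @` U = V,
        smooth_map_on U F /\ smooth_map_on V G,
        forall x, U x -> G (F x) = x &
        forall x, U x ->
          (M x <-> forall i : 'I_d, (k <= i)%N -> F x ord0 i = 0%R)].

Definition boundary S : set 'rV[R]_d := closure S `\` interior S.

Definition diam S : \bar R :=
  ereal_sup [set q | exists x y, [/\ S x, S y & q = (l2norm (x - y))%:E]].

(** The separate value on the empty set only matters for [s = 0], where it
    makes the Hausdorff measure the counting measure. *)
Definition diam_pow (s : nat) S : \bar R :=
  if S == set0 then 0 else diam S ^+ s.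

Definition hausdorff_pre (s : nat) (delta : R) S : \bar R :=
  ereal_inf [set \sum_(0 <= i <oo) diam_pow s (C i) |
    C in [set C : (set 'rV[R]_d)^nat |
      S `<=` \bigcup_i C i /\ forall i, diam (C i) <= delta%:E]].

(** Hausdorff measure without normalizing constant; on [s]-dimensional
    submanifolds it is a positive constant times the Riemannian volume. *)
Definition hausdorff_measure (s : nat) S : \bar R :=
  ereal_sup [set hausdorff_pre s delta S | delta in [set delta : R | (0 < delta)%R]].

Definition piecewise_holder phi :=
  exists (gamma : R) (K : nat) (phis : 'I_K -> 'rV[R]_d -> R)
         (S : 'I_K -> set 'rV[R]_d),
    [/\ (0 < gamma)%R,
        forall j, holder_space gamma (phis j),
        forall j, zperiodic_set (S j),
        forall j, smooth_submanifold d.-1 (boundary (S j)) /\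
                  hausdorff_measure d.-1 (boundary (S j) `&` unit_cube) < +oo &
        forall x, phi x = (\sum_j \1_(S j) x * phis j x)%R].

End piecewise_holder.

Section lebesgue_Rn.
Context {R : realType}.
Local Open Scope ereal_scope.

Local Notation RR := (measurableTypeR R).
Local Notation Rn n := (n.-tuple RR).

Definition tcons n (x : RR * Rn n) : Rn n.+1 := [tuple of x.1 :: x.2].

Let tuncons n (t : Rn n.+1) : RR * Rn n := (thead t, [tuple of behead t]).

Let measurable_tcons n : measurable_fun setT (@tcons n).
Proof. by apply: measurable_cons; [exact: measurable_fst|exact: measurable_snd]. Qed.

Let measurable_tuncons n : measurable_fun setT (@tuncons n).
Proof.
apply: measurable_fun_pair; first exact: measurable_tnth.
exact: measurable_behead.
Qed.

Section step.
Variables (n : nat) (m : {sigma_finite_measure set (Rn n) -> \bar R}).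

Definition lebesgue_step : set (Rn n.+1) -> \bar R :=
  pushforward (@lebesgue_measure R \x m) (@tcons n).

Let step0 : lebesgue_step set0 = 0.
Proof. by rewrite /lebesgue_step /pushforward preimage_set0 measure0. Qed.

Let step_ge0 A : 0 <= lebesgue_step A.
Proof. by rewrite /lebesgue_step /pushforward; exact: measure_ge0. Qed.

Let step_sigma_additive : semi_sigma_additive lebesgue_step.
Proof.
move=> F mF tF mUF; rewrite /lebesgue_step /pushforward preimage_bigcup.
apply: measure_semi_sigma_additive.
- by move=> i; rewrite -[X in measurable X]setTI; exact: measurable_tcons.
- apply/trivIsetP => /= i j _ _ ij; rewrite -preimage_setI.
  by move/trivIsetP : tF => /(_ _ _ _ _ ij) ->//; rewrite preimage_set0.
- rewrite -preimage_bigcup -[X in measurable X]setTI; exact: measurable_tcons.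
Qed.

HB.instance Definition _ := isMeasure.Build _ _ _ lebesgue_step
  step0 step_ge0 step_sigma_additive.

Let step_sigma_finite : sigma_finite setT lebesgue_step.
Proof.
have /sigma_finiteP[F [TF ndF Foo]] := sigma_finiteT (@lebesgue_measure R).
have /sigma_finiteP[G [TG ndG Goo]] := sigma_finiteT m.
have mFG k : measurable (F k `*` G k).
  by apply: measurableX; [exact: (Foo k).1|exact: (Goo k).1].
exists (fun k => @tuncons n @^-1` (F k `*` G k)).
  rewrite -preimage_bigcup; apply/seteqP; split => // t _.
  have [i _ Fi] : (\bigcup_i F i) (thead t) by rewrite -TF.
  have [j _ Gj] : (\bigcup_i G i) [tuple of behead t] by rewrite -TG.
  exists (maxn i j) => //; split => /=.
    by move: Fi; exact/subsetPset/ndF/leq_maxl.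
  by move: Gj; exact/subsetPset/ndG/leq_maxr.
move=> k; split.
  by rewrite -[X in measurable X]setTI; apply: measurable_tuncons.
have [? ?] := Foo k; have [? ?] := Goo k.
rewrite /lebesgue_step /pushforward -comp_preimage.
rewrite (_ : _ \o _ = id); last first.
  by apply/funext => -[x t]; rewrite /tuncons /tcons/=; congr pair; exact/val_inj.
by rewrite preimage_id product_measure1E// lte_mul_pinfty// ge0_fin_numE.
Qed.

HB.instance Definition _ := Measure_isSigmaFinite.Build _ _ _ lebesgue_step
  step_sigma_finite.

End step.

(** Lebesgue measure on R^n: the n-fold product of [lebesgue_measure]. *)
Fixpoint lebesgue_Rn (n : nat) :
    {sigma_finite_measure set (Rn n) -> \bar R} :=
  match n return {sigma_finite_measure set (Rn n) -> \bar R} with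
  | 0%N => \d_([tuple] : Rn 0)
  | n'.+1 => lebesgue_step (lebesgue_Rn n')
  end.

End lebesgue_Rn.

Section lyapunov.
Context {R : realType} {d : nat}.
Implicit Types (phi : 'rV[R]_d -> R) (alpha theta : 'rV[R]_d) (z : R[i]).

(** For a periodic [g] that is only Lebesgue measurable this is still the
    Lebesgue integral, since MathComp-Analysis integrals of nonnegative
    functions are suprema over simple functions below. *)
Definition torus_integral (g : 'rV[R]_d -> R) : R :=
  \int[lebesgue_Rn d]_(t in [set t | unit_cube (\row_i tnth t i)])
    g (\row_i tnth t i).

Definition cocycle phi theta z : 'M[R[i]]_2 :=
  \matrix_(i < 2, j < 2)
    if i == ord0 then (if j == ord0 then z - (phi theta)%:C else -1)
    else (if j == ord0 then 1 else 0).

Fixpoint cocycle_iter phi alpha (k : nat) theta z : 'M[R[i]]_2 :=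
  if k is k'.+1 then
    cocycle phi (rotation alpha k' theta) z *m cocycle_iter phi alpha k' theta z
  else 1%:M.

Definition cvnorm (v : 'cV[R[i]]_2) : R :=
  Num.sqrt (\sum_i normc (v i ord0) ^+ 2).

Definition opnorm (A : 'M[R[i]]_2) : R :=
  sup [set cvnorm (A *m v) | v in [set v | cvnorm v <= 1]].

Definition lyapunov phi alpha z : R :=
  limn (fun k : nat => k%:R^-1 *
    torus_integral (fun theta => ln (opnorm (cocycle_iter phi alpha k theta z)))).

End lyapunov.

Section transport.
Context {R : realType}.
Implicit Types (u v w : int -> R[i]) (A : (int -> R[i]) -> int -> R[i]).

(** Squared norm of ell^2(Z). *)
Definition ell2_sqnorm u : \bar R :=
  \esum_(n in [set: int]) (normc (u n) ^+ 2)%:E.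

(** Inner product of ell^2(Z), linear in the first argument. *)
Definition ell2_dot u v : R[i] :=
  limn (fun N : nat => \sum_(j < N.*2.+1)
    (u (j%:Z - N%:Z) * (v (j%:Z - N%:Z))^* : R[i]^o)).

Definition delta_seq (m : int) : int -> R[i] := fun n => (n == m)%:R.

(** [op_exp A u] is exp(A) u: the ell^2-limit of the partial sums of the
    exponential power series (0 if that limit does not exist, which is excluded
    when [A] is bounded on ell^2(Z) and [u] is in ell^2(Z)). *)
Definition op_exp A u : int -> R[i] :=
  xget (fun=> 0) [set v | 
    (fun N : nat => ell2_sqnorm
       (fun n => \sum_(k < N) (k`!%:R)^-1 * iter k A u n - v n)) @ \oo
    --> 0%E].

Context {d : nat}.
Implicit Types (phi : 'rV[R]_d -> R) (alpha theta : 'rV[R]_d).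

Definition schrodinger phi alpha theta u : int -> R[i] :=
  fun n => u (n + 1) + u (n - 1) + (phi (rotation alpha n theta))%:C * u n.

(** exp(-i t H_theta). *)
Definition propagator phi alpha theta (t : R) : (int -> R[i]) -> int -> R[i] :=
  op_exp (fun u n => - ('i%C * t%:C) * schrodinger phi alpha theta u n).

Definition amplitude phi alpha theta (n : int) (t : R) : R :=
  normc (ell2_dot (propagator phi alpha theta t (delta_seq 0)) (delta_seq n)) ^+ 2.

Definition moment phi alpha theta (p t : R) : \bar R :=
  \esum_(n in [set: int])
    ((1 + `|n|%:~R) `^ p * amplitude phi alpha theta n t)%:E.

Definition beta_plus phi alpha theta (p : R) : \bar R :=
  limf_esup (fun t : R =>
    lne (moment phi alpha theta p t) * ((p * ln t)^-1)%:E)%E +oo_R.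

End transport.

(* Main.v *)
Require Import Defs.
From mathcomp Require Import all_boot all_order all_algebra.
From mathcomp Require Import all_classical all_reals all_analysis.
From mathcomp Require Import complex ring lra zify.

Set Implicit Arguments.
Unset Strict Implicit.
Unset Printing Implicit Defensive.

Import Order.TTheory GRing.Theory Num.Theory.
Import numFieldNormedType.Exports.
Import ComplexField.Normc.

Local Open Scope classical_set_scope.
Local Open Scope complex_scope.
Local Open Scope ring_scope.

(** Why the theorem holds.  The exponent [beta_plus] only sees powers of the
    time [t].  It vanishes as soon as, for every [delta > 0] and all large [t],
    the wave packet lives on the sites [|n| <= t^delta] up to errors smaller
    than a fixed large power of [1/t]: the moments are then at most a power of
    [t^delta], the sites far beyond [t] being negligible because of the finite
    speed of propagation, and they are not small either because the norm is
    conserved ([transport_sites], [moment_bounds]).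

    Quantum side.  The propagator is replaced by [j] explicit Euler steps
    [U = 1 - i h H], with [h = t / j] and [j] a large power of [t].  As [H] is
    symmetric, one step multiplies the squared norm by [1 + O(h^2)], and
    comparing a step with two half steps bounds the error at each site by
    [O(t h)] ([sqn_iter_euler], [euler_doubling], [euler_approx]); only finitely
    supported sequences occur, and no spectral theory.  The entry [(n, 0)] of
    [U^j] is read off, by Fourier inversion on [Z/m], from the sums
    [g = sum_(j < m) r^j U^j delta_n] with [|r| = 1 / (1 + h/t)].  Each [g]
    solves [(H - z) g = c delta_n] up to a negligible error, for an energy [z]
    which either is far from the spectrum or has a bounded real part and an
    imaginary part close to [1/t].  If the Dirichlet determinant of [z - H] on
    some interval between [0] and [n] exceeds a large power of [t], then [g 0]
    is tiny: the current of [g] and the Wronskian of [g] with the Dirichlet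
    solution of that interval are both controlled ([green_decay],
    [euler_decay]).

    Dynamical side.  It remains to find, from every starting point and for
    every such [z], a window of length at most [t^delta] on which the
    determinant is at least [t^M].  Determinants are the entries of transfer
    matrices ([cocycle_iter_dirdet0]), so the question is the growth of the
    cocycle over [k] steps, with [k] a multiple of [ln t] ([cocycle_growth]).
    Since the integral of [ln ||A_k||] is at least [k L - O(1)], and since on
    all but few cells of a grid of mesh [t^-eta] the potential hardly varies
    during [k] steps ([piecewise_holder_tame], where the discontinuity
    hypersurfaces are covered by [O(q^(d-1))] cells of side [1/q]), some such
    cell contains a point with [ln ||A_k|| >= k (L - eps)].  By the Diophantine
    condition every orbit enters that cell after at most [t^delta] steps
    ([orbit_hits]).  Growth persists throughout the cell, and for complex
    energies at distance [1/t] from the real axis, because the product is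
    bounded by [C exp(k (L + eps))] uniformly in the base point
    ([entry_norm_uniform_upper]): the perturbation error is smaller than the
    product itself by a power of [t].  The uniform bound follows from the
    uniform convergence of orbit averages ([orbit_average]), which is proved by
    sandwiching between functions constant on grid cells, and from the
    continuity of [L]. *)

Local Notation ReC := (@complex.Re _).
Local Notation ImC := (@complex.Im _).

(** * Moduli of complex numbers *)
Section complex_facts.
Context {R : realType}.
Implicit Types (x y : R[i]) (a : R).

Lemma normc_ge0 x : 0 <= normc x.
Proof. by case: x => a b; rewrite /normc sqrtr_ge0. Qed.

Lemma sqr_normc2 x : normc x ^+ 2 = ReC x ^+ 2 + ImC x ^+ 2.
Proof. by case: x => a b /=; rewrite sqr_sqrtr// addr_ge0// sqr_ge0. Qed.

Lemma normc_real a : normc a%:C = `|a|.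
Proof. by rewrite /normc /= expr0n /= addr0 sqrtr_sqr. Qed.

Lemma normci : normc ('i : R[i]) = 1.
Proof. by rewrite /normc /= expr0n /= add0r expr1n sqrtr1. Qed.

Lemma ler_Re_normc x : `|ReC x| <= normc x.
Proof.
rewrite -[leLHS]sqrtr_sqr; case: x => a b /=; rewrite ler_wsqrtr//.
by rewrite lerDl sqr_ge0.
Qed.

Lemma ler_Im_normc x : `|ImC x| <= normc x.
Proof.
rewrite -[leLHS]sqrtr_sqr; case: x => a b /=; rewrite ler_wsqrtr//.
by rewrite lerDr sqr_ge0.
Qed.

Lemma normc_le_ReIm x : normc x <= `|ReC x| + `|ImC x|.
Proof.
rewrite -(@ler_pXn2r _ 2)// ?nnegrE ?normc_ge0 ?addr_ge0//.
rewrite sqr_normc2 sqrrD !real_normK ?num_real//.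
by rewrite addrAC lerDl mulrn_wge0 // mulr_ge0.
Qed.

Lemma normc_conj x : normc x^* = normc x.
Proof. by case: x => a b /=; rewrite sqrrN. Qed.

Lemma normc_sum (I : Type) (r : seq I) (P : pred I) (F : I -> R[i]) :
  normc (\sum_(i <- r | P i) F i) <= \sum_(i <- r | P i) normc (F i).
Proof.
elim/big_rec2 : _ => [|i a x _ H]; first by rewrite normc0.
by apply: (le_trans (le_normcD _ _)); rewrite lerD2l.
Qed.

Lemma normcX x n : normc (x ^+ n) = normc x ^+ n.
Proof. by elim: n => [|n IH]; rewrite ?expr0 ?normc1 // !exprS normcM IH. Qed.

Lemma normcBC x y : normc (x - y) = normc (y - x).
Proof. by rewrite -normcN opprB. Qed.

End complex_facts.

(** * The lattice operator and its explicit Euler steps *)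
Section lattice_operator.
Context {R : realType}.
Implicit Types (V : int -> R) (u w : int -> R[i]) (h : R) (z : R[i]).

Definition hop V u : int -> R[i] :=
  fun n => u (n + 1) + u (n - 1) + (V n)%:C * u n.

Definition euler V h u : int -> R[i] := fun n => u n - 'i * h%:C * hop V u n.

Definition exp_bounded (B : R) u := forall n, normc (u n) <= B * 2^-1 ^+ `|n|%N.

(** A shift by one site changes the weight [2^-|n|] by a factor at most 2. *)
Lemma hop_exp_bounded V (Phi B : R) u : (forall n, `|V n| <= Phi) -> 0 <= B ->
  exp_bounded B u -> exp_bounded ((4 + Phi) * B) (hop V u).
Proof.
move=> HV B0 Hu n; rewrite /hop.
have wS (k : int) : `|n - k|%N = 1%N -> normc (u k) <= 2 * B * 2^-1 ^+ `|n|%N.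
  move=> nk; apply: (le_trans (Hu k)).
  have : (`|n| <= `|k|.+1)%N by lia.
  move=> nk1; have : (2^-1 : R) ^+ `|k|.+1 <= 2^-1 ^+ `|n|%N by apply: ler_wiXn2l => //; lra.
  rewrite exprS => H; have -> : 2 * B * 2^-1 ^+ `|n|%N = B * (2 * 2^-1 ^+ `|n|%N) by ring.
  by rewrite ler_wpM2l//; lra.
apply: (le_trans (le_normcD _ _)).
have H1 : normc (u (n + 1)) <= 2 * B * 2^-1 ^+ `|n|%N by apply: wS; lia.
have H2 : normc (u (n - 1)) <= 2 * B * 2^-1 ^+ `|n|%N by apply: wS; lia.
have H3 : normc ((V n)%:C * u n) <= Phi * (B * 2^-1 ^+ `|n|%N).
  by rewrite normcM normc_real ler_pM// ?normc_ge0 ?HV ?Hu.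
apply: (@le_trans _ _ (2 * B * 2^-1 ^+ `|n|%N + 2 * B * 2^-1 ^+ `|n|%N + Phi * (B * 2^-1 ^+ `|n|%N))).
  rewrite lerD//; apply: (le_trans (le_normcD _ _)); exact: lerD.
by rewrite le_eqVlt; apply/orP; left; apply/eqP; ring.
Qed.

Lemma exp_bounded_delta : exp_bounded 1 (delta_seq 0).
Proof.
move=> n; rewrite /delta_seq; case: eqVneq => [->|_]; first by rewrite normc1 absz0 expr0 mulr1.
by rewrite normc0 mul1r exprn_ge0// invr_ge0.
Qed.

Lemma iter_hop_exp_bounded V Phi k : (forall n, `|V n| <= Phi) ->
  exp_bounded ((4 + Phi) ^+ k) (iter k (hop V) (delta_seq 0)).
Proof.
move=> HV; have Phi0 : 0 <= Phi by apply: le_trans (HV 0).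
elim: k => [|k IH]; first by rewrite expr0; exact: exp_bounded_delta.
by rewrite iterS exprS; apply: hop_exp_bounded => //; rewrite exprn_ge0// addr_ge0.
Qed.

Lemma euler_exp_bounded V Phi h B u : (forall n, `|V n| <= Phi) -> 0 <= B -> 0 <= h ->
  exp_bounded B u -> exp_bounded ((1 + h * (4 + Phi)) * B) (euler V h u).
Proof.
move=> HV B0 h0 Hu n; rewrite /euler.
apply: (le_trans (le_normcD _ _)); rewrite normcN !normcM normci mul1r normc_real ger0_norm//.
have -> : (1 + h * (4 + Phi)) * B * 2^-1 ^+ `|n|%N = B * 2^-1 ^+ `|n|%N + h * ((4 + Phi) * B * 2^-1 ^+ `|n|%N) by ring.
by rewrite lerD ?Hu// ler_wpM2l//; exact: hop_exp_bounded.
Qed.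

Lemma iter_euler_exp_bounded V Phi h j : (forall n, `|V n| <= Phi) -> 0 <= h ->
  exp_bounded ((1 + h * (4 + Phi)) ^+ j) (iter j (euler V h) (delta_seq 0)).
Proof.
move=> HV h0; have Phi0 : 0 <= Phi by apply: le_trans (HV 0).
elim: j => [|k IH]; first by rewrite expr0; exact: exp_bounded_delta.
rewrite iterS exprS; apply: euler_exp_bounded => //; rewrite exprn_ge0//.
by rewrite addr_ge0 // mulr_ge0// addr_ge0.
Qed.

End lattice_operator.

(** * The propagator as a pointwise limit *)
Section complex_series.
Context {R : realType}.

Lemma ord_sum_split (f : nat -> R) (N n : nat) : (N <= n)%N ->
  \sum_(k < n) f k = \sum_(k < N) f k + \sum_(N <= k < n) f k.
Proof. by move=> Nn; rewrite -(big_mkord xpredT f) (big_cat_nat (n := N))//= big_mkord. Qed.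

(** Domination by a series with bounded partial sums controls every remainder. *)
Lemma series_tail (f b : nat -> R) (B : R) :
  (forall k, `|f k| <= b k) -> (forall n, \sum_(k < n) b k <= B) ->
  exists l, forall N, `|\sum_(k < N) f k - l| <= B - \sum_(k < N) b k.
Proof.
move=> fb bB.
have b0 k : 0 <= b k by apply: le_trans (fb k).
have cb : cvgn (series b).
  apply: nondecreasing_is_cvgn; first exact: nondecreasing_series.
  by exists B => _ [n _ <-]; rewrite /series /= big_mkord.
have cf : cvgn (series f).
  by apply: normed_cvg; apply: (@series_le_cvg _ (fun k => `|f k|) b).
exists (limn (series f)) => N.
have H : (fun n => `|\sum_(k < N) f k - series f n|) @ \oo -->
         `|\sum_(k < N) f k - limn (series f)|.
  by apply: cvg_norm; apply: cvgB => //; exact: cvg_cst.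
rewrite -(cvg_lim _ H)//; apply: limr_le; first by apply/cvg_ex; eexists; exact: H.
exists N => // n /= Nn.
have -> : \sum_(k < N) f k - series f n = - \sum_(N <= k < n) f k.
  by rewrite /series /= big_mkord (ord_sum_split f Nn) opprD addrA subrr add0r.
rewrite normrN; apply: (le_trans (ler_norm_sum _ _ _)).
apply: (@le_trans _ _ (\sum_(N <= k < n) b k)); first by apply: ler_sum.
rewrite lerBrDr; apply: le_trans (bB n).
by rewrite (ord_sum_split b Nn) addrC.
Qed.

Lemma complex_series_tail (F : nat -> R[i]) (b : nat -> R) (B : R) :
  (forall k, normc (F k) <= b k) -> (forall n, \sum_(k < n) b k <= B) ->
  exists v, forall N, normc (\sum_(k < N) F k - v) <= 2 * (B - \sum_(k < N) b k).
Proof.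
move=> Fb bB.
have [x Hx] := @series_tail (fun k => complex.Re (F k)) b B
  (fun k => le_trans (ler_Re_normc _) (Fb k)) bB.
have [y Hy] := @series_tail (fun k => complex.Im (F k)) b B
  (fun k => le_trans (ler_Im_normc _) (Fb k)) bB.
exists (x +i* y) => N; apply: (le_trans (normc_le_ReIm _)).
have -> : complex.Re (\sum_(k < N) F k - x +i* y) = \sum_(k < N) complex.Re (F k) - x.
  have <- : complex.Re (\sum_(k < N) F k) = \sum_(k < N) complex.Re (F k).
    by elim/big_rec2 : _ => // i a [c d] _ <-; case: (F i).
  by case: (\sum_(k < N) F k).
have -> : complex.Im (\sum_(k < N) F k - x +i* y) = \sum_(k < N) complex.Im (F k) - y.
  have <- : complex.Im (\sum_(k < N) F k) = \sum_(k < N) complex.Im (F k).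
    by elim/big_rec2 : _ => // i a [c d] _ <-; case: (F i).
  by case: (\sum_(k < N) F k).
by rewrite mulr2n mulrDl mul1r lerD.
Qed.

Lemma sum_exp_coeff_le (x : R) n : 0 <= x -> \sum_(k < n) exp_coeff x k <= expR x.
Proof.
move=> x0; rewrite -(big_mkord xpredT).
have -> : expR x = limn (series (exp_coeff x)) by [].
apply: (nondecreasing_cvgn_le _ _ n); last exact: is_cvg_series_exp_coeff.
by apply: nondecreasing_series => k _ _; exact: exp_coeff_ge0.
Qed.

Lemma sum_exp_coeff_cvg (x : R) :
  (fun N => expR x - \sum_(k < N) exp_coeff x k) @ \oo --> (0 : R).
Proof.
have H : series (exp_coeff x) @ \oo --> expR x by exact: is_cvg_series_exp_coeff.
have -> : (fun N : nat => expR x - \sum_(k < N) exp_coeff x k) =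
          (fun N => expR x - series (exp_coeff x) N).
  by apply/funext => n; rewrite /series /= big_mkord.
by have := cvgB (cvg_cst (expR x)) H; rewrite subrr; apply.
Qed.

End complex_series.

Section sums_over_int.
Context {R : realType}.
Local Open Scope ereal_scope.

Lemma esum_int (f : int -> \bar R) : (forall n, 0 <= f n) ->
  \esum_(n in [set: int]) f n = \sum_(i <oo) f (Posz i) + \sum_(i <oo) f (Negz i).
Proof.
move=> f0; rewrite (esumID (range Posz))//; congr (_ + _).
  rewrite setTI (@esum_set_image _ _ f Posz setT) ?setTT//; last by move=> x y _ _ [].
  by apply: eq_eseriesl => i; rewrite in_setT.
have -> : setT `&` ~` range Posz = range Negz.
  apply/seteqP; split => [[n|n] [_ H]/=|_ [n _ <-]]; last by split => // -[].
  - by exfalso; apply: H; exists n.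
  - by exists n.
rewrite (@esum_set_image _ _ f Negz setT)//; last by move=> x y _ _ [].
by apply: eq_eseriesl => i; rewrite in_setT.
Qed.

Lemma nneseries_le_bound (f : nat -> \bar R) (c : \bar R) : (forall n, 0 <= f n) ->
  (forall n, \sum_(i < n) f i <= c) -> \sum_(i <oo) f i <= c.
Proof.
move=> f0 H; apply: lime_le; first exact: is_cvg_nneseries.
by apply: nearW => n; rewrite big_mkord.
Qed.

Lemma sum_inv_sqr_le (n : nat) : (\sum_(i < n) (i.+1%:R ^+ 2)^-1 <= 2 :> R)%R.
Proof.
case: n => [|n]; first by rewrite big_ord0.
suff : (\sum_(i < n.+1) (i.+1%:R ^+ 2)^-1 <= 2 - n.+1%:R^-1 :> R)%R.
  by move=> /le_trans; apply; rewrite gerBl invr_ge0.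
elim: n => [|n IH]; first by rewrite big_ord1 expr1n invr1; lra.
rewrite big_ord_recr /=; apply: (le_trans (lerD IH (lexx _))).
have n1 : (0 < n.+1%:R :> R)%R by [].
rewrite -subr_ge0 (_ : (_ - _)%R = (n.+1%:R * (n.+1%:R + 1) ^+ 2)^-1)%R.
  by rewrite invr_ge0 mulr_ge0// ?exprn_ge0// addr_ge0.
have n0 : (0 <= n%:R :> R)%R by [].
by rewrite -(natr1 n.+1); field; apply/andP; split; rewrite gt_eqF//; lra.
Qed.

(** Each half-line contributes at most [sum 1/n^2 <= 2]. *)
Lemma esum_int_le (f : int -> R) (B : R) : (forall n, 0 <= f n)%R ->
  (forall n, f n <= B * ((1 + `|n|%:~R) ^+ 2)^-1)%R ->
  \esum_(n in [set: int]) (f n)%:E <= (4 * B)%:E.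
Proof.
move=> f0 fB; rewrite esum_int; last by move=> n; rewrite lee_fin.
have B0 : (0 <= B)%R by have := le_trans (f0 0%Z) (fB 0%Z); rewrite normr0 addr0 expr1n invr1 mulr1.
have -> : (4 * B = 2 * B + 2 * B)%R by ring.
have K (e : nat -> int) : (forall i, (i.+1%:R <= 1 + `|e i|%:~R :> R)%R) ->
   \sum_(i <oo) (f (e i))%:E <= (2 * B)%:E.
  move=> He; apply: nneseries_le_bound => [n|n]; first by rewrite lee_fin.
  rewrite sumEFin lee_fin; apply: (@le_trans _ _ (\sum_(i < n) B * (i.+1%:R ^+ 2)^-1)%R).
    apply: ler_sum => i _; apply: (le_trans (fB _)); rewrite ler_wpM2l// lef_pV2 ?posrE ?exprn_gt0//.
    by rewrite lerXn2r// nnegrE// (le_trans _ (He i)).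
  by rewrite -mulr_sumr mulrC ler_wpM2r// sum_inv_sqr_le.
rewrite EFinD leeD// K// => i; first by rewrite -natr1 addrC lerD2l.
by rewrite NegzE normrN -natr1 addrC lerD2l -[X in (_ <= X)%R]/(i.+1%:R) ler_nat.
Qed.

End sums_over_int.

Section propagator.
Context {R : realType}.
Implicit Types (V : int -> R) (u w : int -> R[i]) (t Phi : R).

Definition exp_term V t (k : nat) (n : int) : R[i] :=
  (k`!%:R)^-1 * (- ('i * t%:C)) ^+ k * iter k (hop V) (delta_seq 0) n.

Lemma normc_exp_term V Phi t k n : (forall i, `|V i| <= Phi) -> 0 <= t ->
  normc (exp_term V t k n) <= exp_coeff (t * (4 + Phi)) k * 2^-1 ^+ `|n|%N.
Proof.
move=> HV t0; rewrite /exp_term !normcM normcX normcN normcM normci mul1r normc_real (ger0_norm t0).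
have -> : normc ((k`!%:R)^-1 : R[i]) = (k`!%:R)^-1.
  by rewrite normcV normcMn normc1.
have -> : exp_coeff (t * (4 + Phi)) k = (k`!%:R)^-1 * t ^+ k * (4 + Phi) ^+ k.
  by rewrite exp_coeffE exprMn mulrA.
rewrite -[leRHS]mulrA ler_wpM2l//; first by rewrite mulr_ge0// ?invr_ge0// exprn_ge0.
exact: iter_hop_exp_bounded.
Qed.

Lemma exp_term_sum V Phi t : (forall i, `|V i| <= Phi) -> 0 <= t ->
  exists v : int -> R[i], forall n N, normc (\sum_(k < N) exp_term V t k n - v n) <=
   2 * 2^-1 ^+ `|n|%N * (expR (t * (4 + Phi)) - \sum_(k < N) exp_coeff (t * (4 + Phi)) k).
Proof.
move=> HV t0.
have Phi0 : 0 <= Phi by apply: le_trans (HV 0).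
have x0 : 0 <= t * (4 + Phi) by rewrite mulr_ge0// addr_ge0.
suff H n : exists v : R[i], forall N, normc (\sum_(k < N) exp_term V t k n - v) <=
   2 * 2^-1 ^+ `|n|%N * (expR (t * (4 + Phi)) - \sum_(k < N) exp_coeff (t * (4 + Phi)) k).
  by have [v Hv] := choice H; exists v.
have [k | N |v Hv] := @complex_series_tail R (fun k => exp_term V t k n)
    (fun k => exp_coeff (t * (4 + Phi)) k * 2^-1 ^+ `|n|%N)
    (expR (t * (4 + Phi)) * 2^-1 ^+ `|n|%N).
- exact: normc_exp_term.
- by rewrite -mulr_suml ler_wpM2r ?sum_exp_coeff_le// exprn_ge0// invr_ge0.
exists v => N; apply: (le_trans (Hv N)); rewrite -mulr_suml -mulrBl.
by rewrite -mulrA [X in 2 * X <= _]mulrC.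
Qed.

Lemma ell2_sqnorm_ge u n : ((normc (u n) ^+ 2)%:E <= ell2_sqnorm u)%E.
Proof.
rewrite /ell2_sqnorm; apply: le_trans (@esum_ge _ _ _ _ _ _); last first.
  exists [set n]; first by split.
  by rewrite fsbig_set1.
by [].
Qed.

Lemma hop_scale V (c : R[i]) u : hop V (fun n => c * u n) = (fun n => c * hop V u n).
Proof. by apply/funext => n; rewrite /hop; ring. Qed.

Lemma iter_scaled_hop V (c : R[i]) u k n :
  iter k (fun w n => c * hop V w n) u n = c ^+ k * iter k (hop V) u n.
Proof.
have -> : iter k (fun w n => c * hop V w n) u = (fun n => c ^+ k * iter k (hop V) u n).
  elim: k => [|k IH]; first by apply/funext => m; rewrite expr0 mul1r.
  by apply/funext => m; rewrite iterS IH hop_scale iterS exprS mulrA.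
by [].
Qed.

(** Convergence in [ell^2] implies convergence at each site. *)
Lemma l2_limit_unique (S : nat -> int -> R[i]) (v w : int -> R[i]) :
  (fun N => ell2_sqnorm (fun n => S N n - v n)) @ \oo --> 0%E ->
  (fun N => ell2_sqnorm (fun n => S N n - w n)) @ \oo --> 0%E -> v = w.
Proof.
move=> Hv Hw; apply/funext => n; apply/eqP; rewrite -subr_eq0; apply/eqP.
apply: (@eq0_normc R); apply/eqP; rewrite eq_le normc_ge0 andbT.
apply/ler_addgt0Pr => e e0; rewrite add0r.
have e4 : (0 < ((e / 2) ^+ 2)%:E)%E by rewrite lte_fin exprn_gt0// divr_gt0.
have K (x : int -> R[i]) : (fun N => ell2_sqnorm (fun n => S N n - x n)) @ \oo --> 0%E ->
   \forall N \near \oo, normc (S N n - x n) < e / 2.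
  move=> Hx.
  have : \forall N \near \oo, (ell2_sqnorm (fun n => (S N n - x n)%R) < ((e / 2) ^+ 2)%:E)%E.
    exact: (Hx _ (open_ereal_lt' e4)).
  apply: filterS => N HN.
  have := le_lt_trans (ell2_sqnorm_ge (fun n => S N n - x n) n) HN.
  by rewrite lte_fin ltr_pXn2r// nnegrE ?normc_ge0// ltW// divr_gt0.
have [N _ HN] := filterI (K _ Hv) (K _ Hw).
have [/= H1 H2] := HN N (leqnn _).
have -> : v n - w n = (v n - S N n) + (S N n - w n) by ring.
apply: (le_trans (le_normcD _ _)); rewrite normcBC (splitr e).
by apply: ltW; exact: ltrD.
Qed.

Lemma pow2_inv_le (n : int) : 2^-1 ^+ `|n|%N <= (1 + `|n|%:~R)^-1 :> R.
Proof.
rewrite exprVn lef_pV2 ?posrE ?exprn_gt0//.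
have -> : 1 + `|n|%:~R = (`|n|%N.+1)%:R :> R by rewrite -natr1 addrC -abszE.
by rewrite -natrX ler_nat ltn_expl.
Qed.

(** The exponential weight makes the power series of the propagator converge in
    [ell^2], so its sum can be computed site by site, with an explicit remainder. *)
Lemma amplitude_expansion {d : nat} (phi : 'rV[R]_d -> R) alpha theta Phi t :
  let V := fun n => phi (rotation alpha n theta) in
  (forall i, `|V i| <= Phi) -> 0 <= t ->
  exists v : int -> R[i], (forall n, amplitude phi alpha theta n t = normc (v n) ^+ 2) /\
    forall n N, normc (\sum_(k < N) exp_term V t k n - v n) <=
   2 * 2^-1 ^+ `|n|%N * (expR (t * (4 + Phi)) - \sum_(k < N) exp_coeff (t * (4 + Phi)) k).
Proof.
move=> V HV t0; have [v Hv] := exp_term_sum HV t0; exists v; split => //.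
have cv : (fun N => ell2_sqnorm (fun n => \sum_(k < N) exp_term V t k n - v n)) @ \oo --> 0%E.
  pose tau N : R := expR (t * (4 + Phi)) - \sum_(k < N) exp_coeff (t * (4 + Phi)) k.
  have ctau : tau @ \oo --> (0 : R) by exact: sum_exp_coeff_cvg.
  have tau0 N : 0 <= tau N.
    rewrite subr_ge0 sum_exp_coeff_le// mulr_ge0// addr_ge0//.
    exact: le_trans (HV 0).
  apply: (@squeeze_cvge _ _ _ _ (fun=> 0%E) _ (fun N => (4 * (4 * tau N ^+ 2))%:E)).
  - apply: nearW => N; apply/andP; split.
      by apply: esum_ge0 => n _; rewrite lee_fin sqr_ge0.
    apply: (@esum_int_le R (fun n => normc (\sum_(k < N) exp_term V t k n - v n) ^+ 2)).
      by move=> n; exact: sqr_ge0.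
    move=> n; have -> : 4 * tau N ^+ 2 / (1 + `|n|%:~R) ^+ 2 = (2 * (1 + `|n|%:~R)^-1 * tau N) ^+ 2.
      by rewrite !exprMn exprVn; ring.
    rewrite lerXn2r// ?nnegrE ?normc_ge0//.
      by rewrite !mulr_ge0// invr_ge0 addr_ge0.
    apply: (le_trans (Hv n N)); rewrite -/(tau N) ler_wpM2r// ler_wpM2l//.
    exact: pow2_inv_le.
  - exact: cvg_cst.
  - apply: cvg_EFin; first exact: nearW.
    have : (fun N => 4 * (4 * (tau N * tau N))) @ \oo --> (4 * (4 * (0 * 0)) : R).
      apply: cvgM; first exact: cvg_cst.
      apply: cvgM; first exact: cvg_cst.
      exact: cvgM.
    by rewrite !mulr0; apply.
have Hp : propagator phi alpha theta t (delta_seq 0) = v.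
  have E N n : \sum_(k < N) (k`!%:R)^-1 * iter k
     (fun u n => - ('i%C * t%:C) * schrodinger phi alpha theta u n) (delta_seq 0) n =
     \sum_(k < N) exp_term V t k n.
    apply: eq_bigr => k _; rewrite /exp_term -mulrA; congr (_ * _).
    exact: (iter_scaled_hop V).
  rewrite /propagator /op_exp; set P := (X in xget _ X).
  have Pv : P v by rewrite /P /=; under eq_fun do under eq_fun do rewrite E.
  apply: xget_unique => // w; rewrite /P /= => Hw.
  apply: (@l2_limit_unique (fun N n => \sum_(k < N) exp_term V t k n)) => //.
  by move: Hw; under eq_fun do under eq_fun do rewrite E.
move=> n; rewrite /amplitude Hp; congr (normc _ ^+ 2).
rewrite /ell2_dot; apply: (@norm_lim_near_cst _ R[i]^o) => //.
exists `|n|%N => // N /= nN.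
have j0P : (`|(n + N%:Z)%R|%N < N.*2.+1)%N by lia.
rewrite (bigD1 (Ordinal j0P)) //= big1 ?addr0.
  have -> : (`|(n + N%:Z)%R|%N : int) - N%:Z = n by lia.
  by rewrite /delta_seq eqxx rmorph1 mulr1.
move=> j; rewrite -val_eqE /= => jn; rewrite /delta_seq.
have -> : (j%:Z - N%:Z == n) = false by lia.
by rewrite rmorph0 mulr0.
Qed.
End propagator.

(** * Euler steps approximate the propagator *)
Section euler_expansion.
Context {R : realType}.
Implicit Types (V : int -> R) (u w : int -> R[i]) (t h Phi : R).

Lemma hop_sum V (I : Type) (r : seq I) (a : I -> R[i]) (w : I -> int -> R[i]) :
  hop V (fun n => \sum_(i <- r) a i * w i n) = (fun n => \sum_(i <- r) a i * hop V (w i) n).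
Proof.
apply/funext => n; rewrite /hop mulr_sumr -!big_split /=.
by apply: eq_bigr => i _; ring.
Qed.

Lemma iter_euler_binomial V h u j n :
  iter j (euler V h) u n =
  \sum_(k < j.+1) 'C(j, k)%:R * (- ('i * h%:C)) ^+ k * iter k (hop V) u n.
Proof.
set c := - ('i * h%:C).
suff -> : iter j (euler V h) u =
  (fun n => \sum_(k < j.+1) ('C(j, k)%:R * c ^+ k) * iter k (hop V) u n) by [].
elim: j => [|j IH]; first by apply/funext => m; rewrite big_ord1 bin0 expr0 !mul1r.
apply/funext => m; rewrite iterS IH /euler hop_sum -/c.
have -> (x y : R[i]) : x - 'i * h%:C * y = x + c * y by rewrite /c mulNr.
rewrite [RHS]big_ord_recl bin0 expr0 !mul1r /=.
under [in RHS]eq_bigr => i _ do rewrite /bump add1n binS natrD !mulrDl.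
rewrite big_split /= [X in _ + (X + _)]big_ord_recr /= bin_small// !mul0r addr0 !addrA.
congr (_ + _).
  rewrite big_ord_recl /= bin0 expr0 !mul1r; congr (_ + _).
rewrite mulr_sumr; apply: eq_bigr => i _; rewrite exprS; ring.
Qed.

Lemma falling_upper j k : (j ^_ k <= j ^ k)%N.
Proof. by elim: k => // k IH; rewrite ffactnSr expnSr leq_mul// leq_subr. Qed.

Lemma falling_lower j k : (j ^ k.+1 <= j * j ^_ k + k ^ 2 * j ^ k)%N.
Proof.
have [kj|jk] := leqP k j; last first.
  apply: leq_trans (leq_addl _ _); rewrite expnS leq_mul2r; apply/orP; right.
  by rewrite (leq_trans (ltnW jk))// -mulnn leq_pmulr// (leq_ltn_trans _ jk).
elim: k kj => [|k IH] kj; first by rewrite expn1 ffactn0 muln1 leq_addr.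
have := IH (ltnW kj); rewrite ffactnSr.
set f := (j ^_ k)%N; set p := (j ^ k)%N => H.
have -> : (j ^ k.+2 = j ^ k.+1 * j)%N by rewrite expnSr.
have e1 : (j ^ k.+1 = j * p)%N by rewrite expnS.
rewrite e1 in H *.
have : (j * p * (j - k) <= (j * f + k ^ 2 * p) * (j - k))%N by rewrite leq_mul2r H orbT.
have jk : (j = (j - k) + k)%N by lia.
set m := (j - k)%N in jk *; clearbody m p f; clear H e1; rewrite jk; nia.
Qed.

Lemma bin_coeff_bound (j k : nat) : (0 < j)%N ->
  `|'C(j, k)%:R / j%:R ^+ k - (k`!%:R)^-1| <= 4 ^+ k / (j%:R * k`!%:R) :> R.
Proof.
move=> j0; have jR : (0 : R) < j%:R by rewrite ltr0n.
have kR : (0 : R) < k`!%:R by rewrite ltr0n fact_gt0.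
have e : 'C(j, k)%:R = (j ^_ k)%:R / k`!%:R :> R.
  by apply: (mulIf (lt0r_neq0 kR)); rewrite -natrM bin_ffact mulfVK// gt_eqF.
have -> : 'C(j, k)%:R / j%:R ^+ k - (k`!%:R)^-1 =
   - ((j ^ k.+1)%:R - (j * j ^_ k)%:R) / (j%:R ^+ k.+1 * k`!%:R) :> R.
  rewrite e natrM natrX exprS; field.
  by rewrite !gt_eqF ?exprn_gt0.
rewrite normrM normrN normfV (gtr0_norm (_ : 0 < j%:R ^+ k.+1 * k`!%:R)) ?mulr_gt0 ?exprn_gt0//.
rewrite ger0_norm; last first.
  by rewrite subr_ge0 ler_nat expnS leq_mul2l falling_upper orbT.
rewrite ler_pdivrMr ?mulr_gt0 ?exprn_gt0//.
have -> : 4 ^+ k / (j%:R * k`!%:R) * (j%:R ^+ k.+1 * k`!%:R) = 4 ^+ k * j%:R ^+ k :> R.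
  by rewrite exprS; field; rewrite !gt_eqF.
rewrite lerBlDr -!natrX -natrM -natrD ler_nat.
apply: (leq_trans (falling_lower j k)); rewrite addnC leq_add2r leq_mul2r.
apply/orP; right; have -> : (4 ^ k = (2 ^ k) ^ 2)%N by rewrite -expnM mulnC expnM.
by rewrite leq_exp2r// ltnW// ltn_expl.
Qed.

(** Both the Taylor and the Euler approximations of the propagator expand in
    powers of the hopping operator; their coefficients differ by [O(1/j)]. *)
Lemma euler_cvg V Phi t (v : int -> R[i]) : (forall i, `|V i| <= Phi) -> 0 <= t ->
  (forall n N, normc (\sum_(k < N) exp_term V t k n - v n) <=
    2 * 2^-1 ^+ `|n|%N * (expR (t * (4 + Phi)) - \sum_(k < N) exp_coeff (t * (4 + Phi)) k)) ->
  forall e, 0 < e -> exists J : nat, forall j n, (J < j)%N ->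
    normc (iter j (euler V (t / j%:R)) (delta_seq 0) n - v n) <= e.
Proof.
move=> HV t0 Hv e e0.
have Phi0 : 0 <= Phi by apply: le_trans (HV 0).
set x := t * (4 + Phi) in Hv.
have x0 : 0 <= x by rewrite mulr_ge0// addr_ge0.
have half n : 2^-1 ^+ `|n|%N <= 1 :> R by apply: exprn_ile1; lra.
have [J1 _ HJ1] : \forall N \near \oo, expR x - \sum_(k < N) exp_coeff x k < e / 4.
  have := @sum_exp_coeff_cvg R x; move/cvgr_lt; apply; lra.
have [J2 HJ2] : exists J : nat, expR (4 * x) / (e / 2) < J%:R.
  by exists (Num.bound (expR (4 * x) / (e / 2))); apply: le_lt_trans (archi_boundP _);
     rewrite ?ler_norm// divr_ge0 ?expR_ge0//; lra.
exists (maxn J1 J2) => j n; rewrite gtn_max => /andP[j1 j2].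
have j0 : (0 < j)%N by exact: leq_trans j1.
have jR : (0 : R) < j%:R by rewrite ltr0n.
have -> : iter j (euler V (t / j%:R)) (delta_seq 0) n - v n =
  (iter j (euler V (t / j%:R)) (delta_seq 0) n - \sum_(k < j.+1) exp_term V t k n) +
  (\sum_(k < j.+1) exp_term V t k n - v n) by rewrite addrA subrK.
apply: (le_trans (le_normcD _ _)); rewrite (splitr e) lerD//; last first.
  apply: (le_trans (Hv n j.+1)).
  have h2 : expR x - \sum_(k < j.+1) exp_coeff x k < e / 4 by apply: HJ1; rewrite /= (leq_trans (ltnW j1)).
  have h3 : 0 <= expR x - \sum_(k < j.+1) exp_coeff x k by rewrite subr_ge0 sum_exp_coeff_le.
  apply: (@le_trans _ _ (2 * 1 * (e / 4))); last by lra.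
  by rewrite ler_pM// ?mulr_ge0// ?exprn_ge0 ?invr_ge0// ?ler_wpM2l// ltW.
rewrite iter_euler_binomial -sumrB; apply: (le_trans (normc_sum _ _ _)).
apply: (@le_trans _ _ (\sum_(k < j.+1) exp_coeff (4 * x) k / j%:R)).
  apply: ler_sum => k _; rewrite /exp_term -mulrBl normcM.
  have -> : 'C(j, k)%:R * (- ('i * (t / j%:R)%:C)) ^+ k - k`!%:R^-1 * (- ('i * t%:C)) ^+ k =
     ('C(j, k)%:R / j%:R ^+ k - (k`!%:R)^-1)%:C * (- ('i * t%:C)) ^+ k :> R[i].
    rewrite rmorphB /= !rmorphM !fmorphV rmorphXn /= !rmorph_nat mulrBl; congr (_ - _).
    rewrite -!mulNr !exprMn exprVn; ring.
  rewrite normcM normc_real normcX normcN normcM normci mul1r normc_real (ger0_norm t0).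
  have -> : exp_coeff (4 * x) k / j%:R = 4 ^+ k / (j%:R * k`!%:R) * t ^+ k * ((4 + Phi) ^+ k * 1).
    rewrite exp_coeffE !exprMn; field; rewrite gt_eqF// gt_eqF// ltr0n fact_gt0//.
  apply: ler_pM; rewrite ?normc_ge0 ?mulr_ge0 ?exprn_ge0 //.
    by rewrite ler_wpM2r ?exprn_ge0// bin_coeff_bound.
  apply: (le_trans (iter_hop_exp_bounded _ HV _)).
  by rewrite ler_wpM2l// exprn_ge0// addr_ge0.
rewrite -mulr_suml ler_pdivrMr//.
have := @sum_exp_coeff_le R (4 * x) j.+1; rewrite mulr_ge0// => /(_ isT) /le_trans; apply.
rewrite [leRHS]mulrC -ler_pdivrMr ?divr_gt0//.
by apply: ltW; apply: lt_le_trans HJ2 _; rewrite ler_nat ltnW.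
Qed.

End euler_expansion.

Ltac nneg := repeat first [ by [] | assumption | exact: expR_ge0 | exact: powR_ge0
  | exact: normc_ge0 | exact: sqr_ge0 | apply: mulr_ge0 | apply: addr_ge0
  | apply: exprn_ge0 | rewrite invr_ge0 ].

Section euler_norm.
Context {R : realType}.
Implicit Types (V : int -> R) (u w : int -> R[i]) (t h Phi : R).

Definition supp_in (b : nat) u := forall n, (b < `|n|)%N -> u n = 0.

(** Squared norm over the window [|i| <= B], exact for sequences supported there. *)
Definition sqn (B : nat) u : R := \sum_(i < B.*2.+1) normc (u (i%:Z - B%:Z)) ^+ 2.

Lemma telescope_int (f : int -> R) (a : int) m :
  \sum_(i < m) (f (a + i%:Z) - f (a + i%:Z - 1)) = f (a + m%:Z - 1) - f (a - 1).
Proof.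
elim: m => [|m IH]; first by rewrite big_ord0 addr0 subrr.
rewrite big_ord_recr IH /=.
have -> : a + m.+1%:Z - 1 = a + m%:Z by rewrite -[m.+1]addn1 PoszD addrA addrK.
by rewrite addrC addrA subrK.
Qed.

Lemma shift_sum (f : int -> R) (a : int) m :
  \sum_(i < m) f (a + i%:Z + 1) = \sum_(i < m) f (a + i%:Z) + f (a + m%:Z) - f a.
Proof.
apply/eqP; rewrite -subr_eq0 -addrA opprD addrA -sumrB subr_eq0; apply/eqP.
under eq_bigr => i _ do have -> : f (a + i%:Z) = f (a + i%:Z + 1 - 1) by rewrite addrK.
under eq_bigr => i _ do rewrite -[a + i%:Z + 1]addrA [i%:Z + 1]addrC addrA.
by rewrite (telescope_int f (a + 1)) addrK [a + 1 + _]addrAC addrK.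
Qed.

Lemma sqn_ge0 B u : 0 <= sqn B u.
Proof. by apply: sumr_ge0 => i _; exact: sqr_ge0. Qed.

Lemma sqn_ge B u n : (`|n| <= B)%N -> normc (u n) ^+ 2 <= sqn B u.
Proof.
move=> nB; have jP : (`|(n + B%:Z)%R|%N < B.*2.+1)%N by lia.
rewrite /sqn (bigD1 (Ordinal jP)) //=.
have -> : (`|(n + B%:Z)%R|%N : int) - B%:Z = n by lia.
by rewrite lerDl sumr_ge0// => i _; exact: sqr_ge0.
Qed.

Lemma supp_in_delta m : supp_in `|m|%N (delta_seq m : int -> R[i]).
Proof. by move=> n mn; rewrite /delta_seq (_ : (n == m) = false)//; lia. Qed.

Lemma supp_in_hop V b u : supp_in b u -> supp_in b.+1 (hop V u).
Proof.
by move=> Hu n bn; rewrite /hop !Hu ?mulr0 ?addr0//; lia.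
Qed.

Lemma supp_in_euler V h b u : supp_in b u -> supp_in b.+1 (euler V h u).
Proof.
move=> Hu n bn; rewrite /euler (supp_in_hop V Hu bn) mulr0 subr0 Hu//; lia.
Qed.

Lemma supp_in_iter_euler V h j b u : supp_in b u -> supp_in (b + j) (iter j (euler V h) u).
Proof.
move=> Hu; elim: j => [|j IH]; first by rewrite addn0.
by rewrite addnS iterS; exact: supp_in_euler.
Qed.

Lemma window_sum (f : int -> R) B :
  \sum_(i < B.*2.+1) f (i%:Z - B%:Z) = \sum_(i < B.*2.+1) f (- B%:Z + i%:Z).
Proof. by apply: eq_bigr => i _; rewrite addrC. Qed.

(** Hermitian symmetry of the hopping operator: the cross term
    [2 h Im <u, H u>] is a telescoping sum of currents. *)
Lemma sqn_euler V h b B u : supp_in b u -> (b <= B)%N ->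
  sqn B (euler V h u) = sqn B u + h ^+ 2 * sqn B (hop V u).
Proof.
move=> Hu bB; pose J n := complex.Im ((u n)^*%C * u (n + 1)).
have pt n : normc (euler V h u n) ^+ 2 =
    normc (u n) ^+ 2 + h ^+ 2 * normc (hop V u n) ^+ 2 + 2 * h * (J n - J (n - 1)).
  rewrite /J /euler /hop subrK; case: (u n) => a b'; case: (u (n + 1)) => c d.
  by case: (u (n - 1)) => e f; rewrite !sqr_normc2 /=; ring.
rewrite /sqn (eq_bigr _ (fun i _ => pt _)) !big_split /= -!mulr_sumr -[RHS]addr0; congr (_ + _).
rewrite (window_sum (fun n => J n - J (n - 1))) telescope_int.
have J0 (n : int) : (B < `|n|)%N || (B < `|(n + 1)%R|)%N -> J n = 0.
  move=> /orP[H|H]; rewrite /J (Hu _ (leq_ltn_trans bB H)) ?mulr0 ?mul0r//.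
  by rewrite conjc0 mul0r.
by rewrite !J0 ?subr0 ?mulr0//; lia.
Qed.

Lemma sqn_hop V Phi b B u : (forall i, `|V i| <= Phi) -> supp_in b u -> (b <= B)%N ->
  sqn B (hop V u) <= 3 * (2 + Phi ^+ 2) * sqn B u.
Proof.
move=> HV Hu bB.
have pt n : normc (hop V u n) ^+ 2 <= 3 * normc (u (n + 1)) ^+ 2 + 3 * normc (u (n - 1)) ^+ 2
   + 3 * Phi ^+ 2 * normc (u n) ^+ 2.
  have tri : normc (hop V u n) <= normc (u (n + 1)) + normc (u (n - 1)) + Phi * normc (u n).
    rewrite /hop; apply: (le_trans (le_normcD _ _)); apply: lerD; first exact: le_normcD.
    by rewrite normcM normc_real ler_wpM2r// normc_ge0.
  have sq (a b' c : R) : (a + b' + c) ^+ 2 <= 3 * a ^+ 2 + 3 * b' ^+ 2 + 3 * c ^+ 2.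
    rewrite -subr_ge0.
    have -> : 3 * a ^+ 2 + 3 * b' ^+ 2 + 3 * c ^+ 2 - (a + b' + c) ^+ 2 =
      (a - b') ^+ 2 + (a - c) ^+ 2 + (b' - c) ^+ 2 by ring.
    by rewrite !addr_ge0// sqr_ge0.
  apply: (@le_trans _ _ ((normc (u (n + 1)) + normc (u (n - 1)) + Phi * normc (u n)) ^+ 2)).
    by rewrite lerXn2r// nnegrE ?normc_ge0// (le_trans (normc_ge0 _) tri).
  apply: (le_trans (sq _ _ _)).
  by have -> : 3 * (Phi * normc (u n)) ^+ 2 = 3 * Phi ^+ 2 * normc (u n) ^+ 2 by ring.
apply: (@le_trans _ _ (\sum_(i < B.*2.+1) (3 * normc (u (i%:Z - B%:Z + 1)) ^+ 2
   + 3 * normc (u (i%:Z - B%:Z - 1)) ^+ 2 + 3 * Phi ^+ 2 * normc (u (i%:Z - B%:Z)) ^+ 2))).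
  by apply: ler_sum.
rewrite !big_split /= -!mulr_sumr -/(sqn B u).
have h1 : \sum_(i < B.*2.+1) normc (u (i%:Z - B%:Z + 1)) ^+ 2 <= sqn B u.
  rewrite (window_sum (fun n => normc (u (n + 1)) ^+ 2)) (shift_sum (fun n => normc (u n) ^+ 2)).
  rewrite -(window_sum (fun n => normc (u n) ^+ 2)) -/(sqn B u).
  rewrite (Hu (- B%:Z + B.*2.+1%:Z)) ?normc0 ?expr0n ?addr0 ?gerBl ?sqr_ge0//; lia.
have h2 : \sum_(i < B.*2.+1) normc (u (i%:Z - B%:Z - 1)) ^+ 2 <= sqn B u.
  have := shift_sum (fun n => normc (u (n - 1)) ^+ 2) (- B%:Z) B.*2.+1.
  rewrite -(window_sum (fun n => normc (u (n - 1)) ^+ 2)).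
  under eq_bigr => i _ do rewrite addrK.
  rewrite -(window_sum (fun n => normc (u n) ^+ 2)) -/(sqn B u) => ->.
  rewrite (Hu (- B%:Z - 1)) ?normc0 ?expr0n ?subr0 ?lerDl ?sqr_ge0//; lia.
have -> : 3 * (2 + Phi ^+ 2) * sqn B u = 3 * sqn B u + 3 * sqn B u + 3 * Phi ^+ 2 * sqn B u by ring.
by rewrite lerD2r lerD// ler_wpM2l.
Qed.

Definition C2 Phi : R := 3 * (2 + Phi ^+ 2).

Lemma C2_ge0 Phi : 0 <= C2 Phi.
Proof. by rewrite mulr_ge0// addr_ge0// sqr_ge0. Qed.

(** The first-order term in [h] drops out of the squared norm by symmetry. *)
Lemma sqn_iter_euler V Phi h b B j u : (forall i, `|V i| <= Phi) -> supp_in b u ->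
  (b + j <= B)%N ->
  sqn B u <= sqn B (iter j (euler V h) u) <= (1 + h ^+ 2 * C2 Phi) ^+ j * sqn B u.
Proof.
move=> HV Hu; elim: j => [|j IH] bB; first by rewrite expr0 mul1r lexx.
have /andP[IH1 IH2] := IH (leq_trans (leq_add (leqnn _) (leqnSn _)) bB).
have Hj : supp_in (b + j) (iter j (euler V h) u) by exact: supp_in_iter_euler.
have bj : (b + j <= B)%N by rewrite (leq_trans _ bB)// addnS.
rewrite iterS (sqn_euler V h Hj bj); apply/andP; split.
  by rewrite (le_trans IH1)// lerDl mulr_ge0 ?sqr_ge0 ?sqn_ge0.
have := sqn_hop HV Hj bj; rewrite -/(C2 Phi) => H.
apply: (@le_trans _ _ ((1 + h ^+ 2 * C2 Phi) * sqn B (iter j (euler V h) u))).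
  by rewrite mulrDl mul1r lerD2l -mulrA ler_wpM2l ?sqr_ge0.
by rewrite (exprS _ j) -[leRHS]mulrA ler_wpM2l// addr_ge0// mulr_ge0 ?sqr_ge0 ?C2_ge0.
Qed.

Lemma sqn_delta B m : (`|m| <= B)%N -> sqn B (delta_seq m) = 1.
Proof.
move=> mB; have jP : (`|(m + B%:Z)%R|%N < B.*2.+1)%N by lia.
rewrite /sqn (bigD1 (Ordinal jP)) //= /delta_seq.
have -> : (`|(m + B%:Z)%R|%N : int) - B%:Z = m by lia.
rewrite eqxx normc1 expr1n big1 ?addr0// => i; rewrite -val_eqE /= => H.
by rewrite (_ : (i%:Z - B%:Z == m) = false) ?normc0 ?expr0n//; lia.
Qed.

Lemma hopB V u w : hop V (fun n => u n - w n) = (fun n => hop V u n - hop V w n).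
Proof. by apply/funext => n; rewrite /hop; ring. Qed.

(** The defect between a step and two half steps is of second order. *)
Lemma euler_half V h u n : euler V h u n =
  euler V (h / 2) (euler V (h / 2) u) n + (h ^+ 2 / 4)%:C * hop V (hop V u) n.
Proof.
have -> : (h ^+ 2 / 4)%:C = - ('i * (h / 2)%:C) ^+ 2.
  rewrite exprMn sqr_i mulN1r opprK -rmorphXn /=; congr (_%:C); field.
  by [].
have e : h%:C = (h / 2)%:C + (h / 2)%:C by rewrite -rmorphD /= -splitr.
set c := 'i * (h / 2)%:C.
have E w m : euler V (h / 2) w m = w m - c * hop V w m by [].
rewrite [RHS]addrC E.
have -> : hop V (euler V (h / 2) u) n = hop V u n - c * hop V (hop V u) n.
  by rewrite /euler -/c hopB hop_scale.
have ec : 'i * h%:C = c + c by rewrite /c e mulrDr.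
have -> : euler V h u n = u n - (c + c) * hop V u n by rewrite -ec.
by rewrite !E; ring.
Qed.

Lemma sqr_normcD_le (s : R) (x y : R[i]) : 0 < s ->
  normc (x + y) ^+ 2 <= (1 + s) * normc x ^+ 2 + (1 + s^-1) * normc y ^+ 2.
Proof.
move=> s0; apply: (@le_trans _ _ ((normc x + normc y) ^+ 2)).
  by rewrite lerXn2r// ?nnegrE ?addr_ge0 ?normc_ge0// le_normcD.
rewrite -subr_ge0.
have -> : (1 + s) * normc x ^+ 2 + (1 + s^-1) * normc y ^+ 2 - (normc x + normc y) ^+ 2 =
  s^-1 * (s * normc x - normc y) ^+ 2 by field; rewrite gt_eqF.
by rewrite mulr_ge0 ?sqr_ge0// invr_ge0 ltW.
Qed.

Lemma pow_le_expR (a : R) (j i : nat) : 0 <= a -> (i <= j)%N -> (1 + a) ^+ i <= expR (a * j%:R).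
Proof.
move=> a0 ij; apply: (@le_trans _ _ ((1 + a) ^+ j)).
  by apply: ler_weXn2l => //; rewrite lerDl.
by rewrite mulrC expRM_natl lerXn2r ?nnegrE ?addr_ge0 ?expR_ge0// expR_ge1Dx.
Qed.

(** The defects of the [j] pairs of half steps are added up in square norm; the
    weights [1 + 1/j] and [1 + j] of the two terms keep the accumulated factor
    bounded. *)
Lemma euler_doubling V Phi (j : nat) h n m : (forall i, `|V i| <= Phi) -> (0 < j)%N -> 0 <= h ->
  j%:R * h ^+ 2 * C2 Phi <= 1 ->
  normc (iter j (euler V h) (delta_seq m) n - iter j.*2 (euler V (h / 2)) (delta_seq m) n)
  <= j%:R * h ^+ 2 * C2 Phi * expR 2.
Proof.
move=> HV j0 h0 hsmall.
have jR : (1 : R) <= j%:R by rewrite ler1n.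
have c0 := C2_ge0 Phi.
pose B := (`|n| + `|m| + j.*2 + 4)%N.
pose w i := iter i (euler V h) (delta_seq m : int -> R[i]).
pose w' i := iter i.*2 (euler V (h / 2)) (delta_seq m : int -> R[i]).
pose d i := (fun n => w i n - w' i n) : int -> R[i].
set c := C2 Phi in hsmall c0 *.
pose q := (1 + j%:R^-1) * (1 + h ^+ 2 * c).
have q1 : 1 <= q.
  have h1 : 1 <= 1 + j%:R^-1 :> R by rewrite lerDl invr_ge0.
  have h2 : 1 <= 1 + h ^+ 2 * c by rewrite lerDl mulr_ge0 ?sqr_ge0.
  rewrite /q; nra.
have K1 : (1 + h ^+ 2 * c) ^+ j <= expR 1.
  apply: (le_trans (@pow_le_expR _ j j _ _)) => //; first by rewrite mulr_ge0 ?sqr_ge0.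
  by rewrite ler_expR; lra.
have qj : q ^+ j <= expR 2.
  rewrite /q exprMn.
  have -> : expR 2 = expR 1 * expR 1 :> R by rewrite -expRD.
  apply: ler_pM => //.
  - by rewrite exprn_ge0// addr_ge0// mulr_ge0 ?sqr_ge0.
  apply: (le_trans (@pow_le_expR _ j j _ _)) => //.
  by rewrite mulVf// gt_eqF// ltr0n.
have Sw' i : (i <= j)%N -> supp_in (`|m| + i.*2) (w' i) by move=> _; exact/supp_in_iter_euler/supp_in_delta.
have Sw i : (i <= j)%N -> supp_in (`|m| + i) (w i) by move=> _; exact/supp_in_iter_euler/supp_in_delta.
have Sd i : (i <= j)%N -> supp_in (`|m| + i.*2) (d i).
  move=> ij k kb; rewrite /d (Sw i ij) ?(Sw' i ij) ?subrr//.
  by apply: leq_ltn_trans kb; rewrite leq_add2l -addnn leq_addr.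
have nw' i : (i <= j)%N -> sqn B (w' i) <= expR 1.
  move=> ij; have /andP[_] := @sqn_iter_euler V Phi (h / 2) `|m|%N B i.*2 (delta_seq m) HV
    (@supp_in_delta m) (ltac:(rewrite /B; lia)).
  move=> /le_trans; apply; rewrite sqn_delta; last by rewrite /B; lia.
  rewrite mulr1; apply: (le_trans (@pow_le_expR _ j.*2 i.*2 _ _)).
  - by rewrite mulr_ge0 ?sqr_ge0.
  - by rewrite leq_double.
  rewrite ler_expR -/c -muln2 natrM; have -> : (h / 2) ^+ 2 * c * (j%:R * 2) = j%:R * h ^+ 2 * c / 2 by field.
  lra.
pose D := (1 + j%:R) * (h ^+ 4 / 16 * c ^+ 2 * expR 1).
have D0 : 0 <= D.
  by rewrite /D; nneg.
have step i : (i < j)%N -> sqn B (d i.+1) <= q * sqn B (d i) + D.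
  move=> ij.
  have dE k : d i.+1 k = euler V h (d i) k + (h ^+ 2 / 4)%:C * hop V (hop V (w' i)) k.
    have -> : euler V h (d i) k = euler V h (w i) k - euler V h (w' i) k.
      by rewrite /euler /d hopB; ring.
    rewrite (euler_half V h (w' i)).
    have -> : d i.+1 k = euler V h (w i) k - euler V (h / 2) (euler V (h / 2) (w' i)) k by [].
    by ring.
  apply: (@le_trans _ _ (\sum_(l < B.*2.+1) ((1 + j%:R^-1) * normc (euler V h (d i) (l%:Z - B%:Z)) ^+ 2
     + (1 + j%:R) * (h ^+ 4 / 16) * normc (hop V (hop V (w' i)) (l%:Z - B%:Z)) ^+ 2))).
    apply: ler_sum => l _; rewrite dE; apply: (le_trans (@sqr_normcD_le j%:R^-1 _ _ _)).
      by rewrite invr_gt0 ltr0n.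
    rewrite lerD2l invrK normcM normc_real exprMn real_normK ?num_real//.
    have -> : (h ^+ 2 / 4) ^+ 2 = h ^+ 4 / 16 by field.
    by rewrite [leLHS]mulrA.
  rewrite big_split /= -!mulr_sumr; apply: lerD.
    rewrite /q -mulrA ler_wpM2l ?addr_ge0 ?invr_ge0//.
    have Bi : (`|m| + i.*2 <= B)%N by rewrite /B; clear -ij; lia.
    rewrite -/(sqn B (euler V h (d i))) (sqn_euler V h (Sd i (ltnW ij)) Bi) mulrDl mul1r lerD2l.
    by rewrite -[leRHS]mulrA ler_wpM2l ?sqr_ge0// (sqn_hop HV (Sd i (ltnW ij)) Bi).
  have -> : D = (1 + j%:R) * (h ^+ 4 / 16) * (c * (c * expR 1)) by rewrite /D; ring.
  rewrite ler_wpM2l//; first by nneg.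
  rewrite -/(sqn B (hop V (hop V (w' i)))).
  have Bi : (`|m| + i.*2 <= B)%N by rewrite /B; clear -ij; lia.
  have Bi1 : ((`|m| + i.*2).+1 <= B)%N by rewrite /B; clear -ij; lia.
  have S1 := supp_in_hop V (Sw' i (ltnW ij)).
  apply: (le_trans (sqn_hop HV S1 Bi1)); rewrite -/(C2 Phi) -/c ler_wpM2l//.
  apply: (le_trans (sqn_hop HV (Sw' i (ltnW ij)) Bi)); rewrite -/(C2 Phi) -/c ler_wpM2l//.
  exact: nw' (ltnW ij).
have main i : (i <= j)%N -> sqn B (d i) <= i%:R * D * q ^+ i.
  elim: i => [_|i IH ij].
    rewrite !mul0r /sqn big1// => l _; rewrite /d /w /w' /= subrr normc0 expr0n //.
  apply: (le_trans (step i ij)).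
  apply: (@le_trans _ _ (q * (i%:R * D * q ^+ i) + D)).
    by rewrite lerD2r ler_wpM2l ?(le_trans _ q1) // IH// ltnW.
  have -> : i.+1%:R * D * q ^+ i.+1 = q * (i%:R * D * q ^+ i) + D * q ^+ i.+1.
    by rewrite -natr1 exprS; ring.
  by rewrite lerD2l ler_peMr// exprn_ege1.
have := main j (leqnn _) => Hj.
have nB : (`|n| <= B)%N by rewrite /B; clear; lia.
have := le_trans (sqn_ge (d j) nB) Hj => {}Hj.
have e3 : expR 2 * expR 1 <= expR 2 ^+ 2 :> R.
  by rewrite expr2 ler_wpM2l ?expR_ge0// ler_expR; lra.
rewrite -(@ler_pXn2r _ 2)// ?nnegrE ?normc_ge0//; last first.
  by nneg.
apply: (le_trans Hj).
apply: (@le_trans _ _ (j%:R * D * expR 2)).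
  by rewrite ler_wpM2l// mulr_ge0.
apply: (@le_trans _ _ (j%:R * (1 + j%:R) * (h ^+ 4 / 16) * c ^+ 2 * expR 2 ^+ 2)).
  rewrite /D.
  have -> : j%:R * ((1 + j%:R) * (h ^+ 4 / 16 * c ^+ 2 * expR 1)) * expR 2 =
    j%:R * (1 + j%:R) * (h ^+ 4 / 16) * c ^+ 2 * (expR 2 * expR 1) by ring.
  by rewrite ler_wpM2l//; nneg.
have -> : (j%:R * h ^+ 2 * c * expR 2) ^+ 2 = j%:R * (16 * j%:R) * (h ^+ 4 / 16) * c ^+ 2 * expR 2 ^+ 2.
  by field.
do 3! (apply: ler_wpM2r; first by nneg).
by apply: ler_wpM2l => //; lra.
Qed.

End euler_norm.

Section euler_limit.
Context {R : realType}.
Implicit Types (V : int -> R) (u w : int -> R[i]) (t h Phi : R).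

(** Halving the step again and again sums a geometric series of errors. *)
Lemma euler_approx V Phi t (j : nat) (v : int -> R[i]) n :
  (forall i, `|V i| <= Phi) -> (0 < j)%N -> 0 <= t ->
  (forall e, 0 < e -> exists J : nat, forall j n, (J < j)%N ->
    normc (iter j (euler V (t / j%:R)) (delta_seq 0) n - v n) <= e) ->
  j%:R * (t / j%:R) ^+ 2 * C2 Phi <= 1 ->
  normc (iter j (euler V (t / j%:R)) (delta_seq 0) n - v n)
    <= 2 * (j%:R * (t / j%:R) ^+ 2 * C2 Phi * expR 2).
Proof.
move=> HV j0 t0 Hv small; set h := t / j%:R in small *.
have jR : (0 : R) < j%:R by rewrite ltr0n.
have h0 : 0 <= h by rewrite /h divr_ge0.
set a := j%:R * h ^+ 2 * C2 Phi in small *.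
have a0 : 0 <= a by rewrite /a; have := C2_ge0 Phi => ?; nneg.
have hs s : h / 2 ^+ s = t / (j * 2 ^ s)%:R.
  by rewrite /h natrM natrX invfM mulrA.
have step s : normc (iter j (euler V h) (delta_seq 0) n -
    iter (j * 2 ^ s) (euler V (h / 2 ^+ s)) (delta_seq 0) n) <= a * expR 2 * (2 - 2 * 2^-1 ^+ s).
  elim: s => [|s IH].
    by rewrite expn0 muln1 expr0 divr1 subrr normc0 expr0 mulr1 subrr mulr0.
  have -> : iter j (euler V h) (delta_seq 0) n -
    iter (j * 2 ^ s.+1) (euler V (h / 2 ^+ s.+1)) (delta_seq 0) n =
    (iter j (euler V h) (delta_seq 0) n - iter (j * 2 ^ s) (euler V (h / 2 ^+ s)) (delta_seq 0) n)
    + (iter (j * 2 ^ s) (euler V (h / 2 ^+ s)) (delta_seq 0) n -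
     iter (j * 2 ^ s).*2 (euler V (h / 2 ^+ s / 2)) (delta_seq 0) n).
    rewrite addrA subrK expnS mulnCA mul2n; congr (_ - iter _ (euler V _) _ _).
    by rewrite exprSr invfM mulrA.
  have E : (j * 2 ^ s)%:R * (h / 2 ^+ s) ^+ 2 * C2 Phi = a * 2^-1 ^+ s.
    have p0 : (2 : R) ^+ s != 0 by rewrite expf_neq0.
    by rewrite /a natrM natrX exprVn; field.
  have sl : (2^-1 : R) ^+ s <= 1 by apply: exprn_ile1; lra.
  have s0 : 0 <= (2^-1 : R) ^+ s by nneg.
  apply: (le_trans (le_normcD _ _)); apply: (le_trans (lerD IH (@euler_doubling _ V Phi _ _ _ _ HV _ _ _))).
  - by rewrite muln_gt0 j0 expn_gt0.
  - by nneg.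
  - by rewrite E; nra.
  - rewrite E exprS le_eqVlt; apply/orP; left; apply/eqP; by field.
apply/ler_addgt0Pr => e e0; have [J HJ] := Hv e e0.
have Jj : (J < j * 2 ^ J)%N by rewrite (leq_trans (ltn_expl J (ltnSn 1)))// leq_pmull.
have := HJ _ n Jj; rewrite -hs => H2.
have -> : iter j (euler V h) (delta_seq 0) n - v n =
  (iter j (euler V h) (delta_seq 0) n - iter (j * 2 ^ J) (euler V (h / 2 ^+ J)) (delta_seq 0) n)
  + (iter (j * 2 ^ J) (euler V (h / 2 ^+ J)) (delta_seq 0) n - v n) by rewrite addrA subrK.
apply: (le_trans (le_normcD _ _)); apply: lerD => //.
apply: (le_trans (step J)); rewrite mulrC ler_wpM2r//; first by nneg.
by rewrite gerBl; nneg.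
Qed.

Lemma iter_euler_linear V h j (c a : R[i]) (u w1 w2 w3 : int -> R[i]) n :
  iter j (euler V h) (fun n => u n - c * (w1 n + w2 n + a * w3 n)) n =
  iter j (euler V h) u n - c * (iter j (euler V h) w1 n + iter j (euler V h) w2 n
     + a * iter j (euler V h) w3 n).
Proof.
have -> : iter j (euler V h) (fun n => u n - c * (w1 n + w2 n + a * w3 n)) = (fun n =>
  iter j (euler V h) u n - c * (iter j (euler V h) w1 n + iter j (euler V h) w2 n
     + a * iter j (euler V h) w3 n)).
  elim: j => // j IH; apply/funext => k; rewrite !iterS IH /euler /hop; ring.
by [].
Qed.

(** The operator is a symmetric matrix, and powers of a symmetric matrix are
    symmetric. *)
Lemma euler_kernel_sym V h j x y :
  iter j (euler V h) (delta_seq x) y = iter j (euler V h) (delta_seq y) x.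
Proof.
elim: j x y => [|j IH] x y; first by rewrite /= /delta_seq eq_sym.
rewrite iterSr.
have -> : euler V h (delta_seq x) = (fun n => delta_seq x n - 'i * h%:C *
    (delta_seq (x - 1) n + delta_seq (x + 1) n + (V x)%:C * delta_seq x n)).
  apply/funext => n; rewrite /euler /hop /delta_seq; congr (_ - _ * (_ + _ + _)).
  - by rewrite (_ : (n + 1 == x) = (n == x - 1))//; lia.
  - by rewrite (_ : (n - 1 == x) = (n == x + 1))//; lia.
  - by have [->|] := eqVneq n x; rewrite ?mulr0.
rewrite iter_euler_linear iterS {1}/euler /hop.
by rewrite (IH x) (IH (x - 1)) (IH (x + 1)) [X in _ * (X + _)]addrC.
Qed.

Definition refl {T : Type} (u : int -> T) : int -> T := fun n => u (- n).

Lemma euler_refl V h j x n :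
  iter j (euler (refl V) h) (delta_seq (- x)) n = iter j (euler V h) (delta_seq x) (- n).
Proof.
have -> : iter j (euler (refl V) h) (delta_seq (- x)) = refl (iter j (euler V h) (delta_seq x)).
  elim: j => [|j IH].
    apply/funext => k; rewrite /refl /= /delta_seq.
    by rewrite (_ : (k == - x) = (- k == x))//; lia.
  apply/funext => k; rewrite !iterS IH /refl /euler /hop; congr (_ - _ * (_ + _)).
  by rewrite addrC; congr (_ + _); congr (iter _ _ _ _); lia.
by [].
Qed.

End euler_limit.

(** * Dirichlet determinants control the resolvent *)
Section dirichlet.
Context {R : realType}.
Implicit Types (V : int -> R) (u w g s : int -> R[i]) (h Phi y : R) (z : R[i]).

(** Characteristic polynomial of the Dirichlet restriction of the operator to
    [[a, a + k - 1]], by the continuant recursion. *)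
Fixpoint dirdet V z (a : int) (k : nat) : R[i] :=
  if k is k'.+1 then
    if k' is k''.+1 then
      (z - (V (a + k'%:Z))%:C) * dirdet V z a k' - dirdet V z a k''
    else z - (V a)%:C
  else 1.

Lemma dirdet0 V z a : dirdet V z a 0 = 1. Proof. by []. Qed.
Lemma dirdet1 V z a : dirdet V z a 1 = z - (V a)%:C. Proof. by []. Qed.
Lemma dirdetSS V z a k : dirdet V z a k.+2 =
  (z - (V (a + k.+1%:Z))%:C) * dirdet V z a k.+1 - dirdet V z a k.
Proof. by []. Qed.

Lemma nat_ind2 (P : nat -> Prop) : P 0%N -> P 1%N ->
  (forall k, P k -> P k.+1 -> P k.+2) -> forall k, P k.
Proof.
move=> P0 P1 PS k; suff: P k /\ P k.+1 by case.
by elim: k => [//|k [Pk Pk1]]; split => //; exact: PS.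
Qed.

(** The recursion can be run from the left end as well as from the right end. *)
Lemma dirdet_left V z a k : dirdet V z a k.+2 =
  (z - (V a)%:C) * dirdet V z (a + 1) k.+1 - dirdet V z (a + 2) k.
Proof.
elim/nat_ind2: k => [||k IH1 IH2].
- by rewrite dirdetSS !dirdet1 !dirdet0 mulrC.
- rewrite dirdetSS dirdetSS (dirdetSS V z (a + 1) 0) !dirdet1 !dirdet0.
  have -> : a + 2%:Z = a + 1 + 1%:Z by rewrite -addrA.
  by ring.
rewrite dirdetSS IH2 IH1 (dirdetSS V z (a + 1) k.+1) (dirdetSS V z (a + 2) k).
have -> : a + k.+3%:Z = a + 1 + k.+2%:Z by rewrite -addrA; congr (_ + _); lia.
have -> : a + 2 + k.+1%:Z = a + 1 + k.+2%:Z by rewrite -!addrA; congr (_ + _); lia.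
by ring.
Qed.

Lemma dirdet_refl V z a k : dirdet (refl V) z (- (a + k%:Z - 1)) k = dirdet V z a k.
Proof.
elim/nat_ind2: k a => [//||k IH1 IH2] a.
  by rewrite !dirdet1 /refl opprK; congr (_ - (V _)%:C); lia.
rewrite dirdet_left dirdetSS -IH1 -IH2 /refl opprK; congr ((z - (V _)%:C) * _ - _).
- lia.
- by congr dirdet; lia.
- by congr dirdet; lia.
Qed.

Lemma normc_dirdet_le V Phi z (K : R) a k : (forall i, `|V i| <= Phi) -> normc z <= K ->
  normc (dirdet V z a k) <= (K + Phi + 1) ^+ k.
Proof.
move=> HV Hz.
have K0 : 0 <= K by exact: le_trans (normc_ge0 _) Hz.
have P0 : 0 <= Phi by apply: le_trans (HV 0).
have zV i : normc (z - (V i)%:C) <= K + Phi.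
  by apply: (le_trans (le_normcD _ _)); rewrite normcN normc_real lerD.
elim/nat_ind2: k => [||k IH1 IH2]; first by rewrite normc1 expr0.
  by rewrite expr1 dirdet1 (le_trans (zV a))// lerDl.
rewrite dirdetSS; apply: (le_trans (le_normcD _ _)); rewrite normcN normcM.
have X0 : 0 <= (K + Phi + 1) ^+ k by nneg.
have X1 : (K + Phi + 1) ^+ k <= (K + Phi + 1) ^+ k.+1.
  by rewrite exprS ler_peMl// lerDr addr_ge0.
apply: (@le_trans _ _ ((K + Phi) * (K + Phi + 1) ^+ k.+1 + (K + Phi + 1) ^+ k.+1)).
  by apply: lerD; [apply: ler_pM => //; exact: normc_ge0|exact: le_trans X1].
by rewrite (exprS _ k.+1) [leRHS]mulrDl mul1r.
Qed.

(** The solution of the eigenvalue equation with Dirichlet data at the right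
    end of [a, a + k - 1], extended by 0. *)
Definition dirsol V z a k (i : nat) : R[i] :=
  if (i <= k)%N then dirdet V z (a + i%:Z) (k - i) else 0.

Lemma dirsol_rec V z a k i : (i < k)%N -> dirsol V z a k i =
  (z - (V (a + i%:Z))%:C) * dirsol V z a k i.+1 - dirsol V z a k i.+2.
Proof.
move=> ik; rewrite /dirsol ik (ltnW ik).
case: (ltnP i.+1 k) => [i1k|ki1].
  have [e1 e2] : (k - i = (k - i.+2).+2)%N /\ (k - i.+1 = (k - i.+2).+1)%N by lia.
  rewrite e1 e2 dirdet_left; congr (_ * dirdet _ _ _ _ - dirdet _ _ _ _); lia.
have [-> ->] : (k - i = 1)%N /\ (k - i.+1 = 0)%N by lia.
by rewrite dirdet1 dirdet0 mulr1 subr0.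
Qed.

(** Going left from the zero boundary value, each site adds [Im z] times its
    squared modulus to the current. *)
Lemma dirsol_current V z a k i : 0 <= complex.Im z -> (i <= k)%N ->
  0 <= complex.Im (dirsol V z a k i * (dirsol V z a k i.+1)^*%C).
Proof.
move=> z0; move: {2}(k - i)%N (erefl (k - i)%N) => l; elim: l i => [|l IH] i e ik.
  have -> : i = k by lia.
  by rewrite {2}/dirsol ltnn conjc0 mulr0.
have ik' : (i < k)%N by lia.
have := IH i.+1 ltac:(lia) ik'; rewrite (dirsol_rec V z a ik').
case: (dirsol V z a k i.+1) => p q; case: (dirsol V z a k i.+2) => p' q'.
case: z z0 {IH} => zr zi /=; simpc => z0 H.
rewrite (_ : _ + _ = zi * (p ^+ 2 + q ^+ 2) + (p * - q' + q * p')); last by ring.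
by rewrite mulrN; apply: addr_ge0 => //; apply: mulr_ge0 => //; apply: addr_ge0; exact: sqr_ge0.
Qed.

(** After multiplication by the conjugate of [x0 * f0], the two terms of the
    Wronskian have nonnegative imaginary parts and cannot cancel. *)
Lemma wronskian_lower (x0 x1 f0 f1 : R[i]) y : 0 <= y ->
  y * normc x0 ^+ 2 <= complex.Im (x1 * x0^*%C) -> 0 <= complex.Im (f0 * f1^*%C) ->
  y * (normc x0 * normc f0) <= normc (x1 * f0 - x0 * f1).
Proof.
move=> y0 Hx Hf.
have [e|ne] := eqVneq (normc x0 * normc f0) 0; first by rewrite e mulr0 normc_ge0.
have p0 : 0 < normc x0 * normc f0 by rewrite lt_neqAle eq_sym ne mulr_ge0 ?normc_ge0.
rewrite -(ler_pM2r p0).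
apply: (@le_trans _ _ (complex.Im ((x1 * f0 - x0 * f1) * (x0 * f0)^*%C))); last first.
  apply: (le_trans (ler_norm _)); apply: (le_trans (ler_Im_normc _)).
  by rewrite normcM normc_conj normcM.
have -> : complex.Im ((x1 * f0 - x0 * f1) * (x0 * f0)^*%C) =
   complex.Im (x1 * x0^*%C) * normc f0 ^+ 2 + normc x0 ^+ 2 * complex.Im (f0 * f1^*%C).
  move: x0 x1 f0 f1 {Hx Hf ne p0} => [a b] [c d] [e f] [g l].
  by rewrite !sqr_normc2 /=; simpc; ring.
have -> : y * (normc x0 * normc f0) * (normc x0 * normc f0) = y * normc x0 ^+ 2 * normc f0 ^+ 2 + 0.
  by ring.
by apply: lerD; [rewrite ler_wpM2r ?sqr_ge0|rewrite mulr_ge0 ?sqr_ge0].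
Qed.

Section green.
Variables (V : int -> R) (E y G sb F kappa : R) (g s : int -> R[i]) (S n k a : nat).
Let z : R[i] := E +i* y.
Hypotheses (y0 : 0 < y) (gS : supp_in S g).
Hypothesis eqn : forall i : int, (i < n%:Z) -> hop V g i - z * g i = s i.
Hypotheses (gG : forall i, normc (g i) <= G) (sbd : forall i : int, i < n%:Z -> normc (s i) <= sb).
Hypotheses (a1 : (1 <= a)%N) (akn : (a + k <= n)%N).
Hypothesis FB : forall i, (i <= k)%N -> normc (dirdet V z (a%:Z + i%:Z) (k - i)) <= F.
Hypotheses (k0 : 0 < kappa) (gk : kappa <= normc (g 0)).
Hypothesis small1 : (S + n)%:R * (sb * G) <= y * kappa ^+ 2 / 2.
Hypothesis small2 : k%:R * (sb * F) <= G.

Let J (i : int) := complex.Im (g (i + 1) * (g i)^*%C).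

Let n0 : (0%:Z < n%:Z)%R. Proof. lia. Qed.
Let G0 : 0 <= G. Proof. exact: le_trans (normc_ge0 _) (gG 0). Qed.
Let s0 : 0 <= sb. Proof. exact: le_trans (normc_ge0 _) (sbd n0). Qed.

Let Jstep i : i < n%:Z -> y * normc (g i) ^+ 2 - sb * G <= J i - J (i - 1).
Proof.
move=> ilt; have e : g (i + 1) = s i - g (i - 1) - (V i)%:C * g i + z * g i.
  by rewrite -(eqn ilt) /hop; ring.
have -> : J i - J (i - 1) = y * normc (g i) ^+ 2 + complex.Im (s i * (g i)^*%C).
  rewrite /J subrK e sqr_normc2 /z.
  by case: (g i) => p q; case: (g (i - 1)) => p' q'; case: (s i) => p2 q2; rewrite /=; ring.
rewrite lerD2l lerNl; apply: (le_trans (ler_norm _)); rewrite normrN.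
apply: (le_trans (ler_Im_normc _)); rewrite normcM normc_conj.
by apply: ler_pM; rewrite ?normc_ge0 ?sbd.
Qed.

(* The mass of [g] left of the interval contains its values at 0 and at [a - 1]. *)
Let J_lower : y * kappa ^+ 2 / 2 <= J (a%:Z - 1) /\
  y / 2 * normc (g (a%:Z - 1)) ^+ 2 <= J (a%:Z - 1).
Proof.
have := telescope_int J (- S%:Z) (S + a).
have -> : J (- S%:Z - 1) = 0.
  by rewrite /J (gS (_ : (S < `|- S%:Z - 1|)%N)) ?conjc0 ?mulr0//; lia.
have -> : - S%:Z + (S + a)%:Z - 1 = a%:Z - 1 by lia.
rewrite subr0 => JE.
pose X := \sum_(l < S + a) normc (g (- S%:Z + l%:Z)) ^+ 2.
have H1 : y * X - y * kappa ^+ 2 / 2 <= J (a%:Z - 1).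
  rewrite -JE; apply: (@le_trans _ _ (\sum_(l < S + a) (y * normc (g (- S%:Z + l%:Z)) ^+ 2 - sb * G))).
    rewrite sumrB -mulr_sumr lerB// big_const_ord iter_addr_0 -[leLHS]mulr_natl.
    apply: le_trans small1; apply: ler_wpM2r; first by nneg.
    by rewrite ler_nat leq_add2l (leq_trans _ akn)// leq_addr.
  by apply: ler_sum => l _; apply: Jstep; have := ltn_ord l; lia.
have ge0 (l : 'I_(S + a)) : normc (g (- S%:Z + l%:Z)) ^+ 2 <= X.
  by rewrite /X (bigD1 l)//= lerDl sumr_ge0// => i _; exact: sqr_ge0.
have l0 : (S < S + a)%N by clear -a1; lia.
have := ge0 (Ordinal l0); rewrite /= addrC subrr => X1.
have l1 : (S + a.-1 < S + a)%N by clear -a1; lia.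
have := ge0 (Ordinal l1); rewrite /=.
have -> : - S%:Z + (S + a.-1)%:Z = a%:Z - 1 by clear -a1; lia.
move=> X2.
have kX : kappa ^+ 2 <= X by apply: le_trans X1; rewrite lerXn2r// nnegrE ?normc_ge0// ltW.
have yk : y * kappa ^+ 2 <= y * X by rewrite ler_wpM2l// ltW.
have yg : y * normc (g (a%:Z - 1)) ^+ 2 <= y * X by rewrite ler_wpM2l// ltW.
move: H1 yk yg; set c1 := y * X; set c2 := y * kappa ^+ 2.
rewrite (mulrAC y 2^-1); set c3 := y * normc _ ^+ 2; move=> *; split; lra.
Qed.

Let f := dirsol V z a%:Z k.

Let w (i : nat) := g (a%:Z + i%:Z) * f i - g (a%:Z + i%:Z - 1) * f i.+1.

Let w0_le : normc (w 0) <= 2 * G.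
Proof.
have wk : normc (w k) <= G.
  by rewrite /w /f /dirsol leqnn ltnn subnn dirdet0 mulr1 mulr0 subr0.
have st i : (i < k)%N -> normc (w i - w i.+1) <= sb * F.
  move=> ik; have ilt : a%:Z + i%:Z < n%:Z.
    by rewrite -PoszD ltz_nat (leq_trans _ akn)// ltn_add2l.
  have -> : w i - w i.+1 = - (s (a%:Z + i%:Z) * f i.+1).
    rewrite -(eqn ilt) /hop /w /f (dirsol_rec V z a ik).
    have -> : a%:Z + i.+1%:Z = a%:Z + i%:Z + 1 by rewrite -[i.+1]addn1 PoszD addrA.
    by rewrite addrK; ring.
  rewrite normcN normcM; apply: ler_pM; rewrite ?normc_ge0 ?sbd//.
  by rewrite /f /dirsol ik FB.
have H i : (i <= k)%N -> normc (w (k - i)) <= G + i%:R * (sb * F).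
  elim: i => [_|i IH ik]; first by rewrite subn0 mul0r addr0.
  have -> : w (k - i.+1) = (w (k - i.+1) - w (k - i.+1).+1) + w (k - i).
    by rewrite subnSK// subrK.
  apply: (le_trans (le_normcD _ _)); rewrite -natr1 mulrDl mul1r addrA [leRHS]addrC.
  by apply: lerD; [apply: st; rewrite ltn_subrL (leq_ltn_trans _ ik)|apply: IH; exact: ltnW].
have := H k (leqnn _); rewrite subnn => /le_trans; apply.
by rewrite mulr2n mulrDl mul1r lerD2l.
Qed.

(** The dissipation [y * |g|^2] on the left of the interval has to be supplied by
    the current of [g] entering it, which bounds [g] from below at the left end
    when [g 0] is not small.  The Wronskian of [g] with the Dirichlet solution is
    then at least the determinant times this lower bound; being almost constant
    along the interval, it is at most of the order of [G], its size at the right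
    end. *)
Lemma green_decay : normc (dirdet V z a k) * (y ^+ 2 * kappa ^+ 2) <= 8 * G ^+ 2.
Proof.
have [J1 J2] := J_lower.
have fJ := @dirsol_current V z a%:Z k 0 (ltW y0) (leq0n _).
have y2 : 0 <= y / 2 by rewrite divr_ge0// ltW.
have J2' : y / 2 * normc (g (a%:Z - 1)) ^+ 2 <= complex.Im (g a%:Z * (g (a%:Z - 1))^*%C).
  by move: J2; rewrite /J subrK.
have W := wronskian_lower y2 J2' fJ.
have f0 : dirsol V z a%:Z k 0 = dirdet V z a%:Z k by rewrite /dirsol addr0 subn0.
have W2 : y / 2 * (normc (g (a%:Z - 1)) * normc (dirdet V z a%:Z k)) <= 2 * G.
  by rewrite -f0; apply: (le_trans W); move: w0_le; rewrite /w /f addr0.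
have J3 : y * kappa ^+ 2 / 2 <= normc (g (a%:Z - 1)) * G.
  apply: (le_trans J1); apply: (le_trans (ler_norm _)); apply: (le_trans (ler_Im_normc _)).
  by rewrite normcM normc_conj subrK mulrC ler_wpM2l ?normc_ge0.
set P := normc (dirdet _ _ _ _) in W2 *; set q := normc (g _) in W2 J3.
have P0 : 0 <= P by exact: normc_ge0.
have q0 : 0 <= q by exact: normc_ge0.
have h1 : P * (y ^+ 2 * kappa ^+ 2) = 2 * (P * y) * (y * kappa ^+ 2 / 2) by field.
rewrite h1; apply: (@le_trans _ _ (2 * (P * y) * (q * G))).
  by rewrite ler_wpM2l//; nneg; exact: ltW.
have -> : 2 * (P * y) * (q * G) = 4 * G * (y / 2 * (q * P)) by field.
have -> : 8 * G ^+ 2 = 4 * G * (2 * G) by ring.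
by rewrite ler_wpM2l//; nneg.
Qed.

End green.

(** Far from the spectrum the resolvent decays by contraction. *)
Lemma far_decay V Phi z G sb g s (n : nat) : (forall i, `|V i| <= Phi) ->
  Phi + 4 <= normc z ->
  (forall i : int, (i < n%:Z) -> hop V g i - z * g i = s i) ->
  (forall i, normc (g i) <= G) -> (forall i : int, i < n%:Z -> normc (s i) <= sb) -> 0 <= sb ->
  normc (g 0) <= 2^-1 ^+ n * G + sb.
Proof.
move=> HV Hz eqn gG sbd s0.
suff H (l : nat) (i : int) : i <= n%:Z - l%:Z -> normc (g i) <= 2^-1 ^+ l * G + sb.
  by apply: (H n); lia.
elim: l i => [|l IH] i il.
  by rewrite expr0 mul1r (le_trans (gG i))// lerDl.
have ilt : i < n%:Z by lia.
have e : z * g i = g (i + 1) + g (i - 1) + (V i)%:C * g i - s i.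
  by rewrite -(eqn _ ilt) /hop; ring.
have h1 : normc (g (i + 1)) <= 2^-1 ^+ l * G + sb by apply: IH; lia.
have h2 : normc (g (i - 1)) <= 2^-1 ^+ l * G + sb by apply: IH; lia.
have : normc z * normc (g i) <= normc (g (i + 1)) + normc (g (i - 1)) + Phi * normc (g i) + normc (s i).
  rewrite -normcM e; apply: (le_trans (le_normcD _ _)); rewrite normcN lerD2r.
  apply: (le_trans (le_normcD _ _)); apply: lerD; first exact: le_normcD.
  by rewrite normcM normc_real ler_wpM2r ?normc_ge0.
have := sbd _ ilt; have := normc_ge0 (g i); rewrite exprS => g0 si.
set X := 2^-1 ^+ l * G in h1 h2 *.
have -> : 2^-1 * 2^-1 ^+ l * G = X / 2 by rewrite /X; field.
nra.
Qed.

End dirichlet.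

(** * From resolvents back to the dynamics by a discrete Fourier transform *)
Section characters.
Context {R : realType}.
Implicit Types (x y : R).

Definition expi x : R[i] := cos (2 * pi * x) +i* sin (2 * pi * x).

Lemma expi0 : expi 0 = 1.
Proof. by rewrite /expi mulr0 cos0 sin0. Qed.

Lemma expiD x y : expi (x + y) = expi x * expi y.
Proof. by rewrite /expi mulrDr cosD sinD; apply/eqP; rewrite eq_complex /= eqxx /= addrC. Qed.

Lemma expiM_nat n x : expi (n%:R * x) = expi x ^+ n.
Proof.
elim: n => [|n IH]; first by rewrite mul0r expi0 expr0.
by rewrite -natr1 mulrDl mul1r expiD IH exprSr.
Qed.

Lemma normc_expi x : normc (expi x) = 1.
Proof. by rewrite /normc /expi cos2Dsin2 sqrtr1. Qed.

Lemma expi_neq0 x : expi x != 0.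
Proof. by apply/eqP => e; have := normc_expi x; rewrite e normc0 => /eqP; rewrite eq_sym oner_eq0. Qed.

Lemma expi1 : expi 1 = 1.
Proof. by rewrite /expi mulr1 mulr_natl cos2pi sin2pi. Qed.

Lemma expi_nat n : expi n%:R = 1.
Proof. by rewrite -[n%:R]mulr1 expiM_nat expi1 expr1n. Qed.

Lemma expiN x : expi (- x) = (expi x)^-1.
Proof.
apply: (mulIf (expi_neq0 x)); rewrite -expiD addNr expi0 mulVf//; exact: expi_neq0.
Qed.

Lemma expi_int (k : int) : expi k%:~R = 1.
Proof. by case: k => n; rewrite ?NegzE ?mulrNz ?expiN expi_nat ?invr1. Qed.

Lemma normc_expi_sub1 x : normc (expi x - 1) = 2 * `|sin (pi * x)|.
Proof.
apply/eqP; rewrite -(@eqrXn2 _ 2)// ?normc_ge0 ?mulr_ge0//; apply/eqP.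
rewrite exprMn real_normK ?num_real// sqr_normc2 /expi /=.
have -> : 2 * pi * x = (pi * x) *+ 2 by rewrite -mulrA mulr_natl.
have := cos_mulr2n (pi * x); have := cos2Dsin2 ((pi * x) *+ 2); have := cos2sin2 (pi * x).
rewrite subr0; move: (cos _) (sin _) (cos (pi * x)) (sin (pi * x)) => a b c d h1 h2 h3.
by rewrite !mulr2n in h3; nra.
Qed.

Lemma expi_neq1 x : 0 < x < 1 -> expi x != 1.
Proof.
move=> /andP[x0 x1]; rewrite -subr_eq0; apply/eqP => e.
have := normc_expi_sub1 x; rewrite e normc0 => /eqP; rewrite eq_sym mulf_eq0 pnatr_eq0/= normr_eq0.
rewrite gt_eqF// sin_gt0_pi// mulr_gt0 ?pi_gt0//=.
by rewrite -[ltRHS]mulr1 ltr_pM2l ?pi_gt0.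
Qed.

Lemma sum_powers_root (w : R[i]) m : w ^+ m = 1 -> w != 1 -> \sum_(l < m) w ^+ l = 0.
Proof.
move=> wm w1; apply/eqP; have := subrX1 w m; rewrite wm subrr => /eqP.
by rewrite eq_sym mulf_eq0 subr_eq0 (negbTE w1).
Qed.

(** Fourier inversion on [Z/m]. *)
Lemma dft_bound (m : nat) (u : nat -> R[i]) (r kappa : R) : (0 < m)%N ->
  (forall l, (l < m)%N ->
     normc (\sum_(j < m) (r%:C * expi (l%:R / m%:R)) ^+ j * u j) <= kappa) ->
  forall j, (j < m)%N -> `|r| ^+ j * normc (u j) <= kappa.
Proof.
move=> m0 H j jm; have mR : (0 : R) < m%:R by rewrite ltr0n.
pose W l := expi (l%:R / m%:R).
have Wm l : W l ^+ m = 1.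
  by rewrite /W -expiM_nat mulrC divfK ?expi_nat// gt_eqF.
have rea l i : W l ^+ (m - j) * ((r%:C * W l) ^+ i * u i) = (r%:C ^+ i * u i) * W l ^+ (m - j + i).
  by rewrite exprMn exprD; ring.
have key : \sum_(l < m) W l ^+ (m - j) * (\sum_(i < m) (r%:C * W l) ^+ i * u i) =
   m%:R * (r%:C ^+ j * u j).
  under eq_bigr => l _ do rewrite mulr_sumr.
  rewrite exchange_big /= (bigD1 (Ordinal jm)) //= [X in _ + X]big1 ?addr0.
    rewrite (eq_bigr _ (fun (l : 'I_m) _ => rea l j)) subnK ?(ltnW jm)//.
    under eq_bigr => l _ do rewrite Wm mulr1.
    by rewrite sumr_const card_ord -[LHS]mulr_natl.
  move=> i ij.
  have ij' : (i != j :> nat)%N by apply: contra ij => /eqP e; apply/eqP/val_inj.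
  rewrite (eq_bigr _ (fun (l : 'I_m) _ => rea l i)) -mulr_sumr.
  have e1 (l : 'I_m) : W l ^+ (m - j + i) = (expi ((m - j + i)%:R / m%:R)) ^+ l.
    by rewrite /W -!expiM_nat; congr expi; rewrite mulrCA.
  rewrite (eq_bigr _ (fun l _ => e1 l)) sum_powers_root ?mulr0//.
    by rewrite -expiM_nat mulrC divfK ?expi_nat// gt_eqF.
  have im := ltn_ord i; case: (ltnP i j) => cij.
    apply: expi_neq1; rewrite divr_gt0 ?ltr0n//=; last by lia.
    by rewrite ltr_pdivrMr// mul1r ltr_nat; lia.
  have -> : (m - j + i = m + (i - j))%N by lia.
  rewrite natrD mulrDl (mulfV (lt0r_neq0 mR)) expiD expi1 mul1r.
  apply: expi_neq1; rewrite divr_gt0 ?ltr0n//=; last by lia.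
  by rewrite ltr_pdivrMr// mul1r ltr_nat; lia.
rewrite -(ler_pM2l mR) -normc_real -normcX -normcM.
have -> : m%:R * normc (r%:C ^+ j * u j) = normc (m%:R * (r%:C ^+ j * u j)).
  by rewrite [RHS]normcM (normcMn 1) normc1.
rewrite -key; apply: (le_trans (normc_sum _ _ _)).
apply: (@le_trans _ _ (\sum_(l < m) kappa)).
  by apply: ler_sum => l _; rewrite normcM normcX normc_expi expr1n mul1r H.
by rewrite sumr_const card_ord mulr_natl.
Qed.

(** [(1 + x)^(2 l) >= (l x)^2] grows quadratically in [l]. *)
Lemma poly_geometric_small (q e : R) (n j : nat) : 0 < q < 1 -> 0 < e ->
  exists m, (j < m)%N /\ (n + m)%:R * q ^+ m <= e.
Proof.
move=> /andP[q0 q1] e0; pose x := q^-1 - 1.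
have x0 : 0 < x by rewrite /x subr_gt0 invf_gt1.
have qx : q = (1 + x)^-1 by rewrite /x addrC subrK invrK.
have D0 : 0 < x ^+ 2 * e by rewrite mulr_gt0// exprn_gt0.
pose l := (Num.bound ((n%:R + 2) / (x ^+ 2 * e)) + j.+1)%N.
have l1 : (0 < l)%N by rewrite /l addnS.
have lR : (0 : R) < l%:R by rewrite ltr0n.
exists l.*2; split; first by rewrite /l; lia.
have B : l%:R * x <= (1 + x) ^+ l.
  elim: (l) => [|k IH]; first by rewrite mul0r expr0.
  have h1 : 1 <= (1 + x) ^+ k by rewrite exprn_ege1// lerDl ltW.
  have -> : k.+1%:R * x = k%:R * x + x by rewrite -natr1 mulrDl mul1r.
  by rewrite (exprSr _ k); nra.
have B2 : (l%:R * x) ^+ 2 <= (1 + x) ^+ l.*2.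
  have x0' := ltW x0.
  by rewrite -muln2 exprM lerXn2r// nnegrE; nneg.
have lx : 0 < l%:R * x by rewrite mulr_gt0.
rewrite qx exprVn ler_pdivrMr; last by rewrite exprn_gt0// addr_gt0.
apply: (@le_trans _ _ (e * (l%:R * x) ^+ 2)); last by rewrite ler_wpM2l// ltW.
have : (n%:R + 2) / (x ^+ 2 * e) < l%:R.
  apply: lt_le_trans (archi_boundP _) _; first by rewrite divr_ge0 ?addr_ge0// ltW.
  by rewrite ler_nat /l leq_addr.
rewrite ltr_pdivrMr// => H.
apply: (@le_trans _ _ (l%:R * (n%:R + 2))).
  have l1R : (1 : R) <= l%:R by rewrite ler1n.
  have nR : (0 : R) <= n%:R by [].
  rewrite natrD -muln2 natrM; nra.
have -> : e * (l%:R * x) ^+ 2 = l%:R * (l%:R * (x ^+ 2 * e)) by ring.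
by rewrite ler_wpM2l// ltW.
Qed.

End characters.

Section euler_decay.
Context {R : realType}.
Variables (V : int -> R) (Phi eta h K kappa : R) (n : nat).
Hypotheses (HV : forall i, `|V i| <= Phi).
Hypotheses (eta0 : 0 < eta) (eta1 : eta <= 1) (h0 : 0 < h) (hh : h <= 1).
Hypotheses (hC2 : h * C2 Phi <= eta / 2) (hK : h * (4 * K ^+ 2) <= eta) (hK1 : h * K <= 1).
Hypothesis (KPhi : Phi + 4 <= K).
Hypothesis large : forall E y, `|E| <= K -> eta / 2 <= y <= eta ->
  exists a k : nat, [/\ (1 <= a)%N, (a + k <= n)%N &
    8 * (4 / (h * eta)) ^+ 2 < normc (dirdet V (E +i* y) a%:Z k) * ((eta / 2) ^+ 2 * kappa ^+ 2)].
Hypothesis kap : 2^-1 ^+ n * (4 / (h * eta)) < kappa.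

Let rho := (1 + h * eta)^-1.
Let q := (1 + h ^+ 2 * C2 Phi) * rho.
Let G := 4 / (h * eta).
Let U := euler V h.
Let u j : int -> R[i] := iter j U (delta_seq n%:Z).

Let heta0 : 0 < h * eta. Proof. exact: mulr_gt0. Qed.
Let heta1 : h * eta <= 1. Proof. by rewrite -[leRHS]mulr1 ler_pM// ltW. Qed.
Let rho0 : 0 < rho. Proof. by rewrite invr_gt0 addr_gt0. Qed.
Let hc2 : h ^+ 2 * C2 Phi <= h * eta / 2.
Proof. by rewrite expr2 -!mulrA ler_wpM2l// ltW. Qed.
Let hc20 : 0 <= h ^+ 2 * C2 Phi. Proof. by rewrite mulr_ge0 ?sqr_ge0 ?C2_ge0. Qed.
Let q0 : 0 < q. Proof. by rewrite mulr_gt0// ltr_pwDl. Qed.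
Let G0 : 0 < G. Proof. by rewrite divr_gt0. Qed.
Let K0 : 0 < K.
Proof. by apply: lt_le_trans KPhi; rewrite ltr_wpDl// (le_trans _ (HV 0)). Qed.
Let kappa0 : 0 < kappa.
Proof. by apply: le_lt_trans kap; rewrite mulr_ge0 ?(ltW G0)// exprn_ge0// invr_ge0. Qed.

Let oneq : h * eta / 4 <= 1 - q.
Proof.
have p0 : 0 < 1 + h * eta by rewrite addr_gt0.
have -> : 1 - q = (h * eta - h ^+ 2 * C2 Phi) / (1 + h * eta).
  by rewrite /q /rho; field; rewrite gt_eqF.
rewrite ler_pdivlMr//; move: heta0 heta1 hc2 hc20.
by set b := h * eta; set c := h ^+ 2 * _ => *; nra.
Qed.

Let q1 : q < 1. Proof. have := oneq; move: heta0; lra. Qed.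

Let u_le j i : normc (u j i) <= (1 + h ^+ 2 * C2 Phi) ^+ j.
Proof.
pose B := (n + j + `|i|)%N.
have nB : (`|n%:Z|%N + j <= B)%N by rewrite /B absz_nat leq_addr.
have nB1 : (`|n%:Z|%N <= B)%N by apply: leq_trans nB; rewrite leq_addr.
have iB : (`|i| <= B)%N by rewrite /B leq_addl.
have Hsupp : supp_in `|n%:Z|%N (delta_seq n%:Z : int -> R[i]) by exact: supp_in_delta.
have /andP[_ H] := sqn_iter_euler h HV Hsupp nB.
rewrite (sqn_delta nB1) mulr1 in H.
have := le_trans (sqn_ge (iter j (euler V h) (delta_seq n%:Z)) iB) H.
set A := (1 + _) ^+ j.
have A1 : 1 <= A by rewrite exprn_ege1// lerDl.
rewrite -/U -/(u j) => H2.
rewrite -(@ler_pXn2r _ 2)// ?nnegrE ?normc_ge0//; last by apply: le_trans A1.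
by apply: (le_trans H2); rewrite expr2 ler_peMr// (le_trans _ A1).
Qed.

Let rho_u j i : rho ^+ j * normc (u j i) <= q ^+ j.
Proof. by rewrite /q exprMn mulrC ler_wpM2r// ?exprn_ge0 ?(ltW rho0). Qed.

Section fixed_frequency.
Variables (m l : nat).
Let r := rho%:C * expi (l%:R / m%:R).
Let g i := \sum_(j < m) r ^+ j * u j i.
Let z := 'i * (h^-1)%:C * (r^-1 - 1).

Let r_neq0 : r != 0.
Proof.
rewrite mulf_neq0 ?expi_neq0//; apply/eqP => -[] e; by move: rho0; rewrite e ltxx.
Qed.

Let normc_r : normc r = rho.
Proof. by rewrite normcM normc_expi mulr1 normc_real gtr0_norm. Qed.

Let hC_neq0 : h%:C != 0 :> R[i].
Proof. by apply/eqP => -[] e; move: h0; rewrite e ltxx. Qed.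

Let i_neq0 : 'i != 0 :> R[i].
Proof. by apply/eqP => -[] /eqP; rewrite oner_eq0. Qed.

Let s i := (delta_seq n%:Z i - r ^+ m * u m i) / ('i * h%:C * r).

(** Weighted by powers of [r], the Euler steps telescope into a resolvent equation. *)
Let resolvent_eq i : hop V g i - z * g i = s i.
Proof.
have tel : r * (g i - 'i * h%:C * hop V g i) = g i - delta_seq n%:Z i + r ^+ m * u m i.
  have -> : g i - 'i * h%:C * hop V g i = \sum_(j < m) r ^+ j * u j.+1 i.
    rewrite /g (hop_sum V (index_enum 'I_m) (fun j : 'I_m => r ^+ j) (fun j => u j)).
    by rewrite mulr_sumr -sumrB; apply: eq_bigr => j _; rewrite /u iterS /U /euler; ring.
  rewrite mulr_sumr.
  have -> : \sum_(j < m) r * (r ^+ j * u j.+1 i) = \sum_(j < m) r ^+ j.+1 * u j.+1 i.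
    by apply: eq_bigr => j _; rewrite exprS mulrA.
  have : \sum_(j < m.+1) r ^+ j * u j i = r ^+ 0 * u 0 i + \sum_(j < m) r ^+ j.+1 * u j.+1 i.
    by rewrite big_ord_recl.
  rewrite big_ord_recr /= expr0 mul1r -/(g i) => e.
  by rewrite addrAC e [X in X - _]addrC addrK.
have e : 'i * h%:C * r * (hop V g i - z * g i) = delta_seq n%:Z i - r ^+ m * u m i.
  have ez : 'i * h%:C * r * z = r - 1.
    rewrite /z; have -> : (h^-1)%:C = (h%:C)^-1 :> R[i] by rewrite fmorphV.
    have ii : 'i * 'i = -1 :> R[i] by rewrite -expr2 sqr_i.
    have -> : 'i * h%:C * r * ('i / h%:C * (r^-1 - 1)) = ('i * 'i) * (h%:C / h%:C) * (r / r - r) by ring.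
    by rewrite ii !mulfV// mulr1 mulN1r opprB.
  rewrite mulrBr [X in _ - X]mulrA ez.
  have -> : 'i * h%:C * r * hop V g i = r * g i - r * (g i - 'i * h%:C * hop V g i) by ring.
  by rewrite tel; ring.
have nz : 'i * h%:C * r != 0 by apply: mulf_neq0 r_neq0; apply: mulf_neq0 i_neq0 hC_neq0.
by rewrite /s -e [RHS]mulrC mulKf.
Qed.

Let g_le i : normc (g i) <= G.
Proof.
apply: (le_trans (normc_sum _ _ _)).
apply: (@le_trans _ _ (\sum_(j < m) q ^+ j)).
  by apply: ler_sum => j _; rewrite normcM normcX normc_r rho_u.
have d0 : 0 < 1 - q by rewrite subr_gt0.
apply: (@le_trans _ _ (1 - q)^-1).
  rewrite -[leRHS]mul1r ler_pdivlMr//.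
  have := subrX1 q m => e.
  have -> : (\sum_(j < m) q ^+ j) * (1 - q) = 1 - q ^+ m.
    by rewrite mulrC -opprB mulNr -e opprB.
  by rewrite gerBl exprn_ge0// ltW.
by rewrite /G -[leRHS]invrK lef_pV2 ?posrE ?invr_gt0// invf_div.
Qed.

Let s_le i : i < n%:Z -> normc (s i) <= q ^+ m / (h * rho).
Proof.
move=> ilt; rewrite /s /delta_seq lt_eqF// sub0r normcM normcN normcV.
have -> : normc ('i * h%:C * r) = h * rho.
  by rewrite normcM normc_r normcM normci mul1r normc_real gtr0_norm.
rewrite ler_wpM2r ?invr_ge0 ?mulr_ge0 ?(ltW h0) ?(ltW rho0)//.
by rewrite normcM normcX normc_r rho_u.
Qed.

Let g_supp : supp_in (n + m) g.
Proof.
move=> i Hi; rewrite /g big1// => j _; rewrite /u.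
have Hsupp : supp_in `|n%:Z|%N (delta_seq n%:Z : int -> R[i]) by exact: supp_in_delta.
have H := @supp_in_iter_euler R V h j _ _ Hsupp.
rewrite /U H ?mulr0// absz_nat; apply: leq_ltn_trans Hi.
by rewrite leq_add2l ltnW.
Qed.

Let E := complex.Re z.
Let y := complex.Im z.

Let zE : z = E +i* y. Proof. by rewrite /E /y; case: z. Qed.

(** When [|z|] is bounded the angle of [r] is of order [h * K], and it changes the
    imaginary part of [z] only at second order. *)
Let spectral_window : normc z < K -> `|E| <= K /\ eta / 2 <= y <= eta.
Proof.
move=> zK; split; first by rewrite (le_trans (ler_Re_normc _))// ltW.
pose C : R := cos (2 * pi * (l%:R / m%:R)); pose S : R := sin (2 * pi * (l%:R / m%:R)).
have CS : C ^+ 2 + S ^+ 2 = 1 by exact: cos2Dsin2.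
have rV : r^-1 = ((1 + h * eta) * C) +i* (- ((1 + h * eta) * S)).
  apply: (mulfI r_neq0); rewrite mulfV// /r /expi -/C -/S; apply/eqP; rewrite eq_complex /=.
  have nz : 1 + h * eta != 0 by rewrite gt_eqF// addr_gt0.
  rewrite /rho; apply/andP; split; apply/eqP; last by field.
  by transitivity (C ^+ 2 + S ^+ 2); [rewrite CS|field].
have Ey : E = (1 + h * eta) * S / h /\ y = ((1 + h * eta) * C - 1) / h.
  by rewrite /E /y /z rV /=; split; rewrite /=; field; rewrite gt_eqF.
have [E_ y_] := Ey.
have EK : `|E| <= K by rewrite (le_trans (ler_Re_normc _))// ltW.
have yK : `|y| <= K by rewrite (le_trans (ler_Im_normc _))// ltW.
have hE : E * h = (1 + h * eta) * S by rewrite E_; field; rewrite gt_eqF.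
have hy : y * h = (1 + h * eta) * C - 1 by rewrite y_; field; rewrite gt_eqF.
have S2 : S ^+ 2 <= (h * K) ^+ 2.
  apply: (@le_trans _ _ ((E * h) ^+ 2)).
    by rewrite hE exprMn ler_peMl ?sqr_ge0// exprn_ege1// lerDl ltW.
  by rewrite mulrC !exprMn ler_wpM2l ?sqr_ge0// -(@real_normK _ E) ?num_real// lerXn2r// nnegrE// ltW.
have C0 : 0 <= C.
  have : 0 <= (1 + h * eta) * C.
    have -> : (1 + h * eta) * C = 1 + y * h by rewrite hy; ring.
    have : - (K * h) <= y * h by rewrite -mulNr ler_wpM2r ?(ltW h0)//; move: yK; rewrite ler_norml => /andP[].
    by move: hK1; rewrite mulrC; lra.
  by rewrite pmulr_rge0// addr_gt0.
have C1 : C <= 1 by exact: cos_le1.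
have CC : 1 - (h * K) ^+ 2 <= C.
  have : C ^+ 2 <= C by rewrite expr2 -[leRHS]mulr1 ler_wpM2l.
  by move: CS S2; lra.
apply/andP; split; last first.
  by rewrite -(ler_pM2r h0) hy; move: C1 heta0; nra.
rewrite -(ler_pM2r h0) hy.
have hKK : (h * K) ^+ 2 <= h * eta / 4.
  have -> : (h * K) ^+ 2 = h * (h * (4 * K ^+ 2)) / 4 by field.
  by rewrite ler_wpM2r ?invr_ge0// ler_wpM2l// ltW.
have := ler_wpM2l (ltW (ltr_pwDl ltr01 (ltW heta0))) CC.
move: heta0 heta1 hKK; set p := h * eta; set w := (h * K) ^+ 2 => p0 p1 wp Hc.
have -> : eta / 2 * h = p / 2 by rewrite /p; field.
nra.
Qed.

Hypothesis small1 : (n + n + m)%:R * q ^+ m * (G / (h * rho)) <= eta * kappa ^+ 2 / 4.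
Hypothesis small2 : n%:R * q ^+ m * ((K + Phi + 1) ^+ n / (h * rho)) <= G.
Hypothesis small3 : q ^+ m / (h * rho) <= kappa - 2^-1 ^+ n * G.

Lemma fixed_frequency_bound : normc (g 0) <= kappa.
Proof.
have sb0 : 0 <= q ^+ m / (h * rho).
  by rewrite divr_ge0 ?exprn_ge0 ?(ltW q0) ?mulr_ge0 ?(ltW h0) ?(ltW rho0).
have [zK|zK] := leP K (normc z).
  have := far_decay HV (le_trans KPhi zK) (fun i (_ : i < n%:Z) => resolvent_eq i) g_le s_le sb0.
  by move/le_trans; apply; move: small3; lra.
have [EK yb] := spectral_window zK; have /andP[y1 _] := yb.
rewrite leNgt; apply/negP => gk.
have [a [k [a1 akn big]]] := large EK yb.
have y0 : 0 < y by apply: lt_le_trans y1; rewrite divr_gt0.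
have eqn i : i < n%:Z -> hop V g i - (E +i* y) * g i = s i by move=> _; rewrite -zE resolvent_eq.
have P0 : 0 <= Phi by apply: le_trans (HV 0).
have base1 : 1 <= K + Phi + 1 by rewrite lerDr addr_ge0// ltW.
have FB i : (i <= k)%N -> normc (dirdet V (E +i* y) (a%:Z + i%:Z) (k - i)) <= (K + Phi + 1) ^+ n.
  move=> ik; apply: (le_trans (@normc_dirdet_le _ V Phi (E +i* y) K _ _ HV _)).
    by rewrite -zE ltW.
  apply: ler_weXn2l => //.
  by rewrite (leq_trans (leq_subr _ _))// (leq_trans _ akn)// leq_addl.
have sm1 : (n + m + n)%:R * (q ^+ m / (h * rho) * G) <= y * kappa ^+ 2 / 2.
  apply: (@le_trans _ _ (eta * kappa ^+ 2 / 4)).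
    by apply: le_trans small1; rewrite le_eqVlt; apply/orP; left; apply/eqP; rewrite addnAC; ring.
  have -> : eta * kappa ^+ 2 / 4 = eta / 2 * kappa ^+ 2 / 2 by field.
  by rewrite ler_wpM2r// ler_wpM2r// ?sqr_ge0.
have sm2 : k%:R * (q ^+ m / (h * rho) * (K + Phi + 1) ^+ n) <= G.
  apply: le_trans small2.
  have -> : n%:R * q ^+ m * ((K + Phi + 1) ^+ n / (h * rho)) = n%:R * (q ^+ m / (h * rho) * (K + Phi + 1) ^+ n) by ring.
  apply: ler_wpM2r; last by rewrite ler_nat (leq_trans _ akn)// leq_addl.
  by rewrite mulr_ge0// exprn_ge0// (le_trans _ base1).
have := green_decay y0 g_supp eqn g_le s_le a1 akn FB kappa0 (ltW gk) sm1 sm2.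
rewrite leNgt => /negP; apply; apply: (lt_le_trans big).
rewrite ler_wpM2l ?normc_ge0// ler_wpM2r ?sqr_ge0// lerXn2r// nnegrE; lra.
Qed.

End fixed_frequency.

(** The length [m] of the Fourier transform is chosen after all other parameters,
    so the boundary terms, of size [q^m], beat every constant, including those
    that are exponential in [n]. *)
Lemma euler_decay j : normc (iter j (euler V h) (delta_seq n%:Z) 0) <= kappa * (1 + h * eta) ^+ j.
Proof.
have hr0 : 0 < h * rho by rewrite mulr_gt0.
have P0 : 0 <= Phi by apply: le_trans (HV 0).
have F0 : 0 < (K + Phi + 1) ^+ n by rewrite exprn_gt0// ltr_wpDl// addr_ge0// ltW.
pose e1 := eta * kappa ^+ 2 / 4 / (G / (h * rho)).
pose e2 := G / ((K + Phi + 1) ^+ n / (h * rho)).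
pose e3 := (kappa - 2^-1 ^+ n * G) * (h * rho).
have e10 : 0 < e1.
  apply: divr_gt0; last exact: divr_gt0.
  by apply: divr_gt0 => //; apply: mulr_gt0 => //; exact: exprn_gt0.
have e20 : 0 < e2 by apply: divr_gt0 => //; exact: divr_gt0.
have e30 : 0 < e3 by rewrite mulr_gt0// subr_gt0.
have [m [jm Hm]] := @poly_geometric_small R q (Num.min e1 (Num.min e2 e3)) (n + n) j
  (introT andP (conj q0 q1)) (ltac:(by rewrite !lt_min e10 e20)).
move: Hm; rewrite !le_min => /and3P[m1 m2 m3].
have qm0 : 0 <= q ^+ m by rewrite exprn_ge0// ltW.
have m0 : (0 < m)%N by exact: leq_ltn_trans jm.
have := @dft_bound R m (fun j => u j 0) rho kappa m0.
have H l : (l < m)%N -> normc (\sum_(j < m) (rho%:C * expi (l%:R / m%:R)) ^+ j * u j 0) <= kappa.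
  move=> lm; apply: (@fixed_frequency_bound m l).
  - by rewrite -(ler_pdivlMr _ _ (divr_gt0 G0 hr0)); exact: m1.
  - rewrite -(ler_pdivlMr _ _ (divr_gt0 F0 hr0)); apply: le_trans m2.
    by rewrite ler_wpM2r// ler_nat -addnA leq_addr.
  - rewrite ler_pdivrMr//; apply: le_trans m3; by rewrite ler_peMl// ler1n addn_gt0 m0 orbT.
move=> /(_ H j jm); rewrite (gtr0_norm rho0) /rho exprVn mulrC.
by rewrite ler_pdivrMr// exprn_gt0// addr_gt0.
Qed.

End euler_decay.

(** * Quantitative density of Diophantine orbits *)
Section exponential_sums.
Context {R : realType}.
Implicit Types (x y : R).

Lemma exists_round y : exists m : int, `|y - m%:~R| <= 1 / 2.
Proof.
exists (Num.floor (y + 1 / 2)).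
have := ge_floor (y + 1 / 2); have := floorD1_gt (y + 1 / 2).
rewrite intrD => h1 h2; rewrite ler_norml; apply/andP; split; lra.
Qed.

Lemma expi_sub1_half x : 1 / 4 <= x <= 1 / 2 -> 1 <= normc (expi x - 1).
Proof.
move=> /andP[x1 x2]; apply: (le_trans _ (ler_Re_normc _)); rewrite /expi /=.
have : cos (2 * pi * x) <= 0.
  have -> : 2 * pi * x = (2 * pi * x - pi) + pi by rewrite subrK.
  have p0 : (0 : R) < pi by exact: pi_gt0.
  rewrite cosDpi oppr_le0 cos_ge0_pihalf//; apply/andP; split; nra.
move=> c0; rewrite -normrN; apply: le_trans (ler_norm _); lra.
Qed.

Lemma normc_expi_nat_sub1 n x : normc (expi (n%:R * x) - 1) <= n%:R * normc (expi x - 1).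
Proof.
elim: n => [|n IH]; first by rewrite !mul0r expi0 subrr normc0.
have -> : expi (n.+1%:R * x) - 1 = expi x * (expi (n%:R * x) - 1) + (expi x - 1).
  by rewrite -natr1 mulrDl mul1r expiD; ring.
apply: (le_trans (le_normcD _ _)); rewrite normcM normc_expi mul1r -natr1 mulrDl mul1r.
by rewrite lerD2r.
Qed.

(** [|e(x) - 1|] is bounded below linearly: multiply the angle up to
    [[1/4, 1/2]], where the chord has length at least 1. *)
Lemma expi_sub1_lower x : 0 <= x <= 1 / 2 -> 2 * x <= normc (expi x - 1).
Proof.
move=> /andP[x0 x2]; have [x4|x4] := leP (1 / 4) x.
  by apply: (le_trans _ (@expi_sub1_half x _)); [lra|apply/andP].
have [->|xn0] := eqVneq x 0; first by rewrite mulr0 normc_ge0.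
have xp : 0 < x by rewrite lt_neqAle eq_sym xn0.
pose n := Num.truncn ((2 * x)^-1).
have x2p : 0 < 2 * x by rewrite mulr_gt0.
have /andP[n1 n2] : n%:R <= (2 * x)^-1 < n.+1%:R by rewrite truncn_itv// invr_ge0 ltW.
have nx1 : n%:R * (2 * x) <= 1 by rewrite -ler_pdivlMr// mul1r.
have nx2 : 1 < n.+1%:R * (2 * x) by rewrite -ltr_pdivrMr// mul1r.
rewrite -natr1 in nx2.
have n0 : (0 : R) < n%:R.
  by rewrite ltr0n lt0n; apply/eqP => e; move: nx2; rewrite e; lra.
have H : 1 <= normc (expi (n%:R * x) - 1).
  by apply: expi_sub1_half; apply/andP; split; nra.
have := le_trans H (normc_expi_nat_sub1 n x) => H2.
rewrite -(ler_pM2l n0); lra.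
Qed.

Lemma expi_sub1_int y (m : int) : normc (expi y - 1) = normc (expi `|y - m%:~R| - 1).
Proof.
have -> : expi y = expi (y - m%:~R) by rewrite -[in LHS](subrK m%:~R y) [LHS]expiD expi_int mulr1.
case: (ltP (y - m%:~R) 0) => h; last by rewrite ger0_norm.
rewrite ltr0_norm// expiN; set w := expi _.
have w0 : w != 0 by exact: expi_neq0.
have -> : w^-1 - 1 = w^-1 * (1 - w) by rewrite mulrBr mulr1 mulVf.
by rewrite normcM normcV normc_expi invr1 mul1r normcBC.
Qed.

Lemma dist_int_le y (m : int) : dist_int y <= `|y - m%:~R|.
Proof.
by apply: ge_inf; [exists 0 => _ [k _ <-]; exact: normr_ge0|exists m].
Qed.

Lemma expi_sub1_dist y : 2 * dist_int y <= normc (expi y - 1).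
Proof.
have [m Hm] := exists_round y; rewrite (expi_sub1_int y m).
apply: le_trans (expi_sub1_lower _); last by rewrite normr_ge0 Hm.
by rewrite ler_wpM2l// dist_int_le.
Qed.

Lemma geometric_sum_bound y a N : 
  normc (\sum_(n < N) expi (a + n%:R * y)) * normc (expi y - 1) <= 2.
Proof.
rewrite -normcM.
have -> : (\sum_(n < N) expi (a + n%:R * y)) * (expi y - 1) = expi a * (expi y ^+ N - 1).
  rewrite subrX1 mulrCA [RHS]mulrC; congr (_ * _).
  rewrite mulr_sumr; apply: eq_bigr => n _.
  by rewrite expiD expiM_nat.
rewrite normcM normc_expi mul1r; apply: (le_trans (le_normcD _ _)).
by rewrite normcN normc1 normcX normc_expi expr1n.
Qed.

(** Even powers of the cosine concentrate at the integers, and their Fourier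
    coefficients are binomial coefficients: explicit and nonnegative. *)
Definition bump (M : nat) x : R := cos (pi * x) ^+ (2 * M).

Lemma bump_ge0 M x : 0 <= bump M x.
Proof. by rewrite /bump exprM exprn_ge0// sqr_ge0. Qed.

Lemma bump_le1 M x : bump M x <= 1.
Proof.
rewrite /bump exprM; apply: exprn_ile1; first exact: sqr_ge0.
by have := cos2Dsin2 (pi * x); have := sqr_ge0 (sin (pi * x)); lra.
Qed.

Lemma bump_small M x r : 0 <= r -> 2 * r <= normc (expi x - 1) -> bump M x <= (1 - r ^+ 2) ^+ M.
Proof.
move=> r0; rewrite normc_expi_sub1 ler_pM2l// => rx.
rewrite /bump exprM.
have : r ^+ 2 <= sin (pi * x) ^+ 2 by rewrite -(@real_normK _ (sin _)) ?num_real// lerXn2r// nnegrE.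
move=> h; have := cos2Dsin2 (pi * x) => e.
by apply: lerXn2r; rewrite ?nnegrE ?sqr_ge0//; have := sqr_ge0 (cos (pi * x)); lra.
Qed.

Definition bump_coef (M k : nat) : R := 'C(2 * M, k)%:R / 4 ^+ M.

Lemma bump_expand M x :
  (bump M x)%:C = \sum_(k < (2 * M).+1) (bump_coef M k)%:C * expi ((M%:R - k%:R) * x).
Proof.
have c : (2 * cos (pi * x))%:C = expi (x / 2) + expi (- (x / 2)).
  rewrite /expi mulrN (mulrC 2 pi) -mulrA (_ : 2 * (x / 2) = x); last by field.
  by rewrite cosN sinN; apply/eqP; rewrite eq_complex /= subrr mulr2n mulrDl mul1r !eqxx.
have -> : (bump M x)%:C = (4 ^- M)%:C * (expi (x / 2) + expi (- (x / 2))) ^+ (2 * M).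
  rewrite -c; transitivity (4 ^- M * (2 * cos (pi * x)) ^+ (2 * M))%:C; last first.
    by rewrite rmorphM /= rmorphXn.
  congr (_%:C); rewrite /bump exprMn [2 ^+ _]exprM.
  by rewrite (_ : 2 ^+ 2 = 4) ?mulrA ?mulVf ?mul1r ?expf_neq0//; ring.
set e1 := expi (x / 2); set e2 := expi (- _).
rewrite [X in _ * X]exprDn mulr_sumr; apply: eq_bigr => k _; rewrite /e1 /e2.
rewrite -!expiM_nat -expiD /bump_coef.
have -> : (2 * M - k)%:R * (x / 2) + k%:R * - (x / 2) = (M%:R - k%:R) * x.
  by rewrite natrB -1?ltnS// natrM; field.
rewrite mulrnAr -mulrnAl; congr (_ * _).
by rewrite -[RHS]/(real_complex R _) rmorphM /= rmorph_nat [RHS]mulr_natl.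
Qed.

Lemma central_bin M k : ('C(2 * M, k) <= 'C(2 * M, M))%N.
Proof.
have up j : (j < M)%N -> ('C(2 * M, j) <= 'C(2 * M, j.+1))%N.
  move=> jM; rewrite -(@leq_pmul2l j.+1)// mul_bin_left leq_mul2r; apply/orP; right; lia.
have low j : (j <= M)%N -> ('C(2 * M, j) <= 'C(2 * M, M))%N.
  move=> jM; rewrite -(subKn jM); elim: (M - j)%N => [|i IH]; first by rewrite subn0.
  have [iM|Mi] := ltnP i M; last by rewrite (_ : M - i.+1 = M - i)%N//; lia.
  by apply: leq_trans IH; have := up (M - i.+1)%N; rewrite subnSK//; apply; lia.
have [kM|Mk] := leqP k M; first exact: low.
have [k2|k2] := leqP k (2 * M); last by rewrite bin_small.
by rewrite -bin_sub//; apply: low; lia.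
Qed.

Lemma sum_bump_coef M : \sum_(k < (2 * M).+1) bump_coef M k = 1.
Proof.
rewrite -mulr_suml -natr_sum.
have -> : (\sum_(k < (2 * M).+1) 'C(2 * M, k) = 4 ^ M)%N.
  have -> : (4 ^ M = (1 + 1) ^ (2 * M))%N by rewrite expnM.
  by rewrite expnDn; apply: eq_bigr => k _; rewrite !exp1n !muln1.
by rewrite natrX mulfV// expf_neq0.
Qed.

Lemma bump_coef_ge0 M k : 0 <= bump_coef M k.
Proof. by rewrite divr_ge0// exprn_ge0. Qed.

Lemma central_bump_coef M : (2 * M%:R + 1)^-1 <= bump_coef M M.
Proof.
have p : 0 < 2 * M%:R + 1 :> R by rewrite ltr_wpDl.
rewrite -[leLHS]mul1r ler_pdivrMr//.
apply: (@le_trans _ _ (\sum_(k < (2 * M).+1) bump_coef M k)); first by rewrite sum_bump_coef.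
apply: (@le_trans _ _ (\sum_(k < (2 * M).+1) bump_coef M M)).
  by apply: ler_sum => k _; rewrite ler_wpM2r ?invr_ge0 ?exprn_ge0// ler_nat central_bin.
by rewrite sumr_const card_ord -[leLHS]mulr_natl -natr1 natrM mulrC.
Qed.

End exponential_sums.

Section orbit_density.
Context {R : realType} {d : nat}.
Implicit Types (x y alpha theta : 'rV[R]_d) (h : 'rV[int]_d).

Lemma pairingD h x y : pairing h (x + y) = pairing h x + pairing h y.
Proof.
by rewrite /pairing -big_split; apply: eq_bigr => i _; rewrite mxE mulrDr.
Qed.

Lemma pairingMn h x n : pairing h (x *+ n) = n%:R * pairing h x.
Proof.
rewrite /pairing mulr_sumr; apply: eq_bigr => i _.
by rewrite mulmxnE -[x ord0 i *+ n]mulr_natl mulrCA.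
Qed.

Definition freq (M : nat) (f : {ffun 'I_d -> 'I_(2 * M).+1}) : 'rV[int]_d :=
  \row_i (M%:Z - (f i)%:Z).

Lemma prod_bump_expand M x : (\prod_i bump M (x ord0 i))%:C =
  \sum_(f : {ffun 'I_d -> 'I_(2 * M).+1})
     (\prod_i bump_coef M (f i))%:C * expi (pairing (freq f) x) :> R[i].
Proof.
rewrite (rmorph_prod (real_complex R)) /=.
rewrite (eq_bigr _ (fun i _ => bump_expand M (x ord0 i))) bigA_distr_bigA /=.
apply: eq_bigr => f _; rewrite big_split /= (rmorph_prod (real_complex R)); congr (_ * _).
rewrite /pairing (big_morph (@expi R) (@expiD R) (@expi0 R)).
apply: eq_bigr => i _; congr expi; rewrite mxE; congr (_ * _).
by rewrite intrD mulrNz.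
Qed.

(** The zero frequency gives the main term; every other frequency gives a
    geometric sum. *)
Lemma orbit_bump_lower M N x alpha (Bd : R) : 0 <= Bd ->
  (forall f : {ffun 'I_d -> 'I_(2 * M).+1}, freq f != 0 ->
     normc (\sum_(n < N) expi (pairing (freq f) x + n%:R * pairing (freq f) alpha)) <= Bd) ->
  N%:R * bump_coef M M ^+ d - Bd <= \sum_(n < N) \prod_i bump M ((x + alpha *+ n) ord0 i).
Proof.
move=> B0 HB; set S := \sum_(n < N) _.
pose W (f : {ffun 'I_d -> 'I_(2 * M).+1}) : R := \prod_i bump_coef M (f i).
have W0 f : 0 <= W f by apply: prodr_ge0 => i _; exact: bump_coef_ge0.
have W1 : \sum_f W f = 1.
  rewrite /W -(bigA_distr_bigA (fun (i : 'I_d) (k : 'I_(2 * M).+1) => bump_coef M k)) /=.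
  by rewrite big1// => i _; exact: sum_bump_coef.
have SE : S%:C = \sum_f (W f)%:C * \sum_(n < N) expi (pairing (freq f) x + n%:R * pairing (freq f) alpha).
  rewrite /S (rmorph_sum (real_complex R)) /=.
  rewrite (eq_bigr _ (fun (n : 'I_N) _ => prod_bump_expand M (x + alpha *+ n))) exchange_big /=.
  apply: eq_bigr => f _; rewrite mulr_sumr; apply: eq_bigr => n _.
  by rewrite pairingD pairingMn.
have lt : (M < (2 * M).+1)%N by rewrite ltnS leq_pmull.
pose f0 : {ffun 'I_d -> 'I_(2 * M).+1} := [ffun=> Ordinal lt].
have h0 : freq f0 = 0 by apply/rowP => i; rewrite !mxE ffunE subrr.
have Wf0 : W f0 = bump_coef M M ^+ d.
  by rewrite /W (eq_bigr (fun=> bump_coef M M)) ?prodr_const ?card_ord// => i _; rewrite ffunE.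
have nz f : f != f0 -> freq f != 0.
  apply: contra => /eqP e; apply/eqP/ffunP => i; rewrite ffunE; apply/val_inj => /=.
  by have := congr1 (fun v : 'rV[int]_d => v ord0 i) e; rewrite !mxE => /eqP; rewrite subr_eq0 => /eqP [].
have p0 y : pairing 0 y = 0 by rewrite /pairing big1// => i _; rewrite mxE mul0r.
have BdN : 0 <= \sum_(f | f != f0) W f by apply: sumr_ge0.
have e : normc (S%:C - (N%:R * W f0)%:C) <= (\sum_(f | f != f0) W f) * Bd.
  rewrite SE (bigD1 f0) //= h0 !p0.
  under eq_bigr => n _ do rewrite mulr0 addr0 expi0.
  rewrite sumr_const card_ord (_ : (W f0)%:C * _ = (N%:R * W f0)%:C); last first.
    by rewrite mulrC -[RHS]/(real_complex R _) rmorphM /= rmorph_nat.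
  rewrite addrAC subrr add0r mulr_suml; apply: (le_trans (normc_sum _ _ _)).
  apply: ler_sum => f ff0; rewrite normcM normc_real ger0_norm//.
  by rewrite ler_wpM2l// HB// nz.
have w1 : \sum_(f | f != f0) W f <= 1 by rewrite -W1 [leRHS](bigD1 f0)//= lerDr.
have eS : S%:C - (N%:R * W f0)%:C = (S - N%:R * W f0)%:C.
  by rewrite -[RHS]/(real_complex R _) rmorphB.
have := le_trans e (ler_piMl B0 w1); rewrite eS normc_real ler_norml Wf0 => /andP[H _].
by rewrite addrC -lerBrDr.
Qed.

Lemma r_height_freq_le M (f : {ffun 'I_d -> 'I_(2 * M).+1}) : (0 < M)%N ->
  r_height (freq f) <= (M ^ d)%:R :> R.
Proof.
move=> M0; rewrite /r_height natrX.
have -> : (M%:R : R) ^+ d = \prod_(i < d) M%:R by rewrite prodr_const card_ord.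
apply: ler_prod => i _; apply/andP; split; first by rewrite le_max ler01 orbT.
rewrite mxE ge_max ler1n M0 andbT -intr_norm -[M%:R]/((M%:Z)%:~R) ler_int.
have := ltn_ord (f i); lia.
Qed.

Lemma r_height_ge1 h : 1 <= r_height h :> R.
Proof.
rewrite /r_height; elim/big_ind : _ => // [x y x1 y1|i _]; last by rewrite le_max lexx orbT.
by rewrite mulr_ege1.
Qed.

(** The exponent is an integer and the constant is not normalized, so that the
    condition passes from [alpha] to its multiples. *)
Definition dioph alpha := exists (c : R) (T : nat), 0 < c /\
  forall h, h != 0 -> c / r_height h ^+ T <= dist_int (pairing h alpha).

Lemma dioph_mul alpha m : (0 < m)%N -> dioph alpha -> dioph (alpha *+ m).
Proof.
move=> m0 [c [T [c0 H]]]; have mR : (0 : R) < (m ^ d)%:R by rewrite ltr0n expn_gt0 m0.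
exists (c / (m ^ d)%:R ^+ T), T; split; first by rewrite divr_gt0// exprn_gt0.
move=> h h0; have r1 := r_height_ge1 h.
have r0 : 0 < r_height h :> R by exact: lt_le_trans r1.
have hm0 : h *+ m != 0.
  apply: contra h0 => /eqP e; apply/eqP/rowP => i; rewrite mxE.
  have := congr1 (fun v : 'rV[int]_d => v ord0 i) e; rewrite mulmxnE mxE => /eqP.
  by rewrite mulrn_eq0 eqn0Ngt m0 /= => /eqP.
have -> : pairing h (alpha *+ m) = pairing (h *+ m) alpha.
  rewrite pairingMn /pairing mulr_sumr; apply: eq_bigr => i _.
  by rewrite mulmxnE -[h ord0 i *+ m]mulr_natl intrM natz -pmulrn mulrA.
apply: le_trans (H _ hm0); rewrite -mulrA ler_wpM2l ?(ltW c0)// -invfM -exprMn.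
have rm0 : 0 < r_height (h *+ m) :> R by exact: lt_le_trans (r_height_ge1 _).
rewrite lef_pV2 ?posrE ?exprn_gt0 ?mulr_gt0//.
apply: lerXn2r; rewrite ?nnegrE; first exact: ltW; first by apply: ltW; rewrite mulr_gt0.
rewrite /r_height natrX.
have -> : (m%:R : R) ^+ d = \prod_(i < d) m%:R by rewrite prodr_const card_ord.
rewrite -big_split /=; apply: ler_prod => i _; apply/andP; split; first by rewrite le_max ler01 orbT.
rewrite mulmxnE -[h ord0 i *+ m]mulr_natl intrM natz -pmulrn normrM ger0_norm//.
rewrite maxr_pMr// mulr1 ge_max le_max lexx /= le_max; apply/orP; right.
by rewrite ler1n.
Qed.

Lemma DC_dioph tau alpha : DC tau alpha -> dioph alpha.
Proof.
move=> [c /= c0 Hc]; exists c, (Num.bound tau); split => // h h0.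
apply: le_trans (Hc h h0); rewrite ler_wpM2l ?(ltW c0)//.
have r1 := r_height_ge1 h.
have r0 : 0 < r_height h :> R by exact: lt_le_trans r1.
rewrite powRN lef_pV2 ?posrE ?exprn_gt0 ?powR_gt0//.
rewrite -powR_mulrn ?(le_trans ler01)//; apply: ler_powR => //.
by case: (leP 0 tau) => t0; [apply/ltW/archi_boundP|apply: le_trans (ltW t0) _].
Qed.

(** An orbit avoiding the target would keep the average of the bump below the
    contribution of its zero frequency. *)
Lemma orbit_hits_aux (c : R) (T M N : nat) alpha x (r : R) : 0 < c -> (0 < M)%N ->
  (forall h, h != 0 -> c / r_height h ^+ T <= dist_int (pairing h alpha)) ->
  0 <= r -> r <= 1 ->
  (M ^ d)%:R ^+ T / c < N%:R * (bump_coef M M ^+ d - (1 - r ^+ 2) ^+ M) ->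
  exists2 n : nat, (n < N)%N & forall i, exists k : int,
    `|(x + alpha *+ n) ord0 i - k%:~R| <= r.
Proof.
move=> c0 M0 Hdc r0 r1 HN; apply: contrapT => Hno.
have P0 : 0 < (M ^ d)%:R :> R by rewrite ltr0n expn_gt0 M0.
have := @orbit_bump_lower M N x alpha ((M ^ d)%:R ^+ T / c).
rewrite divr_ge0 ?exprn_ge0 ?(ltW c0)// => /(_ isT).
have HB (f : {ffun 'I_d -> 'I_(2 * M).+1}) : freq f != 0 ->
     normc (\sum_(n < N) expi (pairing (freq f) x + n%:R * pairing (freq f) alpha)) <= (M ^ d)%:R ^+ T / c.
  move=> fn0; have := Hdc _ fn0 => h1.
  have h2 : c / (M ^ d)%:R ^+ T <= dist_int (pairing (freq f) alpha).
    apply: le_trans h1; rewrite ler_wpM2l ?(ltW c0)// lef_pV2 ?posrE ?exprn_gt0//.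
      by rewrite lerXn2r// ?nnegrE ?ler0n// ?(le_trans ler01 (r_height_ge1 _))// r_height_freq_le.
    by rewrite (lt_le_trans ltr01 (r_height_ge1 _)).
  have h3 := expi_sub1_dist (pairing (freq f) alpha).
  have h4 := geometric_sum_bound (pairing (freq f) alpha) (pairing (freq f) x) N.
  set X := normc (\sum_(n < N) _) in h4 *.
  have X0 : 0 <= X by exact: normc_ge0.
  have cp : 0 < c / (M ^ d)%:R ^+ T by rewrite divr_gt0// exprn_gt0.
  rewrite -invf_div -[leRHS]mul1r ler_pdivlMr//.
  have h5 : 2 * (c / (M ^ d)%:R ^+ T) <= normc (expi (pairing (freq f) alpha) - 1).
    by apply: le_trans h3; rewrite ler_wpM2l.
  have := le_trans (ler_wpM2l X0 h5) h4; lra.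
move=> /(_ HB) lower.
have upper : \sum_(n < N) \prod_i bump M ((x + alpha *+ n) ord0 i) <= N%:R * (1 - r ^+ 2) ^+ M.
  rewrite mulr_natl -[X in _ *+ X](card_ord N) -sumr_const; apply: ler_sum => n _.
  have [i Hi] : exists i, forall k : int, r < `|(x + alpha *+ n) ord0 i - k%:~R|.
    apply: contrapT => Hn; apply: Hno; exists n => // i.
    apply: contrapT => Hk; apply: Hn; exists i => k; rewrite ltNge.
    by apply/negP => hk; apply: Hk; exists k.
  rewrite (bigD1 i) //=; set y := (x + alpha *+ n) ord0 i in Hi *.
  have b1 : bump M y <= (1 - r ^+ 2) ^+ M.
    apply: bump_small => //; have [m Hm] := exists_round y.
    rewrite (expi_sub1_int y m); apply: le_trans (expi_sub1_lower _); last by rewrite normr_ge0.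
    by rewrite ler_wpM2l// ltW.
  apply: le_trans b1; apply: ler_piMr; first exact: bump_ge0.
  by apply: prodr_ile1 => j _; rewrite bump_ge0 bump_le1.
have := le_trans lower upper; rewrite lerBlDr => h.
by move: HN; rewrite mulrBr ltrBrDr addrC ltNge => /negP; apply.
Qed.

(** The exponent [M] of the bump is a large multiple of [Q^4], so that its values
    at distance [1/Q] from the target are much smaller than its mean. *)
Lemma orbit_hits alpha : dioph alpha -> exists (C : R) (D : nat), 0 < C /\
  forall (Q : nat) (x y : 'rV[R]_d), (0 < Q)%N -> exists2 n : nat, n%:R <= C * Q%:R ^+ D &
    exists k : 'rV[int]_d, forall i,
      `|(x + alpha *+ n) ord0 i - y ord0 i - (k ord0 i)%:~R| <= Q%:R^-1.
Proof.
have dd1 : ((2 * d).+2 = d + d.+2)%N by lia.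
have dd2 : (2 * (d + d.+2) = 4 * d + 4)%N by lia.
move=> [c [T [c0 Hdc]]].
(* [s] terms of the exponential series suffice to beat the factor [M^d]. *)
pose s := (2 * d).+2; pose A := (2 * 3 ^ d * s`!)%N.
have A0 : (0 < A)%N by rewrite !muln_gt0 expn_gt0 fact_gt0.
pose C0 : R := 2 * 3 ^+ d * (A%:R) ^+ (d + d * T) / c.
exists (C0 + 1), (4 * (d + d * T))%N.
have C00 : 0 <= C0 by rewrite /C0 divr_ge0// ?(ltW c0)//; nneg.
split; first by rewrite ltr_wpDl.
move=> Q x y Q0; pose M := (A * Q ^ 4)%N.
have M0 : (0 < M)%N by rewrite muln_gt0 A0 expn_gt0 Q0.
have QR : (0 : R) < Q%:R by rewrite ltr0n.
have Q1 : (1 : R) <= Q%:R by rewrite ler1n.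
have AR : (0 : R) < A%:R by rewrite ltr0n.
have MR : (1 : R) <= M%:R by rewrite ler1n.
have b1 : (3 * M%:R)^-1 ^+ d <= bump_coef M M ^+ d :> R.
  rewrite lerXn2r// ?nnegrE ?bump_coef_ge0 ?invr_ge0 ?mulr_ge0//.
  apply: le_trans (central_bump_coef M); rewrite lef_pV2 ?posrE ?mulr_gt0 ?ltr0n//; first lra.
have e1 : (1 - (Q%:R^-1) ^+ 2) ^+ M <= (3 * M%:R)^-1 ^+ d / 2 :> R.
  apply: (@le_trans _ _ (expR (- (Q%:R^-1 ^+ 2)) ^+ M)).
    apply: lerXn2r; rewrite ?nnegrE ?expR_ge0//.
      by rewrite subr_ge0 exprn_ile1 ?invr_ge0// invf_le1.
    by have := expR_ge1Dx (- (Q%:R^-1 ^+ 2) : R).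
  have -> : (3 * M%:R)^-1 ^+ d / 2 = ((3 * M%:R) ^+ d * 2)^-1 :> R by rewrite [RHS]invfM exprVn.
  rewrite -expRM_natl mulrN expRN.
  rewrite lef_pV2 ?posrE ?expR_gt0 ?mulr_gt0 ?exprn_gt0//; last by rewrite mulr_gt0// (lt_le_trans ltr01).
  have -> : M%:R * Q%:R^-1 ^+ 2 = A%:R * Q%:R ^+ 2 :> R.
    by rewrite /M natrM natrX; field; rewrite gt_eqF.
  set X : R := A%:R * Q%:R ^+ 2.
  have X0 : 0 <= X by rewrite /X; nneg.
  have := @expR_ge1Dxn R X (2 * d).+1 X0; rewrite -/s => hX.
  apply: (@le_trans _ _ (X ^+ s / s`!%:R)); last by apply: le_trans hX; rewrite lerDr.
  have sf : (0 : R) < s`!%:R by rewrite ltr0n fact_gt0.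
  rewrite ler_pdivlMr//.
  have -> : X ^+ s = (A%:R ^+ d * Q%:R ^+ (4 * d)) * (A%:R ^+ d.+2 * Q%:R ^+ 4).
    rewrite /X /s exprMn -exprM.
    rewrite dd1 dd2; by rewrite !exprD; ring.
  have -> : (3 * M%:R) ^+ d * 2 * s`!%:R = (A%:R ^+ d * Q%:R ^+ (4 * d)) * A%:R :> R.
    have AE : A%:R = 2 * 3 ^+ d * s`!%:R :> R by rewrite /A !natrM natrX.
    transitivity (A%:R ^+ d * Q%:R ^+ (4 * d) * (2 * 3 ^+ d * s`!%:R) : R); last by rewrite -AE.
    have -> : M%:R = A%:R * Q%:R ^+ 4 :> R by rewrite /M natrM natrX.
    rewrite (exprM Q%:R 4); move: (Q%:R ^+ 4) (A%:R) (s`!%:R) => q a g.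
    by rewrite !exprMn; ring.
  apply: ler_wpM2l; first by nneg.
  rewrite -[leLHS]mulr1 ler_pM//; last by rewrite exprn_ege1.
  by rewrite exprS ler_peMr// exprn_ege1// ler1n.
pose N := (Num.truncn (2 * 3 ^+ d * M%:R ^+ d * ((M ^ d)%:R ^+ T / c) : R)).+1.
have HN : (M ^ d)%:R ^+ T / c < N%:R * (bump_coef M M ^+ d - (1 - Q%:R^-1 ^+ 2) ^+ M) :> R.
  have gap : (3 * M%:R)^-1 ^+ d / 2 <= bump_coef M M ^+ d - (1 - Q%:R^-1 ^+ 2) ^+ M :> R.
    by move: b1 e1; lra.
  apply: lt_le_trans (ler_wpM2l (ler0n _ _) gap).
  have M3 : 0 < (3 * M%:R) ^+ d :> R by rewrite exprn_gt0// mulr_gt0// (lt_le_trans ltr01).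
  rewrite exprVn -invfM ltr_pdivlMr ?mulr_gt0//.
  have := @truncnS_gt R (2 * 3 ^+ d * M%:R ^+ d * ((M ^ d)%:R ^+ T / c)).
  by rewrite -/N; congr (_ < _); rewrite exprMn; ring.
have Qi0 : 0 <= Q%:R^-1 :> R by rewrite invr_ge0.
have Qi1 : Q%:R^-1 <= 1 :> R by rewrite invf_le1.
have [n nN Hn] := @orbit_hits_aux c T M N alpha (x - y) (Q%:R^-1) c0 M0 Hdc Qi0 Qi1 HN.
exists n.
  have : (n%:R : R) <= 2 * 3 ^+ d * M%:R ^+ d * ((M ^ d)%:R ^+ T / c).
    have := nN; rewrite /N ltnS => nN'.
    apply: le_trans (_ : (Num.truncn (2 * 3 ^+ d * M%:R ^+ d * ((M ^ d)%:R ^+ T / c) : R))%:R <= _).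
      by rewrite ler_nat.
    have c0' := ltW c0; by rewrite truncn_le; nneg.
  move=> /le_trans; apply.
  have -> : 2 * 3 ^+ d * M%:R ^+ d * ((M ^ d)%:R ^+ T / c) = C0 * Q%:R ^+ (4 * (d + d * T)).
    rewrite /C0 natrX; have -> : M%:R = A%:R * Q%:R ^+ 4 :> R by rewrite /M natrM natrX.
    rewrite (exprM Q%:R 4); move: (Q%:R ^+ 4) (A%:R) => q a.
    by rewrite -exprM !exprMn !exprD; ring.
  by rewrite ler_wpM2r ?exprn_ge0// lerDl.
have [k Hk] := choice Hn.
exists (\row_i k i) => i; rewrite mxE; move: (Hk i); rewrite !mxE.
by rewrite (_ : x ord0 i - y ord0 i + _ - _ = x ord0 i + (alpha *+ n) ord0 i - y ord0 i - (k i)%:~R)//; ring.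
Qed.

End orbit_density.

(** * Equidistribution over grid cells *)
Section equidistribution.
Context {R : realType} {d : nat}.
Implicit Types (x y alpha theta : 'rV[R]_d) (p : nat).

(** The residues modulo [p.+1] make the cell depend on the point of the torus
    only. *)
Definition cell p x : {ffun 'I_d -> 'I_p.+1} :=
  [ffun i => inord `|(Num.floor (p.+1%:R * x ord0 i) %% p.+1%:Z)%Z|%N].

Lemma cellP p x i (a : 'I_p.+1) : (cell p x i = a) <->
  exists k : int, a%:R / p.+1%:R <= x ord0 i - k%:~R < a.+1%:R / p.+1%:R.
Proof.
have q0 : (0 : R) < p.+1%:R by rewrite ltr0n.
have qz : p.+1%:Z != 0 by [].
set F := Num.floor (p.+1%:R * x ord0 i).
have m0 : (0 <= F %% p.+1%:Z)%Z by exact: modz_ge0.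
have mlt : (F %% p.+1%:Z < p.+1%:Z)%Z by exact: ltz_mod.
have mabs : (`|(F %% p.+1%:Z)%Z|%N < p.+1)%N by lia.
rewrite /cell ffunE -/F; split => [e|[k /andP[k1 k2]]].
  have eF := divz_eq F p.+1%:Z.
  have ea : (F %% p.+1%:Z)%Z = a%:Z by rewrite -e inordK//; lia.
  rewrite ea in eF; exists (F %/ p.+1%:Z)%Z; move: eF; move: (F %/ p.+1%:Z)%Z => k eF.
  have h1 : F%:~R <= p.+1%:R * x ord0 i by exact: ge_floor.
  have h2 : p.+1%:R * x ord0 i < (F + 1)%:~R by exact: floorD1_gt.
  move: h1 h2; rewrite eF !intrD intrM -!pmulrn => h1 h2.
  rewrite ler_pdivrMr// ltr_pdivlMr// !mulrBl -(natr1 a).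
  by move: h1 h2; set q : R := p.+1%:R => h1 h2; apply/andP; split; lra.
have eF : F = k * p.+1%:Z + a%:Z.
  apply: floor_def; rewrite !intrD intrM -!pmulrn.
  move: k1 k2; rewrite ler_pdivrMr// ltr_pdivlMr// !mulrBl -(natr1 a).
  by set q : R := p.+1%:R => k1 k2; apply/andP; split; lra.
apply/val_inj; rewrite /= inordK//.
by rewrite eF modzMDl modz_small// ltz_nat ltn_ord.
Qed.

Definition visits alpha (N : nat) theta (P : pred 'rV[R]_d) : R :=
  \sum_(n < N) (P (theta + alpha *+ n))%:R.

Lemma visits_shift alpha N theta (P P' : pred 'rV[R]_d) n0 :
  (forall x, P x -> P' (x + alpha *+ n0)) ->
  visits alpha N theta P <= visits alpha N theta P' + n0%:R.
Proof.
move=> H; pose f n : R := (P' (theta + alpha *+ n))%:R.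
apply: (@le_trans _ _ (\sum_(n < N) f (n0 + n)%N)).
  apply: ler_sum => n _; rewrite /f ler_nat addnC mulrnDr addrA.
  by case: (P _) (H (theta + alpha *+ n)) => // ->.
apply: (@le_trans _ _ (\sum_(n < n0 + N) f n)).
  by rewrite big_split_ord /= lerDr; apply: sumr_ge0 => n _.
rewrite addnC big_split_ord /= lerD2l.
apply: (@le_trans _ _ (\sum_(n < n0) 1)); last by rewrite sumr_const card_ord.
by apply: ler_sum => n _; rewrite /f lern1; case: (P' _).
Qed.

Definition slab (i : 'I_d) (c w : R) : pred 'rV[R]_d :=
  fun x => `[< exists k : int, `|x ord0 i - c - k%:~R| <= w >].

Definition uniformly_dense alpha := forall Q : nat, (0 < Q)%N -> exists B : nat,
  forall x y : 'rV[R]_d, exists2 n : nat, (n <= B)%N & exists k : 'rV[int]_d, forall i,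
      `|(x + alpha *+ n) ord0 i - y ord0 i - (k ord0 i)%:~R| <= Q%:R^-1.

Lemma dioph_dense alpha : dioph alpha -> uniformly_dense alpha.
Proof.
move=> /orbit_hits[C [D [C0 H]]] Q Q0; exists (Num.bound (C * Q%:R ^+ D)) => x y.
have [n n1 n2] := H Q x y Q0; exists n => //.
rewrite -(@ler_nat R); apply: (le_trans n1); apply/ltW/archi_boundP.
by rewrite mulr_ge0 ?exprn_ge0// ltW.
Qed.

Lemma int_lt1_eq0 (k : int) : `|k%:~R : R| < 1 -> k = 0.
Proof. by rewrite -intr_norm -[ltRHS]/(1%:~R) ltr_int; lia. Qed.

Lemma residue_eq (J a b : nat) (K : int) : (a < J)%N -> (b < J)%N ->
  a%:Z - b%:Z + J%:Z * K = 0 -> a = b.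
Proof.
move=> aJ bJ e; have : K = 0 \/ K <= -1 \/ 1 <= K by lia.
by move=> [K0|[K0|K0]]; nia.
Qed.

(** The disjoint translates of a slab are visited about equally often, so each
    of them takes at most its share of the orbit. *)
Lemma slab_visits alpha J : uniformly_dense alpha -> (0 < J)%N -> exists B : nat,
  forall N theta i c, J%:R * visits alpha N theta (slab i c (8 * J%:R)^-1) <= N%:R + J%:R * B%:R.
Proof.
move=> Hd J0; have JR : (0 : R) < J%:R by rewrite ltr0n.
have [B HB] := Hd (8 * J)%N (ltac:(by rewrite muln_gt0)).
exists B => N theta i c.
pose w : R := (4 * J%:R)^-1.
have wE : (8 * J%:R)^-1 + (8 * J%:R)^-1 = w :> R by rewrite /w; field; rewrite gt_eqF.
have step (j : 'I_J) : visits alpha N theta (slab i c (8 * J%:R)^-1) <=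
    visits alpha N theta (slab i (c + j%:R / J%:R) w) + B%:R.
  have [n nB [k Hk]] := HB 0 (\row_l (j%:R / J%:R)).
  apply: (le_trans (@visits_shift _ _ _ _ (slab i (c + j%:R / J%:R) w) n _)).
    move=> x /asboolP[k' Hk']; apply/asboolP; exists (k' + k ord0 i).
    have := Hk i; rewrite add0r !mxE intrD => h.
    have -> : x ord0 i + (alpha *+ n) ord0 i - (c + j%:R / J%:R) - (k'%:~R + (k ord0 i)%:~R) =
       (x ord0 i - c - k'%:~R) + ((alpha *+ n) ord0 i - j%:R / J%:R - (k ord0 i)%:~R) by ring.
    rewrite -wE; apply: (le_trans (ler_normD _ _)); apply: lerD => //.
    by move: h; rewrite natrM.
  by rewrite lerD2l ler_nat.
have disj x : \sum_(j < J) (slab i (c + j%:R / J%:R) w x)%:R <= 1 :> R.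
  case: (pselect (exists j : 'I_J, slab i (c + j%:R / J%:R) w x)) => [[j Hj]|Hn]; last first.
    rewrite big1// => j _; case: (boolP (slab _ _ _ _)) => // h; exfalso; apply: Hn; by exists j.
  rewrite (bigD1 j) //= Hj big1 ?addr0// => j' jj'.
  case: (boolP (slab _ _ _ _)) => // /asboolP[k' Hk']; exfalso.
  move: Hj => /asboolP[k Hk].
  move/negP: jj'; apply; apply/eqP/val_inj/eqP.
  set X := x ord0 i - c in Hk Hk'.
  have h1 : `|j'%:R / J%:R - j%:R / J%:R + (k' - k)%:~R| <= 2 * w :> R.
    have -> : j'%:R / J%:R - j%:R / J%:R + (k' - k)%:~R =
      (x ord0 i - (c + j%:R / J%:R) - k%:~R) - (x ord0 i - (c + j'%:R / J%:R) - k'%:~R) by rewrite intrD mulrNz; ring.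
    by rewrite (le_trans (ler_normB _ _))// mulr2n mulrDl mul1r lerD.
  pose M : int := j'%:Z - j%:Z + J%:Z * (k' - k).
  have h2 : `|M%:~R : R| < 1.
    have -> : M%:~R = J%:R * (j'%:R / J%:R - j%:R / J%:R + (k' - k)%:~R) :> R.
      by rewrite /M !intrD intrM mulrNz -!pmulrn; field; rewrite gt_eqF.
    rewrite normrM gtr0_norm//; apply: (@le_lt_trans _ _ (J%:R * (2 * w))).
      by rewrite ler_wpM2l// ltW.
    have -> : J%:R * (2 * w) = 1 / 2 :> R by rewrite /w; field; rewrite gt_eqF.
    by lra.
  have M0 := int_lt1_eq0 h2.
  have jl := ltn_ord j; have jl' := ltn_ord j'.
  by apply/eqP; exact: (residue_eq jl' jl M0).
have tot : \sum_(j < J) visits alpha N theta (slab i (c + j%:R / J%:R) w) <= N%:R.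
  rewrite /visits exchange_big /=.
  apply: (@le_trans _ _ (\sum_(n < N) 1)); last by rewrite sumr_const card_ord.
  by apply: ler_sum => n _; exact: disj.
have -> : J%:R * visits alpha N theta (slab i c (8 * J%:R)^-1) =
  \sum_(j < J) visits alpha N theta (slab i c (8 * J%:R)^-1).
  by rewrite sumr_const card_ord mulr_natl.
apply: (@le_trans _ _ (\sum_(j < J) (visits alpha N theta (slab i (c + j%:R / J%:R) w) + B%:R))).
  by apply: ler_sum => j _; exact: step.
rewrite big_split /=.
apply: lerD => //; by rewrite sumr_const card_ord mulr_natl.
Qed.

Lemma face_low (Y u A D w : R) : Y = u + D + A -> 0 <= u -> `|D| <= w -> Y < A -> `|Y - A| <= w.
Proof. by rewrite !ler_norml => -> u0 /andP[h1 h2] h; apply/andP; split; lra. Qed.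

Lemma face_high (Y u A b D w : R) : Y = u + D + A -> u < b -> `|D| <= w -> A + b <= Y ->
  `|Y - (A + b)| <= w.
Proof. by rewrite !ler_norml => -> u0 /andP[h1 h2] h; apply/andP; split; lra. Qed.

(** Grid cells are translates of each other; moving an orbit from one to the
    other only loses the points that come close to the faces. *)
Lemma cell_visits alpha p (e : R) : uniformly_dense alpha -> 0 < e ->
  exists N0 : nat, forall N theta f, (N0 <= N)%N ->
    visits alpha N theta (fun x => cell p x == f) <= N%:R * ((p.+1%:R ^+ d)^-1 + e).
Proof.
move=> Hd e0; set q : R := p.+1%:R.
have q0 : 0 < q by rewrite ltr0n.
(* The faces are thickened by [w], and the [2 d] slabs so obtained take a
   proportion at most [2 d / J <= e / 2] of the orbit. *)
pose J := (Num.bound (4 * d%:R / e)).+1.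
have JR : (0 : R) < J%:R by rewrite ltr0n.
have HJ : 4 * d%:R / e <= J%:R.
  apply: (le_trans (ltW (archi_boundP _))); first by rewrite divr_ge0 ?mulr_ge0// ltW.
  by rewrite ler_nat.
have [B1 HB1] := @slab_visits alpha J Hd (ltn0Sn _).
have [B2 HB2] := Hd (8 * J)%N (ltac:(by rewrite muln_gt0)).
pose B : R := 2 * d%:R * B1%:R + B2%:R.
have Bge : 0 <= B by rewrite addr_ge0// !mulr_ge0.
exists (Num.bound (2 * B / e)).+1 => N theta f NN0.
have NR : 2 * B / e <= N%:R.
  apply: (le_trans (ltW (archi_boundP _))); first by rewrite divr_ge0 ?mulr_ge0// ltW.
  by rewrite ler_nat ltnW.
pose w : R := (8 * J%:R)^-1.
pose V P := visits alpha N theta P.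
have sl i c : V (slab i c w) <= N%:R / J%:R + B1%:R.
  have := HB1 N theta i c; rewrite -/w -/(V _) => h.
  rewrite -(ler_pM2l JR); apply: (le_trans h).
  by rewrite mulrDr mulrCA mulfV ?gt_eqF// mulr1.
pose bad (f' : {ffun 'I_d -> 'I_p.+1}) x : bool :=
  [exists i, slab i ((f' i)%:R / q) w x || slab i ((f' i).+1%:R / q) w x].
have step f' : V (fun x => cell p x == f) <= V (fun x => cell p x == f') + (2 * d%:R * (N%:R / J%:R) + B).
  have [n nB [k Hk]] := HB2 0 (\row_i ((f' i)%:R / q - (f i)%:R / q)).
  have : V (fun x => cell p x == f) <= V (fun x => (cell p x == f') || bad f' x) + n%:R.
    apply: visits_shift => x /eqP cx; rewrite -implyNb; apply/implyP => ncell.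
    have [i Hi] : exists i, cell p (x + alpha *+ n) i <> f' i.
      apply: contrapT => Hn; move/eqP: ncell; apply; apply/ffunP => i.
      by apply: contrapT => Hi; apply: Hn; exists i.
    apply/existsP; exists i.
    have := Hk i; rewrite add0r !mxE natrM => h.
    have [l /andP[l1 l2]] := (@cellP p x i (f i)).1 (congr1 (fun g : {ffun _ -> _} => g i) cx).
    rewrite -/q in l1 l2.
    have dec : (x + alpha *+ n) ord0 i - (k ord0 i + l)%:~R =
       (x ord0 i - l%:~R - (f i)%:R / q) + ((alpha *+ n) ord0 i - ((f' i)%:R / q - (f i)%:R / q) - (k ord0 i)%:~R) + (f' i)%:R / q.
      by rewrite mxE intrD; ring.
    have q1 j : j.+1%:R / q = j%:R / q + q^-1 :> R by rewrite -natr1 mulrDl mul1r.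
    rewrite q1 in l2.
    have [c1|c1] := ltP ((x + alpha *+ n) ord0 i - (k ord0 i + l)%:~R) ((f' i)%:R / q).
      apply/orP; left; apply/asboolP; exists (k ord0 i + l).
      by rewrite addrAC; apply: (face_low dec) c1; rewrite ?subr_ge0.
    have [c2|c2] := ltP ((x + alpha *+ n) ord0 i - (k ord0 i + l)%:~R) ((f' i).+1%:R / q).
      by exfalso; apply: Hi; apply/cellP; exists (k ord0 i + l); rewrite -/q c1 c2.
    apply/orP; right; apply/asboolP; exists (k ord0 i + l).
    by rewrite q1 in c2 *; rewrite addrAC; apply: (face_high dec _ _ c2) => //; rewrite ltrBlDl.
  move/le_trans; apply.
  have : V (fun x => (cell p x == f') || bad f' x) <= V (fun x => cell p x == f') +
     \sum_i (V (slab i ((f' i)%:R / q) w) + V (slab i ((f' i).+1%:R / q) w)).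
    rewrite /V /visits; under [X in _ <= _ + X]eq_bigr => i _ do rewrite -big_split /=.
    rewrite exchange_big -big_split /=; apply: ler_sum => m _.
    set y := theta + alpha *+ m.
    case: (cell p y == f') => /=; first by rewrite lerDl; apply: sumr_ge0 => i _; rewrite addr_ge0.
    rewrite add0r; case: (boolP (bad f' y)) => [/existsP[i Hi]|_]; last by apply: sumr_ge0 => i _; rewrite addr_ge0.
    rewrite (bigD1 i) //=; apply: (@le_trans _ _ ((slab i ((f' i)%:R / q) w y)%:R + (slab i ((f' i).+1%:R / q) w y)%:R)).
      by case/orP: Hi => ->; rewrite ?lerDl ?lerDr.
    by rewrite lerDl; apply: sumr_ge0 => j _; rewrite addr_ge0.
  move=> h; apply: (@le_trans _ _ (V (fun x => cell p x == f') + 2 * d%:R * (N%:R / J%:R + B1%:R) + B2%:R)).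
    apply: lerD; last by rewrite ler_nat.
    apply: (le_trans h); rewrite lerD2l.
    apply: (@le_trans _ _ (\sum_(i < d) 2 * (N%:R / J%:R + B1%:R))).
      by apply: ler_sum => i _; rewrite mulr2n mulrDl mul1r lerD.
    by rewrite sumr_const card_ord -[leLHS]mulr_natl mulrCA mulrA.
  by rewrite /B mulrDr !addrA.
have tot : \sum_f' V (fun x => cell p x == f') = N%:R.
  rewrite /V /visits exchange_big /= -[RHS]mulr1 -[N in RHS]card_ord mulr_natl -sumr_const.
  apply: eq_bigr => m _; rewrite (bigD1 (cell p (theta + alpha *+ m))) //= eqxx big1 ?addr0//.
  by move=> g; rewrite eq_sym => /negbTE ->.
have card : #|{ffun 'I_d -> 'I_p.+1}|%:R = q ^+ d :> R by rewrite card_ffun !card_ord natrX.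
have qd : 0 < q ^+ d by rewrite exprn_gt0.
have : q ^+ d * V (fun x => cell p x == f) <= N%:R + q ^+ d * (2 * d%:R * (N%:R / J%:R) + B).
  have cst (z : R) : q ^+ d * z = \sum_(f' : {ffun 'I_d -> 'I_p.+1}) z.
    by rewrite sumr_const -card mulr_natl.
  rewrite !cst -[X in _ <= X + _]tot -big_split /=.
  by apply: ler_sum => f' _; exact: step.
rewrite -ler_pdivlMl// mulrDr mulKf ?gt_eqF// => /le_trans; apply.
rewrite mulrDr [X in X + _ <= _]mulrC lerD2l.
have h1 : 2 * d%:R * (N%:R / J%:R) <= N%:R * (e / 2).
  rewrite mulrCA ler_wpM2l// ler_pdivrMr//.
  by move: HJ; rewrite ler_pdivrMr// => HJ; lra.
have h2 : B <= N%:R * (e / 2) by move: NR; rewrite ler_pdivrMr// => NR; lra.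
by rewrite [e in leRHS]splitr mulrDr lerD.
Qed.

End equidistribution.

(** * Covering numbers of smooth hypersurfaces *)
Section lipschitz.
Context {R : realType} {d : nat}.
Implicit Types (x y z v : 'rV[R]_d) (g : 'rV[R]_d -> R).

Lemma line_derivable g x v (t : R) : derivable g (x + t *: v) v ->
  is_derive t 1 (fun s : R => g (x + s *: v)) ('D_v g (x + t *: v)).
Proof.
move=> Hd.
have E : (fun h : R => h^-1 *: (((fun s : R => g (x + s *: v)) \o shift t) (h *: (1 : R)) - g (x + t *: v)))
  = (fun h : R => h^-1 *: ((g \o shift (x + t *: v)) (h *: v) - g (x + t *: v))).
  apply/funext => h /=; congr (_ *: (g _ - _)).
  by rewrite -[h *: 1]/(h * 1) mulr1 scalerDl addrCA.
by split; [rewrite /derivable E|rewrite /derive E].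
Qed.

Definition cube y0 (r : R) : set 'rV[R]_d := [set y | forall i, `|y ord0 i - y0 ord0 i| <= r].

Lemma step_lipschitz g y0 r (B : R) (i : 'I_d) z (s : R) : 
  (forall y, cube y0 r y -> derivable g y (delta_mx ord0 i) /\ `|'D_(delta_mx ord0 i) g y| <= B) ->
  cube y0 r z -> cube y0 r (z + s *: delta_mx ord0 i) ->
  `|g (z + s *: delta_mx ord0 i) - g z| <= B * `|s|.
Proof.
set e : 'rV[R]_d := delta_mx ord0 i => H Hz Hs.
wlog s0 : z s Hz Hs / 0 <= s.
  move=> W; have [s0|s0] := leP 0 s; first exact: W.
  have := W (z + s *: e) (- s) Hs.
  rewrite scaleNr addrK normrN distrC => /(_ Hz) h; apply: h; by rewrite oppr_ge0 ltW.
have conv t : 0 <= t <= s -> cube y0 r (z + t *: e).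
  move=> /andP[t0 ts] j; have := Hz j; have := Hs j; rewrite !mxE.
  have [_|_] := (boolP ((ord0 == ord0) && (j == i))); last by rewrite !mulr0.
  rewrite !mulr1 !ler_norml => /andP[h1 h2] /andP[h3 h4]; apply/andP; split; lra.
have D (t : R) : 0 <= t <= s -> is_derive t 1 (fun u : R => g (z + u *: e)) ('D_e g (z + t *: e)).
  by move=> ht; apply: line_derivable; exact: (H _ (conv t ht)).1.
have [||c] := @MVT_segment R (fun t => g (z + t *: e)) (fun t => 'D_e g (z + t *: e)) 0 s s0.
- by move=> t; rewrite in_itv /= => /andP[a b]; apply: D; rewrite !ltW.
- apply: derivable_within_continuous => t; rewrite in_itv /= => ht.
  by have [] := D t ht.
rewrite in_itv /= => hc; rewrite scale0r addr0 subr0 => ->.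
by rewrite normrM ler_wpM2r// (H _ (conv c hc)).2.
Qed.

(** Changing one coordinate at a time, the path stays inside the cube. *)
Lemma cube_lipschitz g y0 r (B m : R) : 0 <= B ->
  (forall (i : 'I_d) y, cube y0 r y ->
     derivable g y (delta_mx ord0 i) /\ `|'D_(delta_mx ord0 i) g y| <= B) ->
  forall x y, cube y0 r x -> cube y0 r y -> (forall i, `|x ord0 i - y ord0 i| <= m) ->
  `|g x - g y| <= d%:R * (B * m).
Proof.
move=> B0 H x y Hx Hy Hm.
(* [k] coordinates have already been changed. *)
pose mix (k : nat) : 'rV[R]_d := \row_i if (i < k)%N then y ord0 i else x ord0 i.
have mix0 : mix 0 = x by apply/rowP => i; rewrite mxE.
have mixd : mix d = y by apply/rowP => i; rewrite mxE ltn_ord.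
have mixc k : cube y0 r (mix k) by move=> i; rewrite mxE; case: ifP.
have st k : (k <= d)%N -> `|g x - g (mix k)| <= k%:R * (B * m).
  elim: k => [_|k IH kd]; first by rewrite mix0 subrr normr0 mul0r.
  have -> : g x - g (mix k.+1) = (g x - g (mix k)) + (g (mix k) - g (mix k.+1)) by rewrite addrA subrK.
  apply: (le_trans (ler_normD _ _)); rewrite -natr1 mulrDl mul1r; apply: lerD; first exact/IH/ltnW.
  pose i := Ordinal kd.
  have e : mix k.+1 = mix k + (y ord0 i - x ord0 i) *: delta_mx ord0 i.
    apply/rowP => j; rewrite !mxE ltnS eqxx /=.
    have [->|ji] := eqVneq j i; first by rewrite leqnn ltnn mulr1 addrC subrK.
    by rewrite mulr0 addr0 leq_eqVlt (_ : (j == k :> nat) = false) //; apply/negbTE.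
  rewrite distrC e; apply: (le_trans (step_lipschitz (H i) (mixc k) _)); first by rewrite -e.
  by rewrite ler_wpM2l// distrC.
by have := st d (leqnn _); rewrite mixd.
Qed.

End lipschitz.

Section covering.
Context {R : realType} {d : nat}.
Implicit Types (x y z p : 'rV[R]_d) (M : set 'rV[R]_d).

Lemma nbhs_cube (P : set 'rV[R]_d) y0 : nbhs y0 P -> exists2 r : R, 0 < r & cube y0 r `<=` P.
Proof.
move=> /nbhs_ballP[e /= e0 He]; exists (e / 2); first by rewrite divr_gt0.
move=> y Hy; apply: He; split => // i j; rewrite (ord1 i) /ball /= distrC.
by apply: (le_lt_trans (Hy j)); rewrite ltr_pdivrMr// mulr2n mulrDr mulr1 ltrDl.
Qed.

(** In straightened coordinates the hypersurface is a flat piece of dimension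
    [d - 1]; the inverse chart is Lipschitz and carries a grid on this piece to
    the required centers. *)
Lemma finite_covering_local M p : (0 < d)%N -> smooth_submanifold d.-1 M -> M p ->
  exists (N : set 'rV[R]_d) (C : nat), [/\ open N, N p &
    forall q, (0 < q)%N -> exists s : seq 'rV[R]_d, (size s <= C * q ^ d.-1)%N /\
      forall x, M x -> N x -> exists2 c, c \in s & forall i, `|x ord0 i - c ord0 i| <= q%:R^-1].
Proof.
move=> d0 HM Mp; have [U [V [F [G [[oU Up] [oV FUV] [sF sG] GF slice]]]]] := HM p Mp.
set y0 := F p.
have Vy0 : V y0 by rewrite -FUV; exists p.
pose D (ij : 'I_d * 'I_d) y := 'D_(delta_mx ord0 ij.1 : 'rV[R]_d) (fun x => G x ord0 ij.2) y.
pose B : R := \sum_ij (`|D ij y0| + 1).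
have B0 : 0 <= B by apply: sumr_ge0 => ij _; rewrite addr_ge0.
have HB : \forall y \near y0, V y /\ forall ij, `|D ij y| <= B.
  apply: filterI; first exact: open_nbhs_nbhs.
  apply: (@filter_forall _ _ (fun ij y => `|D ij y| <= B) (nbhs y0)) => -[i j].
  have [_ /(_ i)[_ [cD _]]] := sG j 1%N.
  have c := cD _ Vy0.
  have : \forall y \near y0, `|D (i, j) y0 - D (i, j) y| < 1.
    by move/cvgrPdist_lt : c; apply.
  apply: filterS => y Hy.
  have h1 : `|D (i, j) y| <= `|D (i, j) y0| + 1.
    rewrite -[X in `|X| <= _](subrK (D (i, j) y0)); apply: (le_trans (ler_normD _ _)).
    by rewrite addrC lerD2l distrC ltW.
  apply: (le_trans h1); rewrite /B (bigD1 (i, j))//= lerDl.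
  by apply: sumr_ge0 => ij _; rewrite addr_ge0.
have [r r0 Hr] := nbhs_cube HB.
have lip x y (m : R) j : cube y0 r x -> cube y0 r y -> (forall i, `|x ord0 i - y ord0 i| <= m) ->
    `|G x ord0 j - G y ord0 j| <= d%:R * (B * m).
  move=> Hx Hy Hm; apply: (@cube_lipschitz _ _ (fun x => G x ord0 j) y0 r) => // i z Hz.
  have [Vz Bz] := Hr z Hz; have [_ /(_ i)[dD _]] := sG j 1%N.
  by split; [exact: dD|exact: (Bz (i, j))].
pose N0 := [set x | U x /\ forall j, `|F x ord0 j - y0 ord0 j| <= r].
have N0p : nbhs p N0.
  apply: filterI; first exact: open_nbhs_nbhs.
  apply: (@filter_forall _ _ (fun j x => `|F x ord0 j - y0 ord0 j| <= r) (nbhs p)) => j.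
  have [cF _] := sF j 0%N.
  have := cF _ Up; move/cvgrPdist_lt => /(_ r r0); apply: filterS => x Hx.
  by rewrite distrC ltW.
pose K := (Num.bound (d%:R * B * (2 * r))).+1.
have HK : d%:R * B * (2 * r) <= K%:R.
  apply: (le_trans (ltW (archi_boundP _))); last by rewrite ler_nat.
  by rewrite !mulr_ge0// ltW.
exists (interior N0), (K.+1 ^ d.-1)%N; split; [exact: open_interior|exact: N0p|].
move=> q q0; pose n := (K * q)%N.
have n0 : (0 < n)%N by rewrite muln_gt0.
have nR : (0 : R) < n%:R by rewrite ltr0n.
have qR : (0 : R) < q%:R by rewrite ltr0n.
pose pt (a : {ffun 'I_d.-1 -> 'I_n.+1}) : 'rV[R]_d :=
  \row_i if (insub (val i) : option 'I_d.-1) is Some l then y0 ord0 i - r + 2 * r * (a l)%:R / n%:R else 0.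
exists [seq G (pt a) | a <- enum {ffun 'I_d.-1 -> 'I_n.+1}]; split.
  rewrite size_map -cardE card_ffun !card_ord -expnMn.
  have nK : (n.+1 <= K.+1 * q)%N by rewrite mulSn /n addnC -addn1 leq_add2l.
  by elim: d.-1 => // e IH; rewrite !expnS leq_mul.
move=> x Mx /interior_subset[Ux Fx].
have last0 z : U z -> M z -> forall i : 'I_d, (d.-1 <= i)%N -> F z ord0 i = 0.
  by move=> Uz Mz; apply/(slice z Uz).1.
pose a : {ffun 'I_d.-1 -> 'I_n.+1} :=
  [ffun l => inord (Num.truncn (n%:R * (F x ord0 (widen_ord (leq_pred d) l) - y0 ord0 (widen_ord (leq_pred d) l) + r) / (2 * r)))].
have r2 : 0 < 2 * r by rewrite mulr_gt0.
have key i : `|F x ord0 i - pt a ord0 i| <= 2 * r / n%:R /\ `|pt a ord0 i - y0 ord0 i| <= r.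
  rewrite mxE; case: insubP => [l _ li|/= hi].
    have -> : i = widen_ord (leq_pred d) l by apply/val_inj; rewrite /= -li.
    rewrite ffunE; set j := widen_ord _ l.
    have := Fx j; rewrite ler_norml; set f := F x ord0 j; set b := y0 ord0 j => /andP[f1 f2].
    set X := n%:R * (f - b + r) / (2 * r).
    have X0 : 0 <= X by rewrite divr_ge0 ?mulr_ge0 ?(ltW r2)//; lra.
    have Xn : X <= n%:R by rewrite ler_pdivrMr// ler_wpM2l//; lra.
    have /andP[t1 t2] := truncn_itv X0.
    have tn : (Num.truncn X < n.+1)%N by rewrite ltnS -(ler_nat R) (le_trans t1).
    rewrite inordK//; move: t1 t2; set t : R := (Num.truncn X)%:R.
    rewrite -natr1 -/t => t1 t2; have t0 : 0 <= t by [].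
    have fE : f - b + r = 2 * r * X / n%:R by rewrite /X; field; rewrite !gt_eqF.
    have h1 : 2 * r * t / n%:R <= 2 * r * X / n%:R by rewrite ler_wpM2r ?invr_ge0// ler_wpM2l// ltW.
    have h2 : 2 * r * X / n%:R <= 2 * r * t / n%:R + 2 * r / n%:R.
      by rewrite -mulrDl ler_wpM2r ?invr_ge0// -[X in _ + X]mulr1 -mulrDr ler_wpM2l// ltW.
    have h3 : 0 <= 2 * r * t / n%:R by rewrite divr_ge0 ?mulr_ge0// ltW.
    split; rewrite ler_norml; apply/andP; split; lra.
  have id1 : (d.-1 <= i)%N by rewrite leqNgt.
  rewrite (last0 x)// /y0 (last0 p)// subrr normr0 divr_ge0 ?(ltW r0) ?(ltW r2)//.
exists (G (pt a)).
  by apply/mapP; exists a => //; rewrite mem_enum.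
move=> j; rewrite -{1}(GF x Ux); apply: (le_trans (@lip (F x) (pt a) (2 * r / n%:R) j _ _ _)).
- exact: Fx.
- by move=> i; exact: (key i).2.
- by move=> i; exact: (key i).1.
have -> : d%:R * (B * (2 * r / n%:R)) = d%:R * B * (2 * r) / K%:R * q%:R^-1.
  by rewrite /n natrM; field; rewrite !gt_eqF// ltr0n.
by rewrite ler_piMl ?invr_ge0// ler_pdivrMr ?mul1r// ltr0n.
Qed.

Definition unit_box : set 'rV[R]_d := [set x | forall i, 0 <= x ord0 i <= 1].

(** Compactness of the fundamental domain turns the local count into a global one. *)
Lemma covering_number M : (0 < d)%N -> closed M -> smooth_submanifold d.-1 M ->
  exists C : nat, forall q, (0 < q)%N -> exists s : seq 'rV[R]_d, (size s <= C * q ^ d.-1)%N /\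
      forall x, M x -> unit_box x -> exists2 c, c \in s & forall i, `|x ord0 i - c ord0 i| <= q%:R^-1.
Proof.
move=> d0 cM HM.
have box_compact : compact unit_box.
  have -> : unit_box = [set v | forall i, `[(0 : R), 1]%classic (v ord0 i)].
    by apply/seteqP; split => x Hx i; have := Hx i; rewrite /= in_itv.
  apply: (@rV_compact R d (fun=> `[(0 : R), 1]%classic)) => i; exact: segment_compact.
have Kc : compact (M `&` unit_box).
  by rewrite setIC; apply: compact_closedI.
have H p : exists NC : set 'rV[R]_d * nat, M p -> [/\ open NC.1, NC.1 p &
    forall q, (0 < q)%N -> exists s : seq 'rV[R]_d, (size s <= NC.2 * q ^ d.-1)%N /\
      forall x, M x -> NC.1 x -> exists2 c, c \in s & forall i, `|x ord0 i - c ord0 i| <= q%:R^-1].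
  have [Mp|nMp] := pselect (M p); last by exists (set0, 0%N).
  by have [N [C HN]] := finite_covering_local d0 HM Mp; exists (N, C).
have [NC HNC] := choice H.
move: Kc; rewrite compact_cover => /(_ _ (M `&` unit_box) (fun p => (NC p).1)) [].
- by move=> p [Mp _]; have [] := HNC p Mp.
- by move=> p [Mp Hp]; exists p => //; have [] := HNC p Mp.
move=> D DM cov; pose L : seq 'rV[R]_d := finmap.enum_fset D.
exists (\sum_(p <- L) (NC p).2)%N => q q0.
have H2 p : exists s : seq 'rV[R]_d, p \in L -> (size s <= (NC p).2 * q ^ d.-1)%N /\
      forall x, M x -> (NC p).1 x -> exists2 c, c \in s & forall i, `|x ord0 i - c ord0 i| <= q%:R^-1.
  have [pD|pD] := boolP (p \in L); last by exists [::].
  have [Mp _] : (M `&` unit_box) p by have := DM p pD; rewrite inE.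
  by have [_ _ /(_ q q0)[s Hs]] := HNC p Mp; exists s.
have [s Hs] := choice H2.
exists (flatten [seq s p | p <- L]); split.
  rewrite size_flatten /shape -map_comp sumnE big_map big_distrl /=.
  rewrite big_seq [leqRHS]big_seq; apply: leq_sum => p pD; exact: (Hs p pD).1.
move=> x Mx bx; have [p pD Np] := cov x (conj Mx bx).
have [c cs Hc] := (Hs p pD).2 x Mx Np.
by exists c => //; apply/flattenP; exists (s p) => //; apply/mapP; exists p.
Qed.

End covering.

(** * Oscillation of the potential on grid cells *)
Section holder.
Context {R : realType} {d : nat}.
Implicit Types (x y z : 'rV[R]_d) (g phi : 'rV[R]_d -> R) (S M : set 'rV[R]_d).

Lemma l2norm_ge0 x : 0 <= l2norm x.
Proof. exact: sqrtr_ge0. Qed.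

Lemma l2norm_le x (m : R) : 0 <= m -> (forall i, `|x ord0 i| <= m) -> l2norm x <= d%:R * m.
Proof.
move=> m0 Hm; rewrite /l2norm.
have sx (i : 'I_d) : x ord0 i ^+ 2 <= m ^+ 2.
  by rewrite -(@real_normK _ (x ord0 i)) ?num_real// lerXn2r// nnegrE.
have h1 : \sum_i x ord0 i ^+ 2 <= d%:R * m ^+ 2.
  apply: (@le_trans _ _ (\sum_(i < d) m ^+ 2)); first by apply: ler_sum => i _; exact: sx.
  by rewrite sumr_const card_ord mulr_natl.
have h2 : d%:R * m ^+ 2 <= (d%:R * m) ^+ 2.
  rewrite exprMn ler_wpM2r ?sqr_ge0// expr2.
  case: (d) => [|e]; first by rewrite mul0r.
  by rewrite ler_peMr// ler1n.
rewrite -[leRHS]ger0_norm; last by rewrite mulr_ge0.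
by rewrite -sqrtr_sqr ler_wsqrtr// (le_trans h1).
Qed.

Lemma l2norm_eq0 x : l2norm x = 0 -> x = 0.
Proof.
move=> /eqP; rewrite /l2norm sqrtr_eq0 => h; apply/rowP => i; rewrite mxE.
have s0 : \sum_i x ord0 i ^+ 2 = 0 by apply: le_anti; rewrite h sumr_ge0// => j _; exact: sqr_ge0.
have := psumr_eq0P (fun j _ => sqr_ge0 (x ord0 j)) s0 => /(_ i isT) /eqP.
by rewrite sqrf_eq0 => /eqP.
Qed.

Lemma zvec0 : zvec 0 = 0 :> 'rV[R]_d.
Proof. by apply/rowP => i; rewrite !mxE. Qed.

(** A nonzero integer shift moves a coordinate difference of size at most 1/2 to
    one of size at least 1/2. *)
Lemma torus_dist_local x y : (forall i, `|x ord0 i - y ord0 i| <= 1 / 2) ->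
  torus_dist x y = l2norm (x - y).
Proof.
move=> H; apply/eqP; rewrite eq_le; apply/andP; split.
  apply: ge_inf; first by exists 0 => _ [k _ <-]; exact: l2norm_ge0.
  by exists 0 => //; rewrite zvec0 addr0.
apply: lb_le_inf; first by exists (l2norm (x - y + zvec 0)); exists 0.
move=> _ [k _ <-]; apply: ler_wsqrtr; apply: ler_sum => i _; rewrite !mxE.
have := H i; set u := x ord0 i - y ord0 i => hu.
have [->|k0] := eqVneq (k ord0 i) 0; first by rewrite addr0.
have k1 : 1 <= `|(k ord0 i)%:~R : R|.
  by rewrite -intr_norm -[leLHS]/(1%:~R) ler_int; lia.
rewrite -(@real_normK _ u) ?num_real// -(@real_normK _ (u + _)) ?num_real//.
rewrite lerXn2r ?nnegrE//.
have := lerB_normD ((k ord0 i)%:~R) u; rewrite [_ + u]addrC => h; lra.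
Qed.

Lemma holder_space_modulus (gamma : R) g : (0 < d)%N -> 0 < gamma -> holder_space gamma g ->
  exists C : R, 0 <= C /\ (forall x, `|g x| <= C) /\
    forall x y (m : R), (forall i, `|x ord0 i - y ord0 i| <= m) -> m <= 1 / 2 ->
      `|g x - g y| <= C * (d%:R * m) `^ gamma.
Proof.
move=> d0 g0 [gper]; rewrite /holder_norm.
set A := ereal_sup _; set B := ereal_sup _ => fin.
have A0 : (0 <= A)%E.
  by apply: (@le_trans _ _ (`|g 0|%:E)); [rewrite lee_fin|apply: ereal_sup_ubound; exists 0].
have B0 : (0 <= B)%E.
  pose y : 'rV[R]_d := const_mx (1 / 2).
  apply: (@le_trans _ _ ((`|g 0 - g y| / torus_dist 0 y `^ gamma)%:E)).
    by rewrite lee_fin divr_ge0// powR_ge0.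
  apply: ereal_sup_ubound; exists 0, y; split => // -[k].
  move=> /(congr1 (fun v : 'rV[R]_d => v ord0 (Ordinal d0))); rewrite !mxE => e.
  have : (k ord0 (Ordinal d0) *+ 2 + 1)%:~R = 0 :> R.
    by rewrite intrD mulr2n intrD; lra.
  by move/eqP; rewrite intr_eq0; lia.
have Afin : A \is a fin_num.
  rewrite ge0_fin_numE//; apply: le_lt_trans fin; exact: leeDl.
have Bfin : B \is a fin_num.
  rewrite ge0_fin_numE//; apply: le_lt_trans fin; exact: leeDr.
exists (fine A + fine B); have fA := fine_ge0 A0; have fB := fine_ge0 B0.
split; first by rewrite addr_ge0.
split.
  move=> x; apply: (@le_trans _ _ (fine A)); last by rewrite lerDl.
  by rewrite -lee_fin fineK//; apply: ereal_sup_ubound; exists x.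
move=> x y m Hm m2.
have m0 : 0 <= m by apply: le_trans (Hm (Ordinal d0)).
have dm0 : 0 <= d%:R * m by rewrite mulr_ge0.
have [xy|nxy] := pselect (torus_eq x y).
  by case: xy => k ->; rewrite gper subrr normr0 mulr_ge0 ?addr_ge0// powR_ge0.
have xy : x - y != 0.
  apply/eqP => /eqP; rewrite subr_eq0 => /eqP e; apply: nxy; exists 0.
  by rewrite zvec0 addr0.
have tl : torus_dist x y = l2norm (x - y).
  by apply: torus_dist_local => i; apply: (le_trans (Hm i)).
have tp : 0 < torus_dist x y.
  by rewrite tl lt_neqAle l2norm_ge0 andbT eq_sym; apply: contra xy => /eqP/l2norm_eq0 ->.
have h : `|g x - g y| / torus_dist x y `^ gamma <= fine B.
  by rewrite -lee_fin fineK//; apply: ereal_sup_ubound; exists x, y.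
rewrite ler_pdivrMr ?powR_gt0// in h.
apply: (le_trans h); apply: ler_pM => //; rewrite ?powR_ge0 ?lerDr//.
apply: ge0_ler_powR; rewrite ?nnegrE ?(ltW g0) ?(ltW tp)//.
by rewrite tl; apply: l2norm_le => // i; rewrite !mxE.
Qed.

Lemma translate_continuous (v : 'rV[R]_d) : continuous (fun x : 'rV[R]_d => x + v).
Proof.
move=> x; apply: (@continuousD R _ _ id (cst v) x); [by move=> P|exact: cst_continuous].
Qed.

Lemma boundary_periodic S x k : zperiodic_set S -> boundary S x -> boundary S (x + zvec k).
Proof.
move=> HS.
have nb y (P : set 'rV[R]_d) (l : 'rV[int]_d) : nbhs (y + zvec l) P -> nbhs y (fun z => P (z + zvec l)).
  by move=> h; have := @translate_continuous (zvec l) y; move=> /(_ P h).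
have zN l : zvec (- l) = - zvec l :> 'rV[R]_d by apply/rowP => i; rewrite !mxE mulrNz.
move=> [cl ni]; split.
  move=> B HB; have [y [Sy By]] := cl _ (nb _ _ _ HB).
  by exists (y + zvec k); split => //; apply/HS.
move=> h; apply: ni; have := nb _ _ _ h; apply: filterS => y; exact: (HS y k).1.
Qed.

Lemma closed_boundary S : closed (boundary S).
Proof.
rewrite /boundary setDE; apply: closedI; first exact: closed_closure.
by apply: open_closedC; exact: open_interior.
Qed.

(** The segment is connected, and away from the boundary [S] is both open and
    closed. *)
Lemma segment_same_side S x y : (forall t : R, 0 <= t <= 1 -> ~ boundary S (x + t *: (y - x))) ->
  S x -> S y.
Proof.
move=> H Sx; pose z (t : R) := x + t *: (y - x).
have cz : continuous z.
  have -> : z = (fun v => v + x) \o (fun t : R => t *: (y - x)) by apply/funext => t /=; rewrite addrC.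
  move=> t; apply: continuous_comp; last exact: translate_continuous.
  exact: scalel_continuous.
have z0 : z 0 = x by rewrite /z scale0r addr0.
have z1 : z 1 = y by rewrite /z scale1r addrC subrK.
pose A := `[(0 : R), 1]%classic.
pose B := A `&` (z @^-1` (interior S)).
have E : B = A `&` (z @^-1` (closure S)).
  apply/seteqP; split => t [At /= h]; split => //=.
    by apply: subset_closure; exact: interior_subset.
  apply: contrapT => ni; apply: (H t) => //; by move: At; rewrite /A /= in_itv.
have cA : connected A by exact: segment_connected.
have BA : B = A.
  apply: cA.
  - exists 0; rewrite E; split; first by rewrite /A /= in_itv /= lexx ler01.
    by rewrite /= z0; exact: subset_closure.
  - exists (z @^-1` (interior S)) => //.
    by move/continuousP : cz; apply; exact: open_interior.
  - exists (z @^-1` (closure S)) => //.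
    by move/continuous_closedP : cz; apply; exact: closed_closure.
have : B 1 by rewrite BA /A /= in_itv /= lexx ler01.
by move=> [_ /=]; rewrite z1 => /interior_subset.
Qed.

End holder.

Section good_cells.
Context {R : realType} {d : nat}.
Implicit Types (x y alpha theta : 'rV[R]_d) (g phi : 'rV[R]_d -> R) (S M : set 'rV[R]_d).

Lemma cell_zvec p x k : cell p (x + zvec k) = cell p x.
Proof.
apply/ffunP => i; apply/cellP.
have [k0 Hk] := (cellP x i (cell p x i)).1 erefl.
by exists (k0 + k ord0 i); rewrite !mxE intrD opprD addrACA subrr addr0.
Qed.

Lemma cell_representative p x : exists k : 'rV[int]_d, forall i,
  (cell p x i)%:R / p.+1%:R <= (x + zvec k) ord0 i < (cell p x i).+1%:R / p.+1%:R.
Proof.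
have H i := (cellP x i (cell p x i)).1 erefl.
have [k Hk] := choice H; exists (\row_i - k i) => i.
by rewrite !mxE mulrNz; exact: Hk.
Qed.

Lemma unit_representative x : exists k : 'rV[int]_d, unit_box (x + zvec k).
Proof.
exists (\row_i - Num.floor (x ord0 i)) => i; rewrite !mxE mulrNz.
have h1 := @ge_floor R (x ord0 i) ; have h2 := floorD1_gt (x ord0 i).
rewrite intrD in h2; apply/andP; split; lra.
Qed.

(** The cell next to that of [y] in the direction [e - 1], where each [e i - 1] is
    -1, 0 or 1. *)
Definition cell_offset p y (e : {ffun 'I_d -> 'I_3}) : {ffun 'I_d -> 'I_p.+1} :=
  [ffun i => inord `|((Num.floor (p.+1%:R * y ord0 i) + (e i)%:Z - 1) %% p.+1%:Z)%Z|%N].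

Lemma cell_near p x y : (forall i, `|x ord0 i - y ord0 i| <= p.+1%:R^-1) ->
  exists e, cell p x = cell_offset p y e.
Proof.
move=> H.
have q0 : (0 : R) < p.+1%:R by rewrite ltr0n.
have He i : exists e : 'I_3, Num.floor (p.+1%:R * x ord0 i) = Num.floor (p.+1%:R * y ord0 i) + e%:Z - 1.
  have : `|p.+1%:R * (x ord0 i - y ord0 i)| <= 1.
    by rewrite normrM gtr0_norm// mulrC -ler_pdivlMr// div1r.
  rewrite ler_norml mulrBr => /andP[].
  set u := x ord0 i; set v := y ord0 i; set q := p.+1%:R => h1 h2.
  have a1 : (Num.floor (q * u))%:~R <= q * u by exact: ge_floor.
  have a2 : q * u < (Num.floor (q * u) + 1)%:~R by exact: floorD1_gt.
  have b1 : (Num.floor (q * v))%:~R <= q * v by exact: ge_floor.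
  have b2 : q * v < (Num.floor (q * v) + 1)%:~R by exact: floorD1_gt.
  move: (Num.floor (q * u)) (Num.floor (q * v)) a1 a2 b1 b2 => A B a1 a2 b1 b2.
  have c1 : A%:~R < (B + 2)%:~R :> R by move: a2 b2 a1 b1 h1 h2; rewrite !intrD; lra.
  have c2 : (B)%:~R < (A + 2)%:~R :> R by move: a2 b2 a1 b1 h1 h2; rewrite !intrD; lra.
  move: c1 c2; rewrite !ltr_int => c1 c2.
  have c3 : (absz (A - B + 1)%R < 3)%N by lia.
  by exists (Ordinal c3) => /=; lia.
have [e E] := choice He.
by exists [ffun i => e i]; apply/ffunP => i; rewrite !ffunE E.
Qed.

Lemma indicator_eq S x y (u v : R) : (S x <-> S y) ->
  `|\1_S x * u - \1_S y * v| <= `|u - v|.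
Proof.
move=> H; rewrite !indicE; have [Sx|Sx] := pselect (S x).
  by rewrite !mem_set ?mul1r//; apply/H.
by rewrite !memNset ?mul0r ?subrr ?normr0//; move=> /H.
Qed.

(** A window of the orbit starting in a cell sees nearly the same potential
    wherever in the cell it starts, unless the cell comes within the window
    close to one of the discontinuity hypersurfaces; having codimension one,
    these spoil only few cells. *)
Definition tame phi := exists Phi C H gamma : R,
  [/\ 0 <= Phi, 0 <= C, 0 <= H & 0 < gamma] /\ (forall x, `|phi x| <= Phi) /\
  forall alpha k p, (0 < p)%N -> exists bad : seq {ffun 'I_d -> 'I_p.+1},
    (size bad)%:R <= C * k%:R * p.+1%:R ^+ d.-1 /\
    forall x y j, cell p x = cell p y -> cell p x \notin bad -> (j < k)%N ->
      `|phi (x + alpha *+ j) - phi (y + alpha *+ j)| <= H * p.+1%:R `^ (- gamma).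

(** A cell met by the hypersurface translated by [- alpha *+ j] is adjacent to the
    cell of one of the translated covering centers. *)
Lemma bad_cells M : (0 < d)%N -> closed M -> smooth_submanifold d.-1 M ->
  (forall x k, M x -> M (x + zvec k)) -> exists C : nat,
  forall alpha k p, exists bad : seq {ffun 'I_d -> 'I_p.+1},
    (size bad <= C * k * p.+1 ^ d.-1)%N /\
    forall x j, (j < k)%N -> M (x + alpha *+ j) -> cell p x \in bad.
Proof.
move=> d0 cM sM pM; have [C HC] := covering_number d0 cM sM.
exists (C * 3 ^ d)%N => alpha k p.
have [s [size_s Hs]] := HC p.+1 isT.
pose E := enum {: {ffun 'I_d -> 'I_3}}.
pose bad := [seq cell_offset p (cj.1 - alpha *+ cj.2) e | cj <- [seq (c, j) | c <- s, j <- iota 0 k], e <- E].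
exists bad; split.
  have sE : size E = (3 ^ d)%N by rewrite /E -cardT card_ffun !card_ord.
  rewrite !size_allpairs size_iota sE.
  have -> : (C * 3 ^ d * k * p.+1 ^ d.-1 = C * p.+1 ^ d.-1 * k * 3 ^ d)%N by ring.
  by rewrite !leq_mul2r size_s !orbT.
move=> x j jk Mx.
have [k0 Hk] := unit_representative (x + alpha *+ j).
have [c cs Hc] := Hs _ (pM _ k0 Mx) Hk.
have [e He] : exists e, cell p (x + zvec k0) = cell_offset p (c - alpha *+ j) e.
  apply: cell_near => i; have := Hc i; rewrite !mxE.
  by congr (`| _ | <= _); lra.
rewrite -(cell_zvec p x k0) He; apply/allpairsP; exists ((c, j), e) => /=; split => //.
- by apply/allpairsP; exists (c, j) => /=; split => //; rewrite mem_iota.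
- by rewrite /E mem_enum.
Qed.

(** Two points of a good cell are joined by a segment inside the cell, which
    crosses none of the discontinuities during the whole window. *)
Lemma piecewise_holder_tame phi : (0 < d)%N -> zperiodic phi -> piecewise_holder phi -> tame phi.
Proof.
move=> d0 phiP [gamma [K [g [S [g0 Hg HS Hb phiE]]]]].
have H1 i := holder_space_modulus d0 g0 (Hg i).
have [c Hc] := choice H1.
have c0 i : 0 <= c i by have [] := Hc i.
have H2 i := bad_cells d0 (@closed_boundary R d (S i)) (Hb i).1 (fun x k => @boundary_periodic R d (S i) x k (HS i)).
have [B HB] := choice H2.
exists (\sum_i c i), (\sum_i B i)%N%:R, (\sum_i c i * d%:R `^ gamma), gamma; split.
  split => //; first exact: sumr_ge0.
  by apply: sumr_ge0 => i _; rewrite mulr_ge0// powR_ge0.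
split.
  move=> x; rewrite phiE; apply: (le_trans (ler_norm_sum _ _ _)); apply: ler_sum => i _.
  rewrite normrM; have := (Hc i).2.1 x.
  rewrite indicE; case: (_ \in _); rewrite ?normr1 ?normr0 ?mul1r ?mul0r//.
move=> alpha k p p0.
have H3 i := HB i alpha k p.
have [bad Hbad] := choice H3.
exists (flatten [seq bad i | i <- enum 'I_K]); split.
  rewrite size_flatten /shape -map_comp sumnE big_map big_enum /=.
  rewrite natr_sum !natr_sum !mulr_suml; apply: ler_sum => i _.
  by rewrite -!natrM -natrX -natrM ler_nat; exact: (Hbad i).1.
move=> x y j exy nbad jk.
have [kx Hx] := cell_representative p x; have [ky Hy] := cell_representative p y.
have px (v : 'rV[R]_d) l : phi (v + alpha *+ j) = phi ((v + zvec l) + alpha *+ j).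
  by rewrite addrAC phiP.
rewrite (px x kx) (px y ky).
rewrite -exy in Hy.
have q0 : (0 : R) < p.+1%:R by rewrite ltr0n.
pose x' := x + zvec kx; pose y' := y + zvec ky.
rewrite -/x' -/y' in Hx Hy *.
have cx : cell p x' = cell p x by exact: cell_zvec.
have seg t : 0 <= t <= 1 -> cell p (x' + t *: (y' - x')) = cell p x.
  move=> /andP[t0 t1]; apply/ffunP => i; apply/cellP; exists 0; rewrite subr0.
  move: (Hx i) (Hy i); rewrite !mxE; set a := _ / _; set b := _ / _.
  set u := x ord0 i + _; set v := y ord0 i + _ => /andP[h1 h2] /andP[h3 h4].
  apply/andP; split.
    have := mulr_ge0 t0 (_ : 0 <= v - a); have := mulr_ge0 (_ : 0 <= 1 - t) (_ : 0 <= u - a).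
    by rewrite !subr_ge0 => /(_ t1 h1) w1 /(_ h3) w2; nra.
  have [t2|t2] := leP t (1/2).
    have := mulr_ge0 t0 (_ : 0 <= b - v); have := mulr_gt0 (_ : 0 < 1 - t) (_ : 0 < b - u).
    by rewrite !subr_gt0 subr_ge0 => /(_ (ltac:(lra)) h2) w1 /(_ (ltW h4)) w2; nra.
  have := mulr_gt0 (_ : 0 < t) (_ : 0 < b - v); have := mulr_ge0 (_ : 0 <= 1 - t) (_ : 0 <= b - u).
  by rewrite !subr_gt0 !subr_ge0 => /(_ t1 (ltW h2)) w1 /(_ (ltac:(lra)) h4) w2; nra.
have nb i t : 0 <= t <= 1 -> ~ boundary (S i) (x' + t *: (y' - x') + alpha *+ j).
  move=> ht hb; move/negP : nbad; apply.
  rewrite -(seg t ht); apply/flattenP; exists (bad i).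
    by apply/mapP; exists i => //; rewrite mem_enum.
  exact: (Hbad i).2 hb.
have same i : S i (x' + alpha *+ j) <-> S i (y' + alpha *+ j).
  split; apply: segment_same_side => t ht.
    have := nb i t ht; congr (~ boundary _ _).
    by apply/rowP => l; rewrite !mxE; ring.
  have ht' : 0 <= 1 - t <= 1 by move: ht => /andP[? ?]; apply/andP; split; lra.
  have := nb i _ ht'; congr (~ boundary _ _).
  by apply/rowP => l; rewrite !mxE; ring.
have m2 : (p.+1%:R)^-1 <= 1 / 2 :> R.
  by rewrite div1r lef_pV2 ?posrE// ler_nat.
have near i : `|(x' + alpha *+ j) ord0 i - (y' + alpha *+ j) ord0 i| <= p.+1%:R^-1.
  move: (Hx i) (Hy i); rewrite -(natr1 (cell p x i)) mulrDl div1r !mxE.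
  set a := _ / _; move=> /andP[h1 h2] /andP[h3 h4].
  set b := p.+1%:R^-1 in h2 h4 *; set c1 := (alpha *+ j) ord0 i; rewrite ler_norml; apply/andP; split; move: h1 h2 h3 h4; lra.
rewrite !phiE -sumrB; apply: (le_trans (ler_norm_sum _ _ _)).
rewrite mulr_suml; apply: ler_sum => i _.
apply: (le_trans (indicator_eq _ _ (same i))).
apply: (le_trans ((Hc i).2.2 _ _ _ near m2)).
by rewrite powRM ?invr_ge0// -powR_inv1// -powRrM mulN1r mulrA.
Qed.

End good_cells.

(** * Integrals of functions constant on grid cells *)
Section step_integrals.
Context {R : realType}.
Local Notation RR := (measurableTypeR R).
Local Notation Rn n := (n.-tuple RR).

Definition tbox n (a b : nat -> R) : set (Rn n) :=
  [set t | forall i : 'I_n, a i <= tnth t i < b i].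

Arguments tbox : clear implicits.

Lemma measurable_tbox n a b : measurable (tbox n a b).
Proof.
have -> : tbox n a b = \bigcap_(i in [set: 'I_n]) ((fun t : Rn n => tnth t i) @^-1` `[a i, b i[%classic).
  apply/seteqP; split => t /= H i => [_|] /=; first by rewrite in_itv /=; exact: H.
  by have := H i Logic.I; rewrite /= in_itv.
apply: fin_bigcap_measurable => // i _; rewrite -[X in measurable X]setTI.
apply: measurable_tnth => //; exact: measurable_itv.
Qed.

Lemma lebesgue_Rn_tbox n a b : (forall i, a i <= b i) ->
  lebesgue_Rn n (tbox n a b) = (\prod_(i < n) (b i - a i))%:E.
Proof.
elim: n a b => [|n IH] a b H /=.
  rewrite big_ord0 diracE mem_set//; by case.
rewrite /lebesgue_step /pushforward.
have -> : @tcons R n @^-1` (tbox n.+1 a b) = `[a 0%N, b 0%N[%classic `*` tbox n (a \o S) (b \o S).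
  apply/seteqP; split => -[x t] /=.
    move=> h; split; first by have := h ord0; rewrite tnth0 /= in_itv.
    by move=> i; have := h (lift ord0 i); rewrite /tcons tnthS.
  by rewrite /= in_itv /= => -[h1 h2] i; case: (unliftP ord0 i) => [j ->|->]; rewrite /tcons ?tnthS ?tnth0//; exact: h2.
rewrite product_measure1E; last 2 first.
- exact: measurable_itv.
- exact: measurable_tbox.
rewrite IH; last by move=> i; exact: H.
rewrite big_ord_recl /= EFinM; congr (_ * _)%E.
rewrite lebesgue_measure_itv /= lte_fin; case: ifPn => //.
by rewrite -leNgt => h; congr EFin; apply/eqP; rewrite eq_sym subr_eq0 eq_le h H.
Qed.

(** The integral of a nonnegative function is a supremum over the simple functions
    below it, hence monotone on arbitrary functions. *)
Lemma ge0_le_integral_upper dd (T : measurableType dd) (mu : {measure set T -> \bar R}) (D : set T)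
    (f1 f2 : T -> \bar R) : (forall x, D x -> (0 <= f1 x)%E) -> (forall x, D x -> (f1 x <= f2 x)%E) ->
  (\int[mu]_(x in D) f1 x <= \int[mu]_(x in D) f2 x)%E.
Proof.
move=> f10 f12; have f20 x : D x -> (0 <= f2 x)%E by move=> Dx; rewrite (le_trans (f10 x Dx)) ?f12.
rewrite !ge0_integralE//; apply: ereal_sup_le => _ [h /= Hh <-]; exists h => //= x.
apply: (le_trans (Hh x)); rewrite /patch; case: ifPn => //.
by rewrite inE => /f12.
Qed.

Context {d : nat}.
Implicit Types (g : 'rV[R]_d -> R).

Let D : set (Rn d) := [set t | unit_cube (\row_i tnth t i)].

Let D_tbox : D = tbox d (fun=> 0) (fun=> 1).
Proof. by apply/seteqP; split => t /= H i; have := H i; rewrite mxE. Qed.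

Let mD : measurable D.
Proof. by rewrite D_tbox; exact: measurable_tbox. Qed.

Lemma integral_cell_function p (w : {ffun 'I_d -> 'I_p.+1} -> R) : (forall f, 0 <= w f) ->
  (\int[lebesgue_Rn d]_(t in D) (w (cell p (\row_i tnth t i)))%:E)%E =
  ((p.+1%:R ^+ d)^-1 * \sum_f w f)%:E.
Proof.
move=> w0; have q0 : (0 : R) < p.+1%:R by rewrite ltr0n.
pose lo (f : {ffun 'I_d -> 'I_p.+1}) (i : nat) : R := (if insub i is Some j then (f j : nat) else 0%N)%:R / p.+1%:R.
pose hi (f : {ffun 'I_d -> 'I_p.+1}) (i : nat) : R := (if insub i is Some j then (f j : nat) else 0%N).+1%:R / p.+1%:R.
have loE f (i : 'I_d) : lo f i = (f i)%:R / p.+1%:R by rewrite /lo valK.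
have hiE f (i : 'I_d) : hi f i = (f i).+1%:R / p.+1%:R by rewrite /hi valK.
have hilo f i : hi f i - lo f i = p.+1%:R^-1 by rewrite /hi /lo -mulrBl -natrB// subSnn mul1r.
pose box f := tbox d (lo f) (hi f).
have boxD f : box f `<=` D.
  rewrite D_tbox => t /= H i; have /andP[h1 h2] := H i; apply/andP; split.
    by apply: (le_trans _ h1); rewrite loE divr_ge0.
  by apply: (lt_le_trans h2); rewrite hiE ler_pdivrMr// mul1r ler_nat.
have boxP t f : D t -> box f t <-> cell p (\row_i tnth t i) = f.
  move=> Dt; split => [H|<-] .
    apply/ffunP => i; apply/cellP; exists 0; rewrite subr0 mxE.
    by have := H i; rewrite loE hiE.
  move=> i; rewrite loE hiE.
  have [k] := (cellP (\row_i tnth t i) i (cell p (\row_i tnth t i) i)).1 erefl.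
  have := Dt i; rewrite !mxE; move: (cell p _ i) => a /andP[u0 u1] /andP[k1 k2].
  suff k0 : k = 0 by move: k1 k2; rewrite k0 subr0 => -> ->.
  have a0 : 0 <= a%:R / p.+1%:R :> R by rewrite divr_ge0.
  have a1 : a.+1%:R / p.+1%:R <= 1 :> R by rewrite ler_pdivrMr// mul1r ler_nat.
  have aux (u l A B : R) : 0 <= u -> u < 1 -> A <= u - l -> u - l < B -> 0 <= A -> B <= 1 -> l < 1 /\ -1 < l.
    by move=> *; split; lra.
  have [c1 c2] := aux _ _ _ _ u0 u1 k1 k2 a0 a1.
  by move: c1 c2; rewrite -[1]/(1%:~R) -mulrNz !ltr_int; lia.
transitivity (\int[lebesgue_Rn d]_(t in D) (\sum_f ((w f)%:E * (\1_(box f) t)%:E)))%E.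
  apply: eq_integral => t; rewrite inE => Dt.
  rewrite (bigD1 (cell p (\row_i tnth t i)))//= indicE mem_set ?mule1; last exact/(boxP _ _ Dt).
  rewrite big1 ?adde0// => f /eqP nf; rewrite indicE memNset ?mule0//.
  by move/(boxP _ _ Dt) => e; apply: nf.
rewrite ge0_integral_sum//.
- rewrite mulr_sumr -sumEFin; apply: eq_bigr => f _.
  rewrite ge0_integralZl_EFin//.
  + rewrite integral_indic//; last exact: measurable_tbox.
    have -> : box f `&` D = box f by apply/seteqP; split => [t []//|t h]; split => //; exact: boxD h.
    have vol : lebesgue_Rn d (box f) = (\prod_(i < d) (hi f i - lo f i))%:E.
      by apply: lebesgue_Rn_tbox => i; rewrite -subr_ge0 hilo invr_ge0.
    transitivity ((w f)%:E * (\prod_(i < d) (hi f i - lo f i))%:E)%E; first by congr (_ * _)%E.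
    rewrite -EFinM mulrC; congr ((_ * _)%:E).
    under eq_bigr do rewrite hilo.
    by rewrite prodr_const card_ord exprVn.
  + apply/measurable_realfun.measurable_EFinP; apply: measurable_realfun.measurable_indic; exact: measurable_tbox.
- move=> f; apply: measurable_funeM; apply/measurable_realfun.measurable_EFinP; apply: measurable_realfun.measurable_indic; exact: measurable_tbox.
- by move=> f t _; rewrite mule_ge0 ?lee_fin.
Qed.

(** [g] itself may be arbitrary; only the cell function above it has to be
    measurable. *)
Lemma torus_integral_le p (w : {ffun 'I_d -> 'I_p.+1} -> R) g : (forall x, 0 <= g x) ->
  (forall f, 0 <= w f) -> (forall x, g x <= w (cell p x)) ->
  torus_integral g <= (p.+1%:R ^+ d)^-1 * \sum_f w f.
Proof.
move=> g0 w0 gw.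
have h : (\int[lebesgue_Rn d]_(t in D) (g (\row_i tnth t i))%:E <= ((p.+1%:R ^+ d)^-1 * \sum_f w f)%:E)%E.
  by rewrite -integral_cell_function//; apply: ge0_le_integral_upper => t _; rewrite lee_fin.
rewrite -lee_fin /torus_integral /Rintegral fineK// ge0_fin_numE; first exact: le_lt_trans h (ltry _).
by apply: integral_ge0 => t _; rewrite lee_fin.
Qed.

Lemma torus_integral_ge p (w : {ffun 'I_d -> 'I_p.+1} -> R) g (W : R) : (forall f, 0 <= w f) ->
  (forall x, w (cell p x) <= g x) -> (forall x, g x <= W) ->
  (p.+1%:R ^+ d)^-1 * \sum_f w f <= torus_integral g.
Proof.
move=> w0 wg gW.
have W0 : 0 <= W by apply: le_trans (gW 0); apply: le_trans (wg 0); exact: w0.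
have fin : (\int[lebesgue_Rn d]_(t in D) (g (\row_i tnth t i))%:E < +oo)%E.
  apply: (@le_lt_trans _ _ (\int[lebesgue_Rn d]_(t in D) ((fun=> W) (cell 0 (\row_i tnth t i)))%:E)%E).
    apply: ge0_le_integral_upper => t _; rewrite lee_fin ?gW//.
    exact: le_trans (w0 _) (wg _).
  by rewrite (@integral_cell_function 0%N (fun=> W))// ltry.
rewrite -lee_fin /torus_integral /Rintegral fineK; last first.
  rewrite ge0_fin_numE//; apply: integral_ge0 => t _; rewrite lee_fin.
  exact: le_trans (w0 _) (wg _).
rewrite -integral_cell_function//; apply: ge0_le_integral_upper => t _; rewrite lee_fin//.
Qed.

End step_integrals.

(** * Norms and perturbations of transfer matrices *)
Section matrix_norms.
Context {R : realType}.
Local Notation C := R[i].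
Implicit Types (A B : 'M[C]_2) (z w : C).

(** Equivalent to [opnorm] within a factor 4, and visibly submultiplicative. *)
Definition entry_norm A : R := \sum_i \sum_j normc (A i j).

Lemma entry_norm2 A : entry_norm A =
  normc (A 0 0) + normc (A 0 1) + (normc (A 1 0) + normc (A 1 1)).
Proof. by rewrite /entry_norm !big_ord_recl !big_ord0 !addr0; congr (_ + normc (A _ _) + (normc (A _ _) + normc (A _ _))); apply/val_inj. Qed.

Lemma entry_norm_ge0 A : 0 <= entry_norm A.
Proof. by apply: sumr_ge0 => i _; apply: sumr_ge0 => j _; exact: normc_ge0. Qed.

Lemma entry_normD A B : entry_norm (A + B) <= entry_norm A + entry_norm B.
Proof.
rewrite -big_split; apply: ler_sum => i _ /=; rewrite -big_split; apply: ler_sum => j _ /=.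
by rewrite mxE; exact: le_normcD.
Qed.

Lemma entry_normN A : entry_norm (- A) = entry_norm A.
Proof. by apply: eq_bigr => i _; apply: eq_bigr => j _; rewrite mxE normcN. Qed.

Lemma entry_norm_mul A B : entry_norm (A *m B) <= entry_norm A * entry_norm B.
Proof.
have h i j : normc ((A *m B) i j) <= normc (A i 0) * normc (B 0 j) + normc (A i 1) * normc (B 1 j).
  rewrite mxE !big_ord_recl big_ord0 addr0 -!normcM; apply: (le_trans (le_normcD _ _)).
  by rewrite (_ : lift ord0 ord0 = 1)//; apply/val_inj.
have := h 0 0; have := h 0 1; have := h 1 0; have := h 1 1.
rewrite !entry_norm2.
have := normc_ge0 (A 0 0); have := normc_ge0 (A 0 1); have := normc_ge0 (A 1 0); have := normc_ge0 (A 1 1).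
have := normc_ge0 (B 0 0); have := normc_ge0 (B 0 1); have := normc_ge0 (B 1 0); have := normc_ge0 (B 1 1).
move: (normc (A 0 0)) (normc (A 0 1)) (normc (A 1 0)) (normc (A 1 1)) => a b c d.
move: (normc (B 0 0)) (normc (B 0 1)) (normc (B 1 0)) (normc (B 1 1)) => a' b' c' d'.
move: (normc _) (normc _) (normc _) (normc _) => x1 x2 x3 x4 *.
have := mulr_ge0 (_ : 0 <= a) (_ : 0 <= c'); have := mulr_ge0 (_ : 0 <= a) (_ : 0 <= d').
have := mulr_ge0 (_ : 0 <= b) (_ : 0 <= a'); have := mulr_ge0 (_ : 0 <= b) (_ : 0 <= b').
have := mulr_ge0 (_ : 0 <= c) (_ : 0 <= c'); have := mulr_ge0 (_ : 0 <= c) (_ : 0 <= d').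
have := mulr_ge0 (_ : 0 <= d) (_ : 0 <= a'); have := mulr_ge0 (_ : 0 <= d) (_ : 0 <= b').
do 8 (move=> /(_ ltac:(assumption) ltac:(assumption)) ?).
lra.
Qed.

Lemma cvnorm_mul_le A v : cvnorm v <= 1 -> cvnorm (A *m v) <= entry_norm A.
Proof.
move=> v1; have vi i : normc (v i ord0) <= 1.
  have v0 : 0 <= cvnorm v by exact: sqrtr_ge0.
  have : normc (v i ord0) ^+ 2 <= 1.
    apply: (@le_trans _ _ (\sum_i normc (v i ord0) ^+ 2)).
      by rewrite (bigD1 i)//= lerDl; apply: sumr_ge0 => j _; exact: sqr_ge0.
    have -> : \sum_i normc (v i ord0) ^+ 2 = cvnorm v ^+ 2.
      by rewrite sqr_sqrtr//; apply: sumr_ge0 => j _; exact: sqr_ge0.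
    by rewrite expr_le1.
  by rewrite expr_le1 ?normc_ge0.
have h i : normc ((A *m v) i ord0) <= \sum_j normc (A i j).
  rewrite mxE; apply: (le_trans (normc_sum _ _ _)); apply: ler_sum => j _.
  by rewrite normcM ler_piMr ?normc_ge0.
have r0 i : 0 <= \sum_j normc (A i j) by apply: sumr_ge0 => j _; exact: normc_ge0.
rewrite -[leRHS]ger0_norm ?entry_norm_ge0// -sqrtr_sqr; apply: ler_wsqrtr.
have -> : entry_norm A = (\sum_j normc (A ord0 j)) + (\sum_j normc (A (lift ord0 ord0) j)).
  by rewrite /entry_norm big_ord_recl big_ord_recl big_ord0 addr0.
rewrite big_ord_recl big_ord_recl big_ord0 addr0.
apply: (@le_trans _ _ ((\sum_j normc (A ord0 j)) ^+ 2 + (\sum_j normc (A (lift ord0 ord0) j)) ^+ 2)).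
  by apply: lerD; rewrite lerXn2r ?nnegrE ?normc_ge0 ?r0 ?h.
move: (r0 ord0) (r0 (lift ord0 ord0)); move: (\sum_j _) (\sum_j _) => a b *.
by rewrite sqrrD; nra.
Qed.

Lemma opnorm_le A : opnorm A <= entry_norm A.
Proof.
apply: ge_sup; first by exists (cvnorm (A *m 0)); exists 0 => //=; rewrite /cvnorm big1 ?sqrtr0// => i _; rewrite mxE normc0 expr0n.
by move=> _ [v /= v1 <-]; exact: cvnorm_mul_le.
Qed.

Lemma opnorm_col A j : cvnorm (col j A) <= opnorm A.
Proof.
apply: ub_le_sup; first by exists (entry_norm A) => _ [v /= v1 <-]; exact: cvnorm_mul_le.
exists (delta_mx j ord0); last by rewrite -colE.
rewrite /= /cvnorm (bigD1 j)//= big1 => [|i ij]; last by rewrite mxE (negbTE ij) normc0 expr0n.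
by rewrite mxE !eqxx normc1 expr1n addr0 sqrtr1.
Qed.

Lemma entry_le_cvnorm A i j : normc (A i j) <= cvnorm (col j A).
Proof.
rewrite /cvnorm -[leLHS]ger0_norm ?normc_ge0// -sqrtr_sqr; apply: ler_wsqrtr.
by rewrite (bigD1 i)//= mxE lerDl; apply: sumr_ge0 => k _; exact: sqr_ge0.
Qed.

Lemma entry_norm_le A : entry_norm A <= 4 * opnorm A.
Proof.
have h i j : normc (A i j) <= opnorm A by apply: le_trans (entry_le_cvnorm _ _ _) (opnorm_col _ _).
rewrite entry_norm2; have := h 0 0; have := h 0 1; have := h 1 0; have := h 1 1; lra.
Qed.

Lemma det2 (K : comPzRingType) (A : 'M[K]_2) : \det A = A 0 0 * A 1 1 - A 0 1 * A 1 0.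
Proof.
rewrite (expand_det_row _ 0) !big_ord_recl big_ord0 addr0 /cofactor !det_mx11 !mxE /= expr0 mul1r expr1 mulN1r mulrN.
by congr (_ * A _ _ - A _ _ * A _ _); apply/val_inj.
Qed.

(** Hadamard: the determinant is at most the product of the norms of the columns. *)
Lemma opnorm_ge1 A : \det A = 1 -> 1 <= opnorm A.
Proof.
move=> dA; have n0 : 0 <= opnorm A by apply: le_trans (opnorm_col A 0); exact: sqrtr_ge0.
suff : 1 <= opnorm A ^+ 2 by rewrite expr_ge1.
have c0 : cvnorm (col 0 A) <= opnorm A := opnorm_col A 0.
have c1 : cvnorm (col 1 A) <= opnorm A := opnorm_col A 1.
have c0' : 0 <= cvnorm (col 0 A) by exact: sqrtr_ge0.
have c1' : 0 <= cvnorm (col 1 A) by exact: sqrtr_ge0.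
apply: (@le_trans _ _ (cvnorm (col 0 A) * cvnorm (col 1 A))); last by rewrite expr2 ler_pM.
suff : 1 <= (cvnorm (col 0 A) * cvnorm (col 1 A)) ^+ 2 by rewrite expr_ge1// mulr_ge0.
have sq j : cvnorm (col j A) ^+ 2 = normc (A 0 j) ^+ 2 + normc (A 1 j) ^+ 2.
  rewrite sqr_sqrtr; last by apply: sumr_ge0 => i _; exact: sqr_ge0.
  by rewrite !big_ord_recl big_ord0 addr0 !mxE (_ : lift ord0 ord0 = 1)//; apply/val_inj.
rewrite exprMn !sq.
have h : 1 <= normc (A 0 0) * normc (A 1 1) + normc (A 0 1) * normc (A 1 0).
  have : normc (\det A) = 1 by rewrite dA normc1.
  have := le_normcD (A 0 0 * A 1 1) (- (A 0 1 * A 1 0)).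
  by rewrite -det2 normcN !normcM dA normc1.
have := normc_ge0 (A 0 0); have := normc_ge0 (A 0 1); have := normc_ge0 (A 1 0); have := normc_ge0 (A 1 1).
move: h; move: (normc (A 0 0)) (normc (A 0 1)) (normc (A 1 0)) (normc (A 1 1)) => a b c d h *.
have h2 : 1 <= (a * d + b * c) ^+ 2 by rewrite expr_ge1// addr_ge0// mulr_ge0.
by have := sqr_ge0 (a * b - c * d); nra.
Qed.

End matrix_norms.

Section cocycles.
Context {R : realType} {d : nat}.
Local Notation C := R[i].
Variables (phi : 'rV[R]_d -> R) (alpha : 'rV[R]_d).
Implicit Types (A B : 'M[C]_2) (x y theta : 'rV[R]_d) (z w : C).

Local Notation cocyc := (cocycle_iter phi alpha).

Lemma rotationE n theta : rotation alpha n%:Z theta = theta + alpha *+ n.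
Proof. by rewrite /rotation -pmulrn. Qed.

Lemma cocycle_iterD j k theta z :
  cocyc (j + k) theta z = cocyc j (theta + alpha *+ k) z *m cocyc k theta z.
Proof.
elim: j => [|j IH]; first by rewrite add0n mul1mx.
by rewrite addSn /= IH mulmxA !rotationE -addrA -mulrnDr addnC.
Qed.

Lemma cocycle_iterSr k theta z :
  cocyc k.+1 theta z = cocyc k (theta + alpha) z *m cocycle phi theta z.
Proof.
have one : cocyc 1 theta z = cocycle phi theta z by rewrite /= mulmx1 rotationE mulr0n addr0.
by have := cocycle_iterD k 1 theta z; rewrite addn1 one mulr1n.
Qed.

Lemma det_cocycle_iter k theta z : \det (cocyc k theta z) = 1.
Proof.
elim: k => [|k IH] /=; first exact: det1.
by rewrite det_mulmx IH mulr1 det2 !mxE /= mulr0 sub0r mulN1r opprK.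
Qed.

Lemma ln_opnorm_ge0 k theta z : 0 <= ln (opnorm (cocyc k theta z)).
Proof. by apply: ln_ge0; apply: opnorm_ge1; exact: det_cocycle_iter. Qed.

Lemma entry_norm_cocycle_ge1 k theta z : 1 <= entry_norm (cocyc k theta z).
Proof. by apply: le_trans (opnorm_le _); apply: opnorm_ge1; exact: det_cocycle_iter. Qed.

Lemma ln_opnorm_le k theta z : ln (opnorm (cocyc k theta z)) <= ln (entry_norm (cocyc k theta z)).
Proof.
have h1 := entry_norm_cocycle_ge1 k theta z; have h2 := opnorm_ge1 (det_cocycle_iter k theta z).
by rewrite ler_ln ?posrE ?opnorm_le// (lt_le_trans ltr01).
Qed.

Lemma ln_entry_norm_le k theta z :
  ln (entry_norm (cocyc k theta z)) <= ln (opnorm (cocyc k theta z)) + ln 4.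
Proof.
have h1 := entry_norm_cocycle_ge1 k theta z; have h2 := opnorm_ge1 (det_cocycle_iter k theta z).
rewrite -lnM ?posrE//; last by rewrite (lt_le_trans ltr01).
by rewrite ler_ln ?posrE ?(lt_le_trans ltr01)// mulrC; [exact: entry_norm_le|rewrite mulr_ege1// ler1n].
Qed.

Lemma entry_norm_diff x y z w :
  entry_norm (cocycle phi x z - cocycle phi y w) <= `|phi x - phi y| + normc (z - w).
Proof.
rewrite entry_norm2 !mxE !subrr !normc0 !addr0 /=.
have -> : z - (phi x)%:C - (w - (phi y)%:C) = - (phi x - phi y)%:C + (z - w) by rewrite rmorphB /=; ring.
by apply: (le_trans (le_normcD _ _)); rewrite normcN normc_real.
Qed.

(** Replacing the factors of the product one at a time. *)
Lemma cocycle_perturbation k x y z w (P delta : R) : 0 <= P ->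
  (forall i j theta1 theta2, (i + j < k)%N ->
    entry_norm (cocyc i theta1 z) * entry_norm (cocyc j theta2 w) <= P) ->
  (forall j, (j < k)%N -> `|phi (x + alpha *+ j) - phi (y + alpha *+ j)| + normc (z - w) <= delta) ->
  entry_norm (cocyc k x z - cocyc k y w) <= k%:R * P * delta.
Proof.
move=> P0 HP Hd.
have H j : (j <= k)%N -> entry_norm (cocyc k x z - cocyc (k - j) (x + alpha *+ j) z *m cocyc j y w)
    <= j%:R * P * delta.
  elim: j => [|j IH] jk.
    by rewrite subn0 mulr0n addr0 mulmx1 subrr !mul0r entry_norm2 !mxE !normc0 !addr0.
  have e1 : (k - j = (k - j.+1).+1)%N by rewrite subnSK.
  have := IH (ltnW jk); rewrite e1 cocycle_iterSr.
  rewrite -addrA -mulrSr.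
  set X := cocyc (k - j.+1) _ _; set Y := cocyc j y w => h.
  rewrite /= rotationE.
  have -> : cocyc k x z - X *m (cocycle phi (y + alpha *+ j) w *m Y) =
    (cocyc k x z - X *m cocycle phi (x + alpha *+ j) z *m Y) +
    X *m ((cocycle phi (x + alpha *+ j) z - cocycle phi (y + alpha *+ j) w) *m Y).
    by rewrite mulmxBl mulmxBr !mulmxA addrA subrK.
  apply: (le_trans (entry_normD _ _)).
  rewrite -(natr1 j) !mulrDl mul1r; apply: lerD => //.
  apply: (le_trans (entry_norm_mul _ _)).
  apply: (@le_trans _ _ (entry_norm X * (delta * entry_norm Y))).
    rewrite ler_wpM2l ?entry_norm_ge0//; apply: (le_trans (entry_norm_mul _ _)).
    rewrite ler_wpM2r ?entry_norm_ge0//; apply: (le_trans (entry_norm_diff _ _ _ _)); exact: Hd.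
  rewrite mulrCA mulrC ler_wpM2r//; last by apply: HP; lia.
  by apply: le_trans (Hd j jk); rewrite addr_ge0// normc_ge0.
have := H k (leqnn k); rewrite subnn /= mul1mx; exact.
Qed.

Variable Phi : R.
Hypothesis HPhi : forall x, `|phi x| <= Phi.

Lemma entry_norm_cocycle theta z : entry_norm (cocycle phi theta z) <= normc z + Phi + 2.
Proof.
have -> : entry_norm (cocycle phi theta z) = normc (z - (phi theta)%:C) + 1 + (1 + 0).
  rewrite entry_norm2 !mxE; congr (_ + _ + (_ + _)); [|exact: normc1|exact: normc0].
  by rewrite [LHS]normcN normc1.
have := le_normcD z (- (phi theta)%:C); rewrite normcN normc_real; have := HPhi theta.
set a := normc _; set b := `| _ |; set c := normc _ => *; lra.
Qed.

Lemma entry_norm_iter (Q : R) k theta z : normc z + Phi + 2 <= Q ->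
  entry_norm (cocyc k theta z) <= 2 * Q ^+ k.
Proof.
move=> HQ; have Q0 : 0 <= Q.
  by apply: le_trans HQ; apply: le_trans (entry_norm_ge0 _) (entry_norm_cocycle theta z).
elim: k => [|k IH] /=.
  have -> : entry_norm (1%:M : 'M[C]_2) = 1 + 0 + (0 + 1).
    by rewrite entry_norm2 !mxE; congr (_ + _ + (_ + _)); [exact: normc1|exact: normc0|exact: normc0|exact: normc1].
  by rewrite expr0; lra.
apply: (le_trans (entry_norm_mul _ _)); rewrite exprS mulrCA; apply: ler_pM => //; rewrite ?entry_norm_ge0//.
exact: le_trans (entry_norm_cocycle _ _) HQ.
Qed.

(** With the trivial bound on the factors the error is exponential in their
    number, which is harmless when that number is fixed. *)
Lemma cocycle_perturbation_crude k x y z w (Q delta : R) :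
  normc z + Phi + 2 <= Q -> normc w + Phi + 2 <= Q -> 1 <= Q ->
  (forall j, (j < k)%N -> `|phi (x + alpha *+ j) - phi (y + alpha *+ j)| + normc (z - w) <= delta) ->
  entry_norm (cocyc k x z - cocyc k y w) <= k%:R * (4 * Q ^+ k) * delta.
Proof.
move=> Hz Hw Q1 Hd; have Q0 : 0 <= Q by lra.
apply: cocycle_perturbation => //; first by rewrite mulr_ge0// exprn_ge0.
move=> i j t1 t2 ij; apply: (@le_trans _ _ ((2 * Q ^+ i) * (2 * Q ^+ j))).
  by apply: ler_pM; rewrite ?entry_norm_ge0 ?entry_norm_iter.
rewrite mulrACA -exprD -natrM ler_wpM2l// ler_weXn2l//; exact: ltnW.
Qed.

End cocycles.

(** * Uniform convergence of orbit averages *)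
Section orbit_averages.
Context {R : realType} {d : nat}.
Implicit Types (x y theta alpha : 'rV[R]_d) (g G : 'rV[R]_d -> R).

Definition cell_corner p (f : {ffun 'I_d -> 'I_p.+1}) : 'rV[R]_d := \row_i ((f i)%:R / p.+1%:R).

Lemma cell_cornerK p f : cell p (@cell_corner p f) = f.
Proof.
apply/ffunP => i; apply/cellP; exists 0; rewrite mxE subr0 lexx /=.
by rewrite ltr_pM2r ?invr_gt0 ?ltr0n// ltr_nat.
Qed.

(** [g] varies by at most [s] on all grid cells but those of a list of
    relative size at most [s]. *)
Definition nearly_constant (s : R) g := exists p (bad : seq {ffun 'I_d -> 'I_p.+1}),
  (size bad)%:R <= s * p.+1%:R ^+ d /\
  forall x y, cell p x = cell p y -> cell p x \notin bad -> `|g x - g y| <= s.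

Lemma sum_mem_le (T : finType) (bad : seq T) (W : R) : 0 <= W ->
  \sum_(f : T) (if f \in bad then W else 0) <= (size bad)%:R * W.
Proof.
move=> W0; rewrite -big_mkcond /= sumr_const -[leLHS]mulr_natl ler_wpM2r// ler_nat.
exact: card_size.
Qed.

(** [G] is bounded above, and [g] below, by functions that are constant on cells
    and differ by little more than [c] off the bad cells; each cell receives at most its
    share of the orbit. *)
Lemma orbit_average alpha g G (W c eps : R) : uniformly_dense alpha ->
  (forall x, 0 <= g x) -> (forall x, g x <= G x) -> (forall x, G x <= W) ->
  (forall x, G x <= g x + c) -> (forall s, 0 < s -> nearly_constant s G) -> 0 < eps ->
  exists N0 : nat, forall N theta, (N0 <= N)%N ->
    \sum_(n < N) G (theta + alpha *+ n) <= N%:R * (torus_integral g + c + eps).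
Proof.
move=> Hd g0 gG GW Gc Hs eps0.
have G0 x : 0 <= G x by apply: le_trans (gG x).
have W0 : 0 <= W by apply: le_trans (GW 0).
have c0 : 0 <= c by have := gG 0; have := Gc 0; lra.
(* [s] and [e] each use up half of [eps]. *)
pose s := eps / (2 * (2 + W)).
have s0 : 0 < s by rewrite divr_gt0// mulr_gt0//; lra.
have sE : 2 * s + s * W = eps / 2 by rewrite /s; field; lra.
have [p [bad [sbad Hbad]]] := Hs s s0.
pose q : R := p.+1%:R ^+ d.
have q0 : 0 < q by rewrite exprn_gt0.
pose e := eps / (2 * (q * (W + s))).
have e0 : 0 < e by rewrite divr_gt0// !mulr_gt0//; lra.
have eE : e * (q * (W + s)) = eps / 2.
  by rewrite /e; field; rewrite !gt_eqF//; lra.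
have [N0 HN0] := cell_visits p Hd e0.
exists N0 => N theta N0N.
pose wu f := if f \in bad then W else G (cell_corner f) + s.
pose wl f := if f \in bad then 0 else Num.max 0 (G (cell_corner f) - s - c).
have wuP x : G x <= wu (cell p x).
  rewrite /wu; case: ifPn => // nb.
  have := Hbad x (cell_corner (cell p x)) (esym (cell_cornerK _)) nb.
  by rewrite ler_norml => /andP[]; lra.
have wlP x : wl (cell p x) <= g x.
  rewrite /wl; case: ifPn => // nb.
  have := Hbad x (cell_corner (cell p x)) (esym (cell_cornerK _)) nb.
  rewrite ge_max g0 /= ler_norml => /andP[h1 h2]; have := Gc x; lra.
have wu0 f : 0 <= wu f.
  by rewrite /wu; case: ifP => // _; rewrite addr_ge0 ?G0// ltW.
have wl0 f : 0 <= wl f by rewrite /wl; case: ifP => // _; rewrite le_max lexx.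
have wuW f : wu f <= W + s.
  by rewrite /wu; case: ifP => _; rewrite ?lerD2r ?GW// lerDl ltW.
have wul f : wu f <= wl f + (2 * s + c) + (if f \in bad then W else 0).
  rewrite /wu /wl; case: ifP => _; first by rewrite add0r lerDr; lra.
  have : G (cell_corner f) - s - c <= Num.max 0 (G (cell_corner f) - s - c) by rewrite le_max lexx orbT.
  by rewrite addr0; move: (Num.max _ _) => m; lra.
have I1 : q^-1 * \sum_f wl f <= torus_integral g.
  apply: (@torus_integral_ge _ _ p wl g W wl0 wlP) => x; exact: le_trans (gG x) (GW x).
have card : #|{: {ffun 'I_d -> 'I_p.+1}}|%:R = q by rewrite card_ffun !card_ord natrX.
have I2 : \sum_f wu f <= \sum_f wl f + q * (2 * s + c) + s * q * W.
  apply: (@le_trans _ _ (\sum_f (wl f + (2 * s + c) + (if f \in bad then W else 0)))).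
    by apply: ler_sum => f _; exact: wul.
  rewrite !big_split /=; apply: lerD; last first.
    by apply: (le_trans (sum_mem_le _ W0)); rewrite ler_wpM2r.
  by rewrite -big_split /= sumr_const -[_ *+ _]mulr_natl card.
have I3 : \sum_f wu f <= q * (W + s).
  apply: (@le_trans _ _ (\sum_(f : {ffun 'I_d -> 'I_p.+1}) (W + s))); first by apply: ler_sum.
  by rewrite sumr_const -[_ *+ _]mulr_natl card.
apply: (@le_trans _ _ (\sum_(n < N) wu (cell p (theta + alpha *+ n)))); first by apply: ler_sum.
have -> : \sum_(n < N) wu (cell p (theta + alpha *+ n)) =
    \sum_f visits alpha N theta (fun x => cell p x == f) * wu f.
  rewrite /visits; under [RHS]eq_bigr do rewrite mulr_suml.
  rewrite exchange_big /=; apply: eq_bigr => n _.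
  rewrite (bigD1 (cell p (theta + alpha *+ n)))//= eqxx mul1r big1 ?addr0// => f nf.
  by rewrite eq_sym (negbTE nf) mul0r.
apply: (@le_trans _ _ (\sum_f (N%:R * (q^-1 + e)) * wu f)).
  by apply: ler_sum => f _; rewrite ler_wpM2r//; exact: HN0.
rewrite -mulr_sumr -mulrA ler_wpM2l// mulrDl.
have J1 : e * \sum_f wu f <= eps / 2 by rewrite -eE ler_wpM2l// ltW.
have J2 : q^-1 * \sum_f wu f <= torus_integral g + (2 * s + c) + s * W.
  apply: (@le_trans _ _ (q^-1 * (\sum_f wl f + q * (2 * s + c) + s * q * W))).
    by rewrite ler_wpM2l// invr_ge0 ltW.
  have -> : q^-1 * (\sum_f wl f + q * (2 * s + c) + s * q * W) = q^-1 * (\sum_f wl f) + (2 * s + c) + s * W.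
    by move: (\sum_f wl f) => S; field; rewrite gt_eqF.
  by rewrite !lerD2r.
lra.
Qed.

(** Otherwise [g] would be at most [h] off the bad cells, too little for its
    integral. *)
Lemma exists_large_value p (bad : seq {ffun 'I_d -> 'I_p.+1}) g (W h : R) :
  (forall x, 0 <= g x) -> (forall x, g x <= W) -> 0 <= h ->
  h + (size bad)%:R / p.+1%:R ^+ d * W < torus_integral g ->
  exists x, cell p x \notin bad /\ h < g x.
Proof.
move=> g0 gW h0; apply: contraPP => /forallNP H.
have W0 : 0 <= W by apply: le_trans (gW 0).
have q0 : (0 : R) < p.+1%:R ^+ d by rewrite exprn_gt0.
apply/negP; rewrite -leNgt.
pose w f := h + (if f \in bad then W else 0).
apply: (@le_trans _ _ ((p.+1%:R ^+ d)^-1 * \sum_f w f)).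
  apply: torus_integral_le => //.
    by move=> f; rewrite /w addr_ge0//; case: ifP.
  move=> x; rewrite /w; case: ifPn => nb.
    by apply: (le_trans (gW x)); rewrite lerDr.
  by rewrite addr0 leNgt; apply/negP => gx; apply: (H x).
rewrite big_split /= sumr_const -[h *+ _]mulr_natl card_ffun !card_ord natrX mulrDr mulKf ?gt_eqF//.
by rewrite lerD2l mulrAC mulrC ler_wpM2r ?invr_ge0 ?(ltW q0)// sum_mem_le.
Qed.

End orbit_averages.

(** * The Lyapunov exponent and uniform growth bounds *)
Section log_facts.
Context {R : realType}.

Lemma ler_dist_ln (x y : R) : 1 <= x -> 1 <= y -> `|ln x - ln y| <= `|x - y|.
Proof.
wlog yx : x y / y <= x.
  move=> H x1 y1; have [h|h] := leP y x; first exact: H.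
  by rewrite distrC [leRHS]distrC; apply: H => //; exact: ltW.
move=> x1 y1; have y0 : 0 < y by rewrite (lt_le_trans ltr01).
have x0 : 0 < x by rewrite (lt_le_trans ltr01).
rewrite !ger0_norm ?subr_ge0 ?ler_ln ?posrE// -ln_div ?posrE//.
have -> : x / y = 1 + (x / y - 1) by rewrite addrC subrK.
apply: le_trans (le_ln1Dx _) _; first by rewrite ltrBrDl subrr divr_gt0.
have -> : x / y - 1 = (x - y) / y by field; rewrite gt_eqF.
by rewrite ler_pdivrMr// ler_peMr// subr_ge0.
Qed.

Lemma mul_ratio_le (X Y : R) : 0 <= Y -> 0 < X -> Y * (X / (Y + 1)) <= X.
Proof.
by move=> Y0 X0; rewrite mulrA ler_pdivrMr ?(ltr_wpDl Y0)// mulrDr mulr1 mulrC lerDl ltW.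
Qed.

Lemma powRN_small (gamma e : R) : 0 < gamma -> 0 < e -> exists p0 : nat, forall p, (p0 <= p)%N ->
  p.+1%:R `^ (- gamma) <= e.
Proof.
move=> g0 e0; exists (Num.bound (expR (- ln e / gamma))) => p hp.
have p1 : (0 : R) < p.+1%:R by rewrite ltr0n.
rewrite /powR gt_eqF// -[leRHS](lnK (e0 : e \is Num.pos)) ler_expR mulNr lerNl.
rewrite mulrC -ler_pdivrMr// -ler_expR lnK//.
apply: (@le_trans _ _ (Num.bound (expR (- ln e / gamma)))%:R).
  by apply/ltW/archi_boundP/expR_ge0.
by rewrite ler_nat (leq_trans hp).
Qed.

Lemma entry_norm_dist (A B : 'M[R[i]]_2) : `|entry_norm A - entry_norm B| <= entry_norm (A - B).
Proof.
have := entry_normD (A - B) B; have := entry_normD (B - A) A.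
rewrite !subrK -(opprB A B) entry_normN ler_norml => h1 h2; apply/andP; split; lra.
Qed.

(** Compactness of the segment. *)
Lemma uniform_on_segment (P : nat -> R -> Prop) (K : R) :
  (forall E0, exists2 rho : R, 0 < rho & exists J0 : nat, forall E J, `|E - E0| < rho -> (J0 <= J)%N -> P J E) ->
  exists J0 : nat, forall J E, (J0 <= J)%N -> `|E| <= K -> P J E.
Proof.
move=> H; have := @segment_compact R (- K) K.
move=> /compact_near_coveringP /(_ _ \oo P _) [].
  move=> E0 _; have [rho rho0 [J0 HJ]] := H E0.
  exists (ball E0 rho, [set J | (J0 <= J)%N]); last first.
    by move=> [E J] /= [h1 h2]; apply: HJ => //; rewrite distrC.
  by split => /=; [exact: nbhsx_ballx|exists J0].
move=> J0 _ HJ; exists J0 => J E JJ EK; apply: (HJ J JJ E).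
by rewrite /= in_itv /= -ler_norml.
Qed.

End log_facts.

Section lyapunov_exponent.
Context {R : realType} {d : nat}.
Local Notation C := R[i].
Variables (phi : 'rV[R]_d -> R) (alpha : 'rV[R]_d).
Hypothesis d0 : (0 < d)%N.
Hypothesis Hphi : tame phi.
Hypothesis Halpha : dioph alpha.
Implicit Types (x y theta : 'rV[R]_d) (z w : C) (E : R).
Local Notation cocyc := (cocycle_iter phi alpha).
Local Notation g k z := (fun theta => ln (opnorm (cocyc k theta z))).
Local Notation G k z := (fun theta => ln (entry_norm (cocyc k theta z))).

Lemma ln_entry_norm_bounded k z : exists W, forall x, G k z x <= W.
Proof.
have [Phi [_ [_ [_ [[P0 _ _ _] [HPhi _]]]]]] := Hphi.
exists (2 * (normc z + Phi + 2) ^+ k) => x.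
apply: le_trans (entry_norm_iter alpha HPhi k x (lexx _)).
by apply/ltW/ln_sublinear; apply: lt_le_trans (entry_norm_cocycle_ge1 _ _ _ _ _).
Qed.

(** The number of factors being fixed, the crude perturbation bound is enough on
    a fine grid. *)
Lemma ln_entry_norm_nearly_constant k z s : 0 < s -> nearly_constant s (G k z).
Proof.
have [Phi [C [H [gamma [[P0 C0 H0 g0] [HPhi Hc]]]]]] := Hphi => s0.
pose Q := normc z + Phi + 2.
have Q1 : 1 <= Q by rewrite /Q; have := normc_ge0 z; lra.
pose c := k%:R * (4 * Q ^+ k) * H.
have c0 : 0 <= c by rewrite /c !mulr_ge0// exprn_ge0//; lra.
have [p0 Hp0] := @powRN_small R gamma (s / (c + 1)) g0 (divr_gt0 s0 (ltr_wpDl c0 ltr01)).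
pose p := maxn 1 (maxn p0 (Num.bound (C * k%:R / s))).
have [bad [sbad Hbad]] := Hc alpha k p (leq_maxl _ _).
exists p, bad; split.
  apply: (le_trans sbad); rewrite -{2}(prednK d0) exprS mulrA ler_wpM2r ?exprn_ge0//.
  rewrite -ler_pdivrMl// [leLHS]mulrC.
  have h : C * k%:R / s <= (Num.bound (C * k%:R / s))%:R.
    by apply/ltW/archi_boundP; rewrite divr_ge0 ?mulr_ge0// ltW.
  apply: (le_trans h); rewrite ler_nat /p; apply: leqW.
  by rewrite (leq_trans _ (leq_maxr _ _))// leq_maxr.
move=> x y exy nb.
apply: le_trans (ler_dist_ln (entry_norm_cocycle_ge1 _ _ _ _ _) (entry_norm_cocycle_ge1 _ _ _ _ _)) _.
apply: le_trans (entry_norm_dist _ _) _.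
apply: (@le_trans _ _ (k%:R * (4 * Q ^+ k) * (H * p.+1%:R `^ (- gamma)))).
  apply: (cocycle_perturbation_crude HPhi) => // j jk.
  by rewrite subrr normc0 addr0; exact: Hbad.
rewrite [leLHS]mulrA -/c; apply: (@le_trans _ _ (c * (s / (c + 1)))).
  by rewrite ler_wpM2l// Hp0// (leq_trans _ (leq_maxr _ _))// leq_maxl.
exact: mul_ratio_le.
Qed.

Lemma ln_entry_norm_mul k N theta z :
  G (k * N.+1) z theta <= \sum_(n < N.+1) G k z (theta + alpha *+ k *+ n).
Proof.
elim: N => [|N IH]; first by rewrite muln1 big_ord_recl big_ord0 mulr0n !addr0.
rewrite big_ord_recr /=; apply: le_trans (lerD IH (lexx _)).
rewrite mulnS cocycle_iterD -mulrnA.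
have h n t := entry_norm_cocycle_ge1 phi alpha n t z.
have h0 n t : 0 < entry_norm (cocyc n t z) := lt_le_trans ltr01 (h n t).
rewrite [leRHS]addrC -lnM ?posrE// ler_ln ?posrE ?mulr_gt0//; first exact: entry_norm_mul.
rewrite -cocycle_iterD; exact: h0.
Qed.

(** Orbit averages converge to the space average uniformly in the starting
    point, so the integral controls the product everywhere. *)
Lemma ln_entry_norm_upper k z eps : (0 < k)%N -> 0 < eps ->
  exists N0 : nat, forall N theta, (N0 <= N)%N -> (0 < N)%N ->
    G (k * N) z theta <= N%:R * (torus_integral (g k z) + ln 4 + eps).
Proof.
move=> k0 eps0; have [W HW] := ln_entry_norm_bounded k z.
have Hd := dioph_dense (dioph_mul k0 Halpha).
have [N0 HN0] := @orbit_average _ _ (alpha *+ k) (g k z) (G k z) W (ln 4) eps Hd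
  (fun x => ln_opnorm_ge0 _ _ _ _ _) (fun x => ln_opnorm_le _ _ _ _ _) HW
  (fun x => ln_entry_norm_le _ _ _ _ _) (@ln_entry_norm_nearly_constant k z) eps0.
exists N0 => -[//|N] theta hN _; exact: le_trans (ln_entry_norm_mul _ _ _ _) (HN0 _ _ hN).
Qed.

Local Notation mean k z := (k%:R^-1 * torus_integral (g k z)).

Variable E : R.
Hypothesis L0 : 0 < lyapunov phi alpha E%:C.
Local Notation L := (lyapunov phi alpha E%:C).

(** The limit of a divergent sequence is 0 by convention, which positivity
    excludes. *)
Lemma lyapunov_cvg : (fun k : nat => mean k E%:C) @ \oo --> L.
Proof.
have [c|nc] := pselect (cvgn (fun k : nat => mean k E%:C)); first exact: c.
by move: L0; rewrite /lyapunov (dvgP nc) ltxx.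
Qed.

(** Subadditivity: the uniform bound on products of [k * N] factors compares the
    means at the multiples of [k] with the mean at [k]. *)
Lemma lyapunov_le_mean k : (0 < k)%N -> k%:R * L <= torus_integral (g k E%:C) + ln 4.
Proof.
move=> k0; apply/ler_addgt0Pr => eps eps0.
have [N0 HN0] := ln_entry_norm_upper E%:C k0 (divr_gt0 eps0 (@ltr0n _ 2) : 0 < eps / 2).
have kr0 : (0 : R) < k%:R by rewrite ltr0n.
have e2 : 0 < eps / (2 * k%:R) by rewrite divr_gt0// mulr_gt0.
have := lyapunov_cvg; move=> /cvgrPdist_le /(_ _ e2) [M _ HM].
pose N := (maxn N0 M).+1.
have NN0 : (N0 <= N)%N by rewrite leqW// leq_maxl.
have MN : (M <= k * N)%N.
  by apply: (@leq_trans N); [rewrite leqW// leq_maxr|rewrite leq_pmull].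
have h1 := HM _ MN.
pose B := N%:R * (torus_integral (g k E%:C) + ln 4 + eps / 2).
have h2 : torus_integral (g (k * N) E%:C) <= B.
  have h3 theta : g (k * N) E%:C theta <= B.
    apply: le_trans (ln_opnorm_le _ _ _ _ _) _; exact: HN0.
  have B0 : 0 <= B by apply: le_trans (h3 0); exact: ln_opnorm_ge0.
  have := @torus_integral_le _ d 0 (fun=> B) (g (k * N) E%:C).
  rewrite expr1n invr1 mul1r sumr_const card_ffun !card_ord exp1n mulr1n; apply => // x.
  exact: ln_opnorm_ge0.
move: h1; rewrite ler_norml => /andP[_ h1].
have N1 : (0 : R) < N%:R by rewrite ltr0n.
have h4 : L <= (k * N)%:R^-1 * B + eps / (2 * k%:R).
  rewrite -lerBlDl; apply: le_trans (_ : L - (k * N)%:R^-1 * torus_integral (g (k * N) E%:C) <= _).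
    by rewrite lerB// ler_wpM2l// invr_ge0.
  by [].
apply: (@le_trans _ _ (k%:R * ((k * N)%:R^-1 * B + eps / (2 * k%:R)))); first by rewrite ler_wpM2l.
rewrite le_eqVlt; apply/orP; left; apply/eqP; rewrite /B natrM.
by move: (torus_integral _) (ln 4) => T l; field; rewrite !gt_eqF.
Qed.

Lemma entry_norm_upper_at eps : 0 < eps -> exists n, (0 < n)%N /\
  forall theta, entry_norm (cocyc n theta E%:C) <= expR (n%:R * (L + eps)).
Proof.
move=> eps0; have e4 : 0 < eps / 3 by rewrite divr_gt0.
have := lyapunov_cvg; move=> /cvgrPdist_le /(_ _ e4) [M _ HM].
pose k := maxn 1 (maxn M (Num.bound (3 * ln 4 / eps))).
have k0 : (0 < k)%N by rewrite leq_maxl.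
have kr0 : (0 : R) < k%:R by rewrite ltr0n.
have h1 : torus_integral (g k E%:C) <= k%:R * (L + eps / 3).
  have := HM k; rewrite /= ler_norml => /(_ _)/andP[|h _].
    by rewrite (leq_trans _ (leq_maxr _ _))// leq_maxl.
  rewrite -ler_pdivrMl//; move: h; set a := _^-1 * _; lra.
have l4 : 0 <= ln 4 :> R by rewrite ln_ge0// ler1n.
have h2 : ln 4 <= k%:R * (eps / 3).
  have : 3 * ln 4 / eps <= k%:R.
    apply: le_trans (ltW (archi_boundP _)) _; first by rewrite divr_ge0 ?mulr_ge0// ltW.
    by rewrite ler_nat (leq_trans _ (leq_maxr _ _))// leq_maxr.
  by rewrite ler_pdivrMr// => h; lra.
have [N0 HN0] := ln_entry_norm_upper E%:C k0 (mulr_gt0 kr0 e4).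
pose N := maxn 1 N0.
exists (k * N)%N; split; first by rewrite muln_gt0 k0 leq_maxl.
move=> theta; have h := HN0 N theta (leq_maxr _ _) (leq_maxl _ _).
rewrite -[leLHS]lnK ?posrE ?(lt_le_trans ltr01 (entry_norm_cocycle_ge1 _ _ _ _ _))// ler_expR.
apply: (le_trans h); rewrite natrM [k%:R * _]mulrC -mulrA ler_wpM2l//.
move: h1 h2; move: (torus_integral _) => T h1 h2.
have -> : k%:R * (L + eps) = k%:R * (L + eps / 3) + k%:R * (eps / 3) + k%:R * (eps / 3) by field.
lra.
Qed.

End lyapunov_exponent.

Section uniform_growth.
Context {R : realType} {d : nat}.
Local Notation C := R[i].
Variables (phi : 'rV[R]_d -> R) (alpha : 'rV[R]_d).
Hypothesis d0 : (0 < d)%N.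
Hypothesis Hphi : tame phi.
Hypothesis Halpha : dioph alpha.
Hypothesis L_cont : continuous (fun E : R => lyapunov phi alpha E%:C).
Hypothesis L_pos : forall E : R, 0 < lyapunov phi alpha E%:C.
Local Notation cocyc := (cocycle_iter phi alpha).
Local Notation L E := (lyapunov phi alpha E%:C).

Lemma lyapunov_lower_bound K : exists2 l : R, 0 < l & forall E : R, `|E| <= K -> l <= L E.
Proof.
have [E0|J0 HJ] := @uniform_on_segment R (fun J E => J.+1%:R^-1 <= L E) K.
  have e0 : 0 < L E0 / 2 by rewrite divr_gt0.
  have := @L_cont E0 => /cvgrPdist_le /(_ _ e0); rewrite -nbhs_ballE => -[rho /= rho0 Hr].
  exists rho => //; exists (Num.bound (L E0 / 2)^-1) => E J EE JJ.
  apply: (@le_trans _ _ (L E0 / 2)); last first.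
    have EE' : `|E0 - E| < rho by rewrite distrC.
    have : `|L E0 - L E| <= L E0 / 2 := Hr E EE'.
    rewrite ler_norml => /andP[_]; move: (L E) (L E0) => a b; lra.
  rewrite -[leRHS]invrK lef_pV2 ?posrE ?invr_gt0//.
  apply: le_trans (ltW (archi_boundP _)) _; first by rewrite invr_ge0 ltW.
  by rewrite ler_nat leqW.
by exists (J0.+1%:R^-1); rewrite ?invr_gt0// => E EK; exact: HJ.
Qed.

(** Upper semicontinuity makes the growth bound uniform in the base point and
    in small complex perturbations of a real energy. *)
Lemma entry_norm_uniform_upper K eps : 0 < eps -> exists J : nat, forall (E : R) z k theta,
  `|E| <= K -> normc (z - E%:C) <= J.+1%:R^-1 ->
  entry_norm (cocyc k theta z) <= J%:R * expR (k%:R * (L E + eps)).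
Proof.
move=> eps0; have e3 : 0 < eps / 3 by rewrite divr_gt0.
have [Phi [_ [_ [_ [[P0 _ _ _] [HPhi _]]]]]] := Hphi.
have [E0|J0 HJ] := @uniform_on_segment R (fun J E => forall z k theta, normc (z - E%:C) <= J.+1%:R^-1 ->
  entry_norm (cocyc k theta z) <= J%:R * expR (k%:R * (L E + eps))) K; last first.
  by exists J0 => E z k theta EK; apply: HJ.
have [n0 [n00 Hn0]] := entry_norm_upper_at d0 Hphi Halpha (L_pos E0) e3.
pose Lam := L E0 + 2 * (eps / 3).
have Lam0 : 0 <= Lam by rewrite /Lam; have := L_pos E0; move: (L E0) => a; lra.
pose Q := `|E0| + 1 + Phi + 2.
have Q1 : 1 <= Q by rewrite /Q; have := normr_ge0 E0; lra.
have Q0 : 0 <= Q by lra.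
pose X := expR (n0%:R * Lam) - expR (n0%:R * (L E0 + eps / 3)).
have X0 : 0 < X.
  rewrite subr_gt0 ltr_expR ltr_pM2l ?ltr0n// /Lam ltrD2l; lra.
pose Y := n0%:R * (4 * Q ^+ n0).
have Y0 : 0 <= Y by rewrite !mulr_ge0// exprn_ge0.
pose rho := Num.min 1 (X / (Y + 1)).
have rho0 : 0 < rho by rewrite lt_min ltr01 divr_gt0// ltr_wpDl.
have near z : normc (z - E0%:C) <= rho -> forall k theta,
    entry_norm (cocyc k theta z) <= 2 * Q ^+ n0 * expR (k%:R * Lam).
  move=> zE.
  have z1 : normc z + Phi + 2 <= Q.
    have := le_normcD (z - E0%:C) E0%:C; rewrite subrK normc_real.
    by have : rho <= 1 by [rewrite ge_min lexx]; rewrite /Q; lra.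
  have E1 : normc E0%:C + Phi + 2 <= Q by rewrite normc_real /Q; lra.
  have step theta : entry_norm (cocyc n0 theta z) <= expR (n0%:R * Lam).
    have h1 : entry_norm (cocyc n0 theta z - cocyc n0 theta E0%:C) <= Y * rho.
      by apply: (cocycle_perturbation_crude HPhi) => // j _; rewrite subrr normr0 add0r.
    have h2 : Y * rho <= X.
      apply: (@le_trans _ _ (Y * (X / (Y + 1)))); first by rewrite ler_wpM2l// ge_min lexx orbT.
      exact: mul_ratio_le.
    have h3 := entry_normD (cocyc n0 theta z - cocyc n0 theta E0%:C) (cocyc n0 theta E0%:C).
    rewrite subrK in h3; have := Hn0 theta; move: h3 h2 h1; rewrite /X; move: (expR _) (expR _) (entry_norm _) (entry_norm _) (entry_norm _) (Y * rho) => a b c e f u; lra.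
  have main a b theta : entry_norm (cocyc (n0 * a + b) theta z) <=
      2 * Q ^+ b * expR ((n0 * a)%:R * Lam).
    elim: a => [|a IH]; first by rewrite muln0 mul0r expR0 mulr1; apply: (entry_norm_iter alpha HPhi).
    rewrite mulnS -addnA cocycle_iterD; apply: le_trans (entry_norm_mul _ _) _.
    rewrite (natrD R n0 (n0 * a)%N) (mulrDl n0%:R _ Lam) expRD [leRHS]mulrCA; apply: ler_pM => //; exact: entry_norm_ge0.
  move=> k theta; rewrite {1}(divn_eq k n0) mulnC; apply: le_trans (main _ _ _) _.
  apply: ler_pM; rewrite ?expR_ge0 ?mulr_ge0 ?exprn_ge0//.
    by rewrite ler_wpM2l// ler_weXn2l// ltnW// ltn_pmod.
  by rewrite ler_expR ler_wpM2r// ler_nat mulnC leq_divM.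
have := @L_cont E0 => /cvgrPdist_le /(_ _ e3); rewrite -nbhs_ballE => -[rho1 /= rho10 Hr].
exists (Num.min (rho / 2) rho1); first by rewrite lt_min rho10 divr_gt0.
exists (maxn (Num.bound (rho / 2)^-1) (Num.bound (2 * Q ^+ n0))) => E J.
rewrite lt_min => /andP[EE1 EE2]; rewrite geq_max => /andP[J1 J2] z k theta zE.
have hJ : J.+1%:R^-1 <= rho / 2.
  rewrite -[leRHS]invrK lef_pV2 ?posrE ?invr_gt0 ?divr_gt0//.
  apply: le_trans (ltW (archi_boundP _)) _; first by rewrite invr_ge0 divr_ge0// ltW.
  by rewrite ler_nat leqW.
have zE0 : normc (z - E0%:C) <= rho.
  have := le_normcD (z - E%:C) (E%:C - E0%:C).
  rewrite addrA subrK -rmorphB normc_real /= => h; apply: (le_trans h).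
  by rewrite (splitr rho) lerD ?(ltW EE1)// (le_trans zE).
apply: le_trans (near z zE0 k theta) _; apply: ler_pM; rewrite ?expR_ge0 ?mulr_ge0 ?exprn_ge0//.
  apply: le_trans (ltW (archi_boundP _)) _; first by rewrite mulr_ge0 ?exprn_ge0.
  by rewrite ler_nat.
rewrite ler_expR ler_wpM2l// /Lam.
have EE' : `|E0 - E| < rho1 by rewrite distrC.
have : `|L E0 - L E| <= eps / 3 := Hr E EE'.
rewrite ler_norml => /andP[_]; move: (L E) (L E0) => a b; lra.
Qed.

End uniform_growth.

(** * Growth of the cocycle along every orbit *)
Section growth_along_orbits.
Context {R : realType} {d : nat}.
Local Notation C := R[i].

Lemma expR_dominates (m : nat) (A c : R) : 0 < c -> \forall s \near +oo, A * (s + 1) ^+ m <= expR (c * s).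
Proof.
move=> c0; pose c' := c / m.+1%:R; have c'0 : 0 < c' by rewrite divr_gt0.
near=> s.
have s1 : 1 <= s by near: s; apply: nbhs_pinfty_ge; rewrite num_real.
have s0 : 0 <= s := le_trans ler01 s1.
have [A0|A0] := leP A 0.
  apply: le_trans (expR_ge0 _); apply: mulr_le0_ge0 => //; apply: exprn_ge0; lra.
have sA : A * 2 ^+ m / c' ^+ m.+1 <= s by near: s; apply: nbhs_pinfty_ge; rewrite num_real.
rewrite ler_pdivrMr ?exprn_gt0// in sA.
have -> : c * s = c' * s * m.+1%:R by rewrite /c' mulrAC divfK.
have h : c' * s <= expR (c' * s) by have := expR_ge1Dx (c' * s); lra.
have h0 : 0 <= c' * s by rewrite mulr_ge0// ltW.
rewrite expRM_natr; apply: (@le_trans _ _ ((c' * s) ^+ m.+1)); last by rewrite lerXn2r ?nnegrE ?expR_ge0.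
apply: (@le_trans _ _ (A * (2 * s) ^+ m)).
  by rewrite ler_wpM2l ?(ltW A0)// lerXn2r ?nnegrE//; lra.
have -> : A * (2 * s) ^+ m = A * 2 ^+ m * s ^+ m by rewrite exprMn mulrA.
have -> : (c' * s) ^+ m.+1 = s * c' ^+ m.+1 * s ^+ m by rewrite exprMn (exprS s) [RHS]mulrAC mulrC.
by rewrite ler_wpM2r ?exprn_ge0.
Unshelve. all: by end_near. Qed.

Variables (phi : 'rV[R]_d -> R) (alpha : 'rV[R]_d).
Hypothesis d0 : (0 < d)%N.
Hypothesis Hphi : tame phi.
Hypothesis Halpha : dioph alpha.
Hypothesis L_cont : continuous (fun E : R => lyapunov phi alpha E%:C).
Hypothesis L_pos : forall E : R, 0 < lyapunov phi alpha E%:C.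

Local Ltac forget_facts := clear -d0 Hphi Halpha L_cont L_pos.
Local Notation cocyc := (cocycle_iter phi alpha).
Local Notation L E := (lyapunov phi alpha E%:C).

(** Aim at the center of the cell with a quarter of its side as precision. *)
Lemma orbit_enters_cell : exists C0 D, 0 <= C0 /\ forall p (x theta : 'rV[R]_d),
  exists2 n, n%:R <= C0 * p.+1%:R ^+ D :> R & cell p (theta + alpha *+ n) = cell p x.
Proof.
have [C0 [D [C00 H]]] := orbit_hits Halpha.
exists (C0 * 4 ^+ D), D; split; first by rewrite mulr_ge0 ?exprn_ge0// ltW.
move=> p x theta; have q0 : (0 : R) < p.+1%:R by rewrite ltr0n.
pose c : 'rV[R]_d := \row_i (((cell p x i)%:R + 1 / 2) / p.+1%:R).
have [n Hn [k Hk]] := H (4 * p.+1)%N theta c isT.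
exists n; first by rewrite -mulrA -exprMn -natrM.
apply/ffunP => i; apply/cellP; exists (k ord0 i).
have := Hk i; rewrite [c _ _]mxE natrM invfM ler_norml; set X := (theta + _) ord0 i.
rewrite -(natr1 (cell p x i)) !mulrDl mul1r.
have r0 : 0 < (p.+1%:R)^-1 :> R by rewrite invr_gt0.
move: r0; set r : R := (p.+1%:R)^-1; set f : R := (cell p x i)%:R * r; set kk : R := _%:~R => r0 /andP[h1 h2].
apply/andP; split; lra.
Qed.

(** Parameters: [k] about [C1 * s] factors, [C1 = 2 (M + 2) / l] so that the growth
    [k (L - eta) >= k l / 2] reaches [(M + 2) s]; a grid of [q] about
    [exp (eta1 * s)] cells per side, coarse enough to be entered in time
    [exp (dlt * s)]; and [eta] small against [eta1 * gamma / C1], so that the loss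
    [exp (2 k eta)] in the perturbation bound is absorbed by the oscillation
    [q^-gamma] of the potential on a good cell. *)
Lemma cocycle_growth (K M dlt : R) : 0 <= M -> 0 < dlt -> \forall s \near +oo, forall theta (E y : R),
  `|E| <= K -> 0 <= y -> y <= expR (- (s / 2)) ->
  exists n k : nat, (n + k)%:R <= expR (dlt * s) /\
    expR (M * s) <= entry_norm (cocyc k (theta + alpha *+ n) (E%:C + 'i * y%:C)).
Proof.
move=> M0 dlt0.
have [l l0 Hl] := lyapunov_lower_bound L_cont L_pos K.
have [Phi [Cb [H [gamma [[P0 Cb0 H0 g0] [HPhi Hc]]]]]] := Hphi.
have [C0 [D [C00 HD]]] := orbit_enters_cell.
pose C1 := 2 * (M + 2) / l.
have C10 : 0 < C1.
  have M2 : 0 < M + 2 by lra.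
  by rewrite divr_gt0// mulr_gt0.
(* The first bound lets orbits enter a cell in time [exp (dlt * s)], the second
   makes the imaginary part of the energy smaller than the oscillation. *)
pose eta1 := Num.min (dlt / (2 * (D%:R + 1))) (1 / (2 * gamma)).
have eta10 : 0 < eta1.
  by rewrite lt_min; apply/andP; split; rewrite divr_gt0// mulr_gt0// ltr_wpDl.
have eta1D : eta1 * D%:R <= dlt / 2.
  apply: (@le_trans _ _ (dlt / (2 * (D%:R + 1)) * D%:R)); first by rewrite ler_wpM2r// ge_min lexx.
  have D1 : 0 < D%:R + 1 :> R by rewrite ltr_wpDl.
  have -> : dlt / (2 * (D%:R + 1)) * D%:R = dlt / 2 * (D%:R / (D%:R + 1)) by field; rewrite gt_eqF.
  by rewrite ler_piMr ?divr_ge0 ?(ltW dlt0)// ler_pdivrMr// mul1r lerDl.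
pose beta := eta1 * gamma.
have beta0 : 0 < beta by rewrite mulr_gt0.
have beta2 : beta <= 1 / 2.
  rewrite /beta -ler_pdivlMr// ge_min; apply/orP; right.
  by rewrite le_eqVlt; apply/orP; left; apply/eqP; field; rewrite gt_eqF.
pose eta := Num.min (l / 2) (beta / (4 * C1)).
have eta0 : 0 < eta by rewrite lt_min; apply/andP; split; rewrite divr_gt0// mulr_gt0.
have etal : eta <= l / 2 by rewrite ge_min lexx.
have etaC : 2 * eta * C1 <= beta / 2.
  have h : eta <= beta / (4 * C1) by rewrite ge_min lexx orbT.
  have h4 : 0 < 4 * C1 by exact: mulr_gt0.
  rewrite ler_pdivlMr// in h.
  have -> : 2 * eta * C1 = eta * (4 * C1) / 2 by field.
  by rewrite ler_pM2r.
have [J HJ] := entry_norm_uniform_upper d0 Hphi Halpha L_cont L_pos K eta0.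
have C1l : C1 * l = 2 * (M + 2) by rewrite divfK// gt_eqF.
have betaE : beta = eta1 * gamma by [].
clearbody C1 beta eta eta1.
pose Q := 2 * (K + Phi + 3).
pose W1 := ln (Num.max 1 Q).
near=> s.
have s1 : 1 <= s by near: s; apply: nbhs_pinfty_ge; rewrite num_real.
have fa : (ln 4 + 2) / (C1 * eta) <= s by near: s; apply: nbhs_pinfty_ge; rewrite num_real.
have fb : Cb * W1 * (C1 + 1) ^+ 2 * (s + 1) ^+ 2 <= expR (eta1 * s) by near: s; exact: expR_dominates.
have fc : 2 * J%:R ^+ 2 * (H + 1) * expR (2 * eta) * (C1 + 1) * (s + 1) ^+ 2 <= expR (beta / 2 * s).
  by near: s; apply: expR_dominates; rewrite divr_gt0.
have fd1 : 2 * C0 * 2 ^+ D * (s + 1) ^+ 2 <= expR (dlt / 2 * s).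
  by near: s; apply: expR_dominates; rewrite divr_gt0.
have fd2 : 2 * (C1 + 1) * (s + 1) ^+ 2 <= expR (dlt * s) by near: s; exact: expR_dominates.
have fe : J.+1%:R * (s + 1) ^+ 2 <= expR (1 / 2 * s).
  by near: s; apply: expR_dominates.
have e2_ge1 : 1 <= (s + 1) ^+ 2 by rewrite exprn_ege1//; move: s1; forget_facts; lra.
have s_le2 : s + 1 <= (s + 1) ^+ 2 by rewrite expr2 ler_peMr//; move: s1; forget_facts; lra.
pose k := (Num.truncn (C1 * s)).+1.
have Cs0 : 0 <= C1 * s by rewrite mulr_ge0// ?ltW//; lra.
have k1 : C1 * s <= k%:R by apply/ltW/truncnS_gt.
have k2 : k%:R <= (C1 + 1) * (s + 1).
  have : (Num.truncn (C1 * s))%:R <= C1 * s by rewrite truncn_le.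
  have -> : k%:R = (Num.truncn (C1 * s))%:R + 1 :> R by rewrite natr1.
  have -> : (C1 + 1) * (s + 1) = C1 * s + C1 + s + 1 by ring.
  by move=> h; move: h s1 (ltW C10); forget_facts; lra.
have k3' : k%:R <= C1 * s + 1 by rewrite -(natr1 (Num.truncn (C1 * s))) lerD2r truncn_le.
have k0 : (0 < k)%N by [].
clearbody k.
pose p := Num.truncn (expR (eta1 * s)).
have q1 : expR (eta1 * s) <= p.+1%:R by apply/ltW/truncnS_gt.
have es1 : 1 <= expR (eta1 * s) by rewrite -expR0 ler_expR mulr_ge0// ?ltW//; lra.
have p0 : (0 < p)%N by rewrite truncn_gt0.
have q2 : p.+1%:R <= 2 * expR (eta1 * s).
  have : p%:R <= expR (eta1 * s) by rewrite truncn_le expR_ge0.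
  by rewrite -(natr1 p) => h; move: h es1; forget_facts; lra.
clearbody p.
have [bad [sbad Hbad]] := Hc alpha k p p0.
have kr : (0 : R) < k%:R by rewrite ltr0n.
have qr : (0 : R) < p.+1%:R by rewrite ltr0n.
move=> theta E y EK y0 ys.
have lE := Hl E EK.
have K0 : 0 <= K by apply: le_trans EK.
have Q1 : 1 <= Q by rewrite /Q; move: K0 P0; forget_facts; lra.
have W1E : W1 = ln Q by rewrite /W1 max_r.
have GW x : ln (opnorm (cocyc k x E%:C)) <= k%:R * W1.
  apply: le_trans (ln_opnorm_le _ _ _ _ _) _.
  have := entry_norm_iter alpha HPhi (Q := K + Phi + 3) k x (_ : normc E%:C + Phi + 2 <= _).
  rewrite normc_real => /(_ ltac:(move: EK; forget_facts; lra)) h.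
  rewrite W1E mulr_natl -lnXn ?(lt_le_trans ltr01)//.
  rewrite ler_ln ?posrE ?exprn_gt0 ?(lt_le_trans ltr01)//; last exact: entry_norm_cocycle_ge1.
  apply: (le_trans h); rewrite /Q exprMn ler_wpM2r ?exprn_ge0//; first by move: K0 P0; forget_facts; lra.
  by rewrite -[leLHS]expr1 ler_weXn2l// ler1n.
have [x [xgood xbig]] : exists x, cell p x \notin bad /\ k%:R * (L E - eta) < ln (opnorm (cocyc k x E%:C)).
  apply: exists_large_value GW _ _ => //.
  - by move=> x; exact: ln_opnorm_ge0.
  - apply: mulr_ge0; first exact: ltW.
    rewrite subr_ge0; apply: (le_trans etal); apply: le_trans lE.
    by rewrite ler_pdivrMr// ler_peMr ?(ltW l0)// ler1n.
  have hm := lyapunov_le_mean d0 Hphi Halpha (L_pos E) k0.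
  have hb : (size bad)%:R / p.+1%:R ^+ d * (k%:R * W1) <= 1.
    apply: (@le_trans _ _ (Cb * k%:R / p.+1%:R * (k%:R * W1))).
      apply: ler_wpM2r; first by rewrite mulr_ge0// W1E ln_ge0.
      rewrite ler_pdivrMr ?exprn_gt0//; apply: (le_trans sbad).
      by rewrite -{2}(prednK d0) exprS mulrA divfK// gt_eqF.
    have -> : Cb * k%:R / p.+1%:R * (k%:R * W1) = Cb * W1 * k%:R ^+ 2 / p.+1%:R.
      by move: (k%:R) (p.+1%:R) => a b; ring.
    rewrite ler_pdivrMr// mul1r; apply: le_trans q1; apply: le_trans fb.
    rewrite -[leRHS]mulrA -exprMn; apply: ler_wpM2l; first by rewrite mulr_ge0// W1E ln_ge0.
    by rewrite lerXn2r ?nnegrE// (le_trans _ k2).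
  have hk : ln 4 + 2 <= k%:R * eta.
    apply: (@le_trans _ _ (C1 * s * eta)); last by rewrite ler_wpM2r// ltW.
    by rewrite mulrAC mulrC -ler_pdivrMr// mulr_gt0.
  move: hm hb hk; rewrite mulrBr; forget_facts; move: (torus_integral _) (ln 4) (_ * L E) (k%:R * eta) (_ * (_ * W1)) => *; lra.
have [n Hn ncell] := HD p x theta.
exists n, k; split.
  have h1 : C0 * p.+1%:R ^+ D <= expR (dlt * s) / 2.
    apply: (@le_trans _ _ (C0 * 2 ^+ D * expR (eta1 * D%:R * s))).
      have -> : eta1 * D%:R * s = eta1 * s * D%:R by ring.
      rewrite expRM_natr -mulrA -exprMn; apply: ler_wpM2l; first exact: C00.
      by apply: lerXn2r; rewrite ?nnegrE// mulr_ge0// expR_ge0.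
    apply: (@le_trans _ _ (expR (dlt / 2 * s) / 2 * expR (dlt / 2 * s))).
      apply: ler_pM; rewrite ?expR_ge0 ?mulr_ge0 ?exprn_ge0//.
        rewrite ler_pdivlMr//; apply: le_trans fd1; rewrite mulrC mulrA ler_peMr//.
        by rewrite !mulr_ge0// exprn_ge0.
      by rewrite ler_expR ler_wpM2r// (le_trans ler01).
    by rewrite mulrAC -expRD -mulrDl -splitr.
  have h2 : k%:R <= expR (dlt * s) / 2.
    rewrite ler_pdivlMr//; apply: le_trans fd2; rewrite mulrC -mulrA ler_wpM2l//.
    by apply: (le_trans k2); rewrite ler_wpM2l// addr_ge0// ltW.
  by rewrite natrD (splitr (expR _)) lerD// (le_trans Hn).
set z := E%:C + 'i * y%:C.
have zE : normc (z - E%:C) = y by rewrite /z addrC addKr normcM normci mul1r normc_real ger0_norm.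
have s0 : 0 <= s := le_trans ler01 s1.
have yJ : y <= J.+1%:R^-1.
  apply: (le_trans ys); rewrite expRN lef_pV2 ?posrE ?expR_gt0//.
  have -> : s / 2 = 1 / 2 * s by field.
  by apply: le_trans fe; rewrite ler_peMr.
pose Lam := L E + eta.
have Lam0 : 0 <= Lam by rewrite addr_ge0 ?(ltW eta0)// (le_trans (ltW l0)).
have del : H * p.+1%:R `^ (- gamma) + y <= (H + 1) * expR (- (beta * s)).
  rewrite mulrDl mul1r; apply: lerD.
    rewrite ler_wpM2l// /powR gt_eqF// ler_expR mulNr lerN2 betaE mulrAC mulrC ler_wpM2l ?(ltW g0)//.
    by rewrite -ler_expR lnK ?posrE.
  apply: (le_trans ys); rewrite ler_expR lerN2 mulrC ler_wpM2l//; move: beta2; forget_facts; lra.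
have pert : entry_norm (cocyc k x E%:C - cocyc k (theta + alpha *+ n) z) <=
    k%:R * (J%:R ^+ 2 * expR (k%:R * Lam)) * ((H + 1) * expR (- (beta * s))).
  apply: cocycle_perturbation.
  - by rewrite mulr_ge0// ?exprn_ge0 ?expR_ge0.
  - move=> i j t1 t2 ij.
    apply: (@le_trans _ _ ((J%:R * expR (i%:R * Lam)) * (J%:R * expR (j%:R * Lam)))).
      apply: ler_pM; rewrite ?entry_norm_ge0//; apply: HJ => //; last by rewrite zE.
      by rewrite subrr normc0 invr_ge0.
    rewrite mulrACA -expr2 -expRD -mulrDl -natrD; apply: ler_wpM2l; first exact: exprn_ge0.
    by rewrite ler_expR ler_wpM2r// ler_nat ltnW.
  - move=> j jk; apply: le_trans del; apply: lerD; last by rewrite normcBC zE.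
    by apply: Hbad => //; rewrite ncell.
have k3 : k%:R * (2 * eta) <= beta / 2 * s + 2 * eta.
  apply: (@le_trans _ _ ((C1 * s + 1) * (2 * eta))).
    by apply: ler_wpM2r => //; rewrite mulr_ge0// ltW.
  rewrite mulrDl mul1r lerD2r; have -> : C1 * s * (2 * eta) = 2 * eta * C1 * s by ring.
  exact: ler_wpM2r.
set X := expR (k%:R * (L E - eta)).
have err : k%:R * (J%:R ^+ 2 * expR (k%:R * Lam)) * ((H + 1) * expR (- (beta * s))) <= X / 2.
  have -> : k%:R * Lam = k%:R * (L E - eta) + k%:R * (2 * eta) by rewrite /Lam; move: (k%:R) (L E) => a b; ring.
  rewrite expRD -/X.
  apply: (@le_trans _ _ (X / 2 * ((2 * J%:R ^+ 2 * (H + 1) * expR (2 * eta) * k%:R) * expR (- (beta / 2 * s))))).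
    apply: (@le_trans _ _ (k%:R * (J%:R ^+ 2 * (X * expR (beta / 2 * s + 2 * eta))) * ((H + 1) * expR (- (beta * s))))).
      apply: ler_wpM2r; first by rewrite mulr_ge0 ?expR_ge0// addr_ge0.
      by do 3!(apply: ler_wpM2l; first by rewrite ?expR_ge0 ?exprn_ge0//); rewrite ler_expR.
    rewrite expRD; have -> : - (beta * s) = - (beta / 2 * s) - (beta / 2 * s) by field.
    rewrite expRD expRN; have := expR_gt0 (beta / 2 * s).
    move: (expR (beta / 2 * s)) (expR (2 * eta)) (k%:R) (J%:R) X => a b c e X a0.
    by rewrite le_eqVlt; apply/orP; left; apply/eqP; field; rewrite gt_eqF.
  rewrite ler_piMr//; first by rewrite divr_ge0// expR_ge0.
  rewrite expRN ler_pdivrMr ?expR_gt0// mul1r; apply: le_trans fc.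
  rewrite -[leRHS]mulrA; apply: ler_wpM2l; first by rewrite !mulr_ge0 ?expR_ge0 ?exprn_ge0 ?addr_ge0.
  by apply: (le_trans k2); rewrite ler_wpM2l// addr_ge0// ltW.
have big : X <= entry_norm (cocyc k x E%:C).
  apply: le_trans (opnorm_le _); rewrite /X -ler_ln ?posrE ?expR_gt0//.
    by rewrite expRK ltW.
  by apply: lt_le_trans ltr01 _; apply: opnorm_ge1; exact: det_cocycle_iter.
have half : X / 2 <= entry_norm (cocyc k (theta + alpha *+ n) z).
  have := entry_normD (cocyc k x E%:C - cocyc k (theta + alpha *+ n) z) (cocyc k (theta + alpha *+ n) z).
  rewrite subrK; move: big err pert; forget_facts; move: (entry_norm _) (entry_norm _) (entry_norm _) (_ * _ * (_ * _)) X => *; lra.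
apply: le_trans half; rewrite ler_pdivlMr//.
apply: (@le_trans _ _ (expR (M * s) * expR (2 * s))).
  by apply: ler_wpM2l; rewrite ?expR_ge0//; have := expR_ge1Dx (2 * s); move: s1; forget_facts; lra.
rewrite -expRD ler_expR -mulrDl.
apply: (@le_trans _ _ (k%:R * (l / 2))); last first.
  by apply: ler_wpM2l => //; move: lE etal; forget_facts; move: (L E) => *; lra.
apply: (@le_trans _ _ (C1 * s * (l / 2))); last by apply: ler_wpM2r => //; rewrite divr_ge0// ltW.
have -> : C1 * s * (l / 2) = C1 * l * s / 2 by field.
by rewrite C1l le_eqVlt; apply/orP; left; apply/eqP; field.
Unshelve. all: by end_near. Qed.

End growth_along_orbits.

(** * Transfer matrices and Dirichlet determinants *)
Section transfer_matrices.
Context {R : realType} {d : nat}.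
Local Notation C := R[i].
Variables (phi : 'rV[R]_d -> R) (alpha theta : 'rV[R]_d) (z : C).
Local Notation V := (fun n => phi (rotation alpha n theta)).
Local Notation A b k := (cocycle_iter phi alpha k (rotation alpha b theta) z).

Lemma rotationD (a b : int) x : rotation alpha a (rotation alpha b x) = rotation alpha (b + a) x.
Proof. by rewrite /rotation mulrzDr addrA. Qed.

Lemma cocycle_iter_row0 b k j : A b k.+1 ord0 j =
  (z - (V (b + k%:Z))%:C) * A b k ord0 j - A b k (lift ord0 ord0) j.
Proof.
rewrite [LHS]mxE big_ord_recl big_ord_recl big_ord0 addr0 !mxE /= mulN1r.
by rewrite rotationD.
Qed.

Lemma cocycle_iter_row1 b k j : A b k.+1 (lift ord0 ord0) j = A b k ord0 j.
Proof. by rewrite [LHS]mxE big_ord_recl big_ord_recl big_ord0 addr0 !mxE /= mul1r mul0r addr0. Qed.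

(** Both sides satisfy the same three-term recursion. *)
Lemma cocycle_iter_dirdet0 b k : A b k ord0 ord0 = dirdet V z b k.
Proof.
elim/nat_ind2: k => [||k IH1 IH2]; first by rewrite mxE.
  by rewrite cocycle_iter_row0 !mxE /= mulr1 subr0 addr0.
by rewrite cocycle_iter_row0 cocycle_iter_row1 IH1 IH2.
Qed.

Lemma cocycle_iter_dirdet1 b k : A b k.+1 ord0 (lift ord0 ord0) = - dirdet V z (b + 1) k.
Proof.
have E0 : A b 0 ord0 (lift ord0 ord0) = 0 by rewrite mxE.
have E1 : A b 1 ord0 (lift ord0 ord0) = - 1.
  by rewrite cocycle_iter_row0 E0 mulr0 !mxE /= sub0r.
elim/nat_ind2: k => [||k IH1 IH2]; first by rewrite E1.
  rewrite cocycle_iter_row0 cocycle_iter_row1 E1 E0 subr0 mulrN1.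
  by congr (- (z - (V _)%:C)); rewrite addr0.
rewrite cocycle_iter_row0 cocycle_iter_row1 IH1 IH2 dirdetSS mulrN opprB opprK addrC.
by congr (_ - (z - (V _)%:C) * _); rewrite -addrA; congr (_ + _); lia.
Qed.

Lemma entry_norm_dirdet (X : R) b k :
  (forall (a : int) k', b <= a -> a + k'%:Z <= b + k%:Z -> normc (dirdet V z a k') <= X) ->
  entry_norm (A b k) <= 4 * X.
Proof.
move=> H.
have X1 : 1 <= X by have := H b 0%N; rewrite normc1; apply => //; lia.
have h0 k' : (k' <= k)%N -> normc (A b k' ord0 ord0) <= X.
  by move=> kk; rewrite cocycle_iter_dirdet0; apply: H; lia.
have h1 k' : (k' <= k)%N -> normc (A b k' ord0 (lift ord0 ord0)) <= X.
  case: k' => [_|k' kk]; first by rewrite mxE normc0 (le_trans ler01).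
  by rewrite cocycle_iter_dirdet1 normcN; apply: H; lia.
have h2 : normc (A b k (lift ord0 ord0) ord0) <= X.
  case: k H h0 h1 => [|k] H h0 h1; first by rewrite mxE normc0 (le_trans ler01).
  by rewrite cocycle_iter_row1; apply: h0.
have h3 : normc (A b k (lift ord0 ord0) (lift ord0 ord0)) <= X.
  case: k H h0 h1 h2 => [|k] H h0 h1 h2; first by rewrite mxE normc1.
  by rewrite cocycle_iter_row1; apply: h1.
have l1 : 1 = lift ord0 ord0 :> 'I_2 by apply/val_inj.
rewrite entry_norm2 !l1 (_ : 0 = ord0)//; have := h0 k (leqnn k); have := h1 k (leqnn k).
move: h2 h3; move: (normc _) (normc _) (normc _) (normc _) => *; lra.
Qed.

End transfer_matrices.

Section large_determinants.
Context {R : realType} {d : nat}.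
Local Notation C := R[i].
Variables (phi : 'rV[R]_d -> R) (alpha : 'rV[R]_d).
Hypothesis d0 : (0 < d)%N.
Hypothesis Hphi : tame phi.
Hypothesis Halpha : dioph alpha.
Hypothesis L_cont : continuous (fun E : R => lyapunov phi alpha E%:C).
Hypothesis L_pos : forall E : R, 0 < lyapunov phi alpha E%:C.

(** A large transfer matrix has a large entry, and the four entries are
    determinants of windows contained in the given one. *)
Lemma large_dirdet (K M dlt : R) : 0 <= M -> 0 < dlt -> \forall s \near +oo, forall theta (E y : R) (c : int) (W : nat),
  `|E| <= K -> 0 <= y -> y <= expR (- (s / 2)) -> expR (dlt * s) <= W%:R ->
  exists (b : int) (k : nat), [/\ c <= b, b + k%:Z <= c + W%:Z &
    expR (M * s) / 8 <= normc (dirdet (fun n => phi (rotation alpha n theta)) (E +i* y) b k)].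
Proof.
move=> M0 dlt0; have := cocycle_growth d0 Hphi Halpha L_cont L_pos K M0 dlt0.
apply: filterS => s H theta E y c W EK y0 ys sW.
have [n [k [nk big]]] := H (rotation alpha c theta) E y EK y0 ys.
have {}nk : (n + k <= W)%N by rewrite -(ler_nat R) (le_trans nk).
have zE : E%:C + 'i * y%:C = E +i* y by rewrite /real_complex_def; apply/eqP; rewrite eq_complex /= !(mul0r, mulr0, mul1r, addr0, add0r, subr0) !eqxx.
rewrite zE -rotationE rotationD in big.
apply: contrapT => nex.
have := @entry_norm_dirdet R d phi alpha theta (E +i* y) (expR (M * s) / 8) (c + n%:Z) k.
apply: contraPP => _; apply/not_implyP; split.
  move=> a k' a1 a2; rewrite leNgt; apply/negP => h; apply: nex; exists a, k'; split; [clear -a1; lia|clear -a2 nk; lia|exact: ltW].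
move=> h; have := le_trans big h; have := expR_gt0 (M * s); move: (expR _) => a; lra.
Qed.
End large_determinants.

(** * Decay of the wave packet *)
Section site_estimates.
Context {R : realType}.
Implicit Types (u v : int -> R[i]) (s : R).

Lemma expR_half_le2 : expR (1 / 2) <= 2 :> R.
Proof.
have := expR_ge1Dx (- (1 / 2) : R); rewrite expRN => h.
have h2 : 2^-1 <= (expR (1 / 2 : R))^-1 by lra.
by rewrite lef_pV2 ?posrE ?expR_gt0 in h2.
Qed.

Lemma expR1_le4 : expR 1 <= 4 :> R.
Proof.
have -> : expR 1 = expR (1 / 2) * expR (1 / 2) :> R by rewrite -expRD; congr expR; field.
have -> : 4 = 2 * 2 :> R by ring.
by apply: ler_pM; rewrite ?expR_ge0 ?expR_half_le2.
Qed.

Lemma half_pow_le n : 2^-1 ^+ n <= expR (- (n%:R / 2)) :> R.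
Proof.
rewrite expRN exprVn lef_pV2 ?posrE ?expR_gt0 ?exprn_gt0//.
have -> : n%:R / 2 = 1 / 2 * n%:R :> R by field.
by rewrite expRM_natr lerXn2r ?nnegrE ?expR_ge0 ?expR_half_le2.
Qed.

(** Up to distance [4 c exp s] the small amplitude beats the polynomial weight;
    further away the exponential localization takes over. *)
Lemma weight_bound (m : nat) (c : R) : 4 <= c -> \forall s \near +oo, forall n (w : R), 0 <= w ->
  w <= 5 * expR (- (m.+3%:R * s)) -> w <= 2 * expR (expR s * c) * 2^-1 ^+ n ->
  (1 + n%:R) ^+ m.+2 * w ^+ 2 <= expR (- s).
Proof.
move=> c4.
have [x0 [_ Hx0]] := @expR_dominates R m.+2 4 (1 / 4) ltac:(lra).
near=> s.
have s0 : 0 <= s by near: s; apply: nbhs_pinfty_ge; rewrite num_real.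
have sx : x0 <= s by near: s; apply: nbhs_pinfty_ge; rewrite num_real.
have h1 : 25 * (1 + 4 * c) ^+ m.+2 * (s + 1) ^+ 0 <= expR (1 * s).
  by near: s; apply: expR_dominates.
have ts : s + 1 <= expR s by rewrite addrC expR_ge1Dx.
move=> n w w0 w1 w2.
have [nt|nt] := leP (n%:R) (4 * c * expR s).
  apply: (@le_trans _ _ ((expR s * (1 + 4 * c)) ^+ m.+2 * (5 * expR (- (m.+3%:R * s))) ^+ 2)).
    apply: ler_pM; rewrite ?exprn_ge0 ?addr_ge0//; last by rewrite lerXn2r ?nnegrE// mulr_ge0 ?expR_ge0.
    rewrite lerXn2r ?nnegrE ?addr_ge0 ?mulr_ge0 ?expR_ge0//; first lra.
    rewrite mulrDr mulr1 mulrC; apply: lerD; first lra.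
    exact: nt.
  have -> : (expR s * (1 + 4 * c)) ^+ m.+2 * (5 * expR (- (m.+3%:R * s))) ^+ 2 =
     (25 * (1 + 4 * c) ^+ m.+2) * expR (- ((m.+4)%:R * s)).
    have e1 : - (m.+4%:R * s) = s * m.+2%:R + (- (m.+3%:R * s)) * 2%:R.
      by rewrite -(natr1 m.+3) -(natr1 m.+2); ring.
    rewrite e1 expRD !expRM_natr !exprMn; set a := expR s ^+ m.+2; set b := _ ^+ m.+2; set e := expR _; ring.
  apply: (@le_trans _ _ (expR s * expR (- (m.+4%:R * s)))).
    by rewrite ler_wpM2r ?expR_ge0//; move: h1; rewrite expr0 mulr1 mul1r.
  rewrite -expRD ler_expR.
  have : 0 <= m%:R * s by rewrite mulr_ge0.
  have -> : m.+4%:R = m%:R + 4 :> R by rewrite -addn4 natrD.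
  by rewrite mulrDl; lra.
have xx0 : x0 < n%:R.
  by apply: (le_lt_trans sx); apply: le_lt_trans nt; nra.
have h2 := Hx0 _ xx0; rewrite /= in h2.
have x4 : 4 * s <= n%:R by apply: le_trans (ltW nt); nra.
have w3 : w <= 2 * expR (- (n%:R / 4)).
  apply: (le_trans w2); rewrite -mulrA ler_wpM2l//.
  apply: (@le_trans _ _ (expR (expR s * c) * expR (- (n%:R / 2)))).
    by rewrite ler_wpM2l ?expR_ge0 ?half_pow_le.
  by rewrite -expRD ler_expR; move: nt; rewrite mulrAC => nt; lra.
apply: (@le_trans _ _ ((1 + n%:R) ^+ m.+2 * (2 * expR (- (n%:R / 4))) ^+ 2)).
  by rewrite ler_wpM2l ?exprn_ge0 ?addr_ge0// lerXn2r ?nnegrE ?mulr_ge0 ?expR_ge0.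
have -> : (1 + n%:R) ^+ m.+2 * (2 * expR (- (n%:R / 4))) ^+ 2 =
    (4 * (n%:R + 1) ^+ m.+2) * expR (- (n%:R / 4)) * expR (- (n%:R / 4)) :> R.
  by rewrite [1 + _]addrC exprMn; set a := _ ^+ m.+2; set b := expR _; ring.
apply: (@le_trans _ _ (expR (1 / 4 * n%:R) * expR (- (n%:R / 4)) * expR (- (n%:R / 4)))).
  by rewrite !ler_wpM2r ?expR_ge0.
rewrite -!expRD ler_expR; lra.
Unshelve. all: by end_near. Qed.

Lemma sqn_le_bound (B : nat) u (Y : R) :
  (forall n, (1 + (`|n|%N)%:R) ^+ 2 * normc (u n) ^+ 2 <= Y) -> sqn B u <= 4 * Y.
Proof.
move=> H.
have Y0 : 0 <= Y by apply: le_trans (H 0); rewrite mulr_ge0// sqr_ge0.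
have H2 (n : int) (i : nat) : (i <= `|n|)%N -> normc (u n) ^+ 2 <= Y * (i.+1%:R ^+ 2)^-1.
  move=> iN; rewrite ler_pdivlMr ?exprn_gt0//; apply: le_trans (H n).
  rewrite mulrC ler_wpM2r ?sqr_ge0// lerXn2r ?nnegrE//.
  by rewrite addrC natr1 ler_nat.
rewrite /sqn -addnn -addnS big_split_ord /=.
have -> : 4 * Y = Y * 2 + Y * 2 by ring.
apply: lerD.
  rewrite (reindex_inj rev_ord_inj) /=.
  apply: (@le_trans _ _ (\sum_(i < B) Y * (i.+1%:R ^+ 2)^-1)).
    by apply: ler_sum => i _; apply: H2; have := ltn_ord i; lia.
  by rewrite -mulr_sumr ler_wpM2l// sum_inv_sqr_le.
apply: (@le_trans _ _ (\sum_(i < B.+1) Y * (i.+1%:R ^+ 2)^-1)).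
  by apply: ler_sum => i _; apply: H2; lia.
by rewrite -mulr_sumr ler_wpM2l// sum_inv_sqr_le.
Qed.

End site_estimates.

Section far_sites.
Context {R : realType}.

Lemma euler_step_size (b s : R) (j : nat) : 0 <= s ->
  expR ((b + 3) * s) <= j%:R -> j%:R <= 2 * expR ((b + 3) * s) ->
  0 < expR s / j%:R /\ expR (- ((b + 2) * s)) / 2 <= expR s / j%:R <= expR (- ((b + 2) * s)).
Proof.
move=> s0 j1 j2; have e0 : 0 < expR ((b + 3) * s) by exact: expR_gt0.
have jr : (0 : R) < j%:R by apply: lt_le_trans j1.
split; first by rewrite divr_gt0// expR_gt0.
have E : expR s = expR (- ((b + 2) * s)) * expR ((b + 3) * s) by rewrite -expRD; congr expR; ring.
have g0 : 0 < expR (- ((b + 2) * s)) by exact: expR_gt0.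
rewrite ler_pdivlMr// ler_pdivrMr// E; apply/andP; split.
  by rewrite mulrAC ler_pdivrMr// -mulrA ler_pM2l// mulrC.
by rewrite ler_pM2l.
Qed.

(** The parameters are [eta = 1/t], [kappa = t^-b] and [h] about [t^-(b + 2)], with
    [t = exp s]; a determinant of size [t^(4 b + 9)] then suffices. *)
Lemma far_sites (V : int -> R) (Phi b s dlt : R) (j W n : nat) : (forall i, `|V i| <= Phi) ->
  0 <= s -> 0 <= b ->
  expR ((b + 3) * s) <= j%:R -> j%:R <= 2 * expR ((b + 3) * s) ->
  2 * C2 Phi <= expR s -> 4 * (Phi + 4) ^+ 2 <= expR s -> 16384 < expR s ->
  2 * ((2 * b + 4) * (s + 1)) <= expR (dlt * s) -> expR (dlt * s) <= W%:R ->
  (forall E y, `|E| <= Phi + 4 -> 0 <= y -> y <= expR (- s) -> exists a k : nat,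
    [/\ (1 <= a)%N, (a + k <= W.+1)%N &
      expR ((4 * b + 9) * s) / 8 <= normc (dirdet V (E +i* y) a%:Z k)]) ->
  (W < n)%N ->
  normc (iter j (euler V (expR s / j%:R)) (delta_seq n%:Z) 0) <= 4 * expR (- (b * s)).
Proof.
move=> HV s0 b0 j1 j2 hC hK h16 hd hW large Wn.
have P0 : 0 <= Phi by apply: le_trans (HV 0).
have jr : (0 : R) < j%:R by apply: lt_le_trans j1; exact: expR_gt0.
have [h0 /andP[hl hu]] := euler_step_size s0 j1 j2.
have jh : j%:R * (expR s / j%:R) = expR s by rewrite mulrC divfK// gt_eqF.
set h : R := expR s / j%:R in h0 hl hu jh *.
pose eta := expR (- s); pose kappa := expR (- (b * s)).
have eta0 : 0 < eta by exact: expR_gt0.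
have kap0 : 0 < kappa by exact: expR_gt0.
have eta1 : eta <= 1 by rewrite -expR0 ler_expR oppr_le0.
have es : expR s * eta = 1 by rewrite -expRD subrr expR0.
have h2s : h <= eta * eta.
  apply: (le_trans hu); rewrite -expRD ler_expR.
  by move: s0 (mulr_ge0 b0 s0); clear; lra.
have hmul (x : R) : 0 <= x -> x <= expR s -> h * x <= eta.
  move=> x0 xs; apply: (@le_trans _ _ (eta * eta * expR s)); first by apply: ler_pM => //; exact: ltW.
  by rewrite -mulrA [eta * expR s]mulrC es mulr1.
have K1 : Phi + 4 <= 4 * (Phi + 4) ^+ 2 by move: P0; clear; rewrite expr2; nra.
have hh : h <= 1 by apply: (le_trans h2s); rewrite mulr_ile1// ltW.
have hC2 : h * C2 Phi <= eta / 2.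
  rewrite ler_pdivlMr// -mulrA [C2 Phi * 2]mulrC; apply: hmul hC.
  by apply: mulr_ge0; last exact: C2_ge0.
have hK2 : h * (4 * (Phi + 4) ^+ 2) <= eta by apply: hmul => //; rewrite mulr_ge0// sqr_ge0.
have hK1 : h * (Phi + 4) <= 1.
  by apply: le_trans eta1; apply: hmul; [rewrite addr_ge0|exact: le_trans hK].
have he0 : 0 < h * eta by rewrite mulr_gt0.
have main := @euler_decay R V Phi eta h (Phi + 4) kappa n HV eta0 eta1 h0 hh hC2 hK2 hK1 (lexx _) _ _ j.
apply: (@le_trans _ _ (kappa * (1 + h * eta) ^+ j)).
  apply: main.
    move=> E y EK /andP[y1 y2].
    have [a [k [a1 ak big]]] := large E y EK (le_trans (ltW (divr_gt0 eta0 (ltr0n _ 2))) y1) y2.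
    exists a, k; split => //; first exact: leq_trans ak Wn.
    have q0 : 0 < (eta / 2) ^+ 2 * kappa ^+ 2 by rewrite mulr_gt0 ?exprn_gt0 ?divr_gt0.
    apply: (@lt_le_trans _ _ (expR ((4 * b + 9) * s) / 8 * ((eta / 2) ^+ 2 * kappa ^+ 2))); last by rewrite ler_pM2r.
    rewrite (expr_div_n 4 (h * eta)) [ltLHS]mulrA ltr_pdivrMr ?exprn_gt0//.
    set g := expR (- ((b + 2) * s)) in hl.
    have g0 : 0 < g by exact: expR_gt0.
    apply: (@lt_le_trans _ _ (expR ((4 * b + 9) * s) / 8 * ((eta / 2) ^+ 2 * kappa ^+ 2) * (g / 2 * eta) ^+ 2)); last first.
      rewrite ler_pM2l ?mulr_gt0 ?divr_gt0 ?expR_gt0//.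
      by rewrite lerXn2r ?nnegrE ?mulr_ge0 ?(ltW eta0) ?(ltW h0) ?divr_ge0 ?(ltW g0)// ler_pM2r.
    have -> : expR ((4 * b + 9) * s) / 8 * ((eta / 2) ^+ 2 * kappa ^+ 2) * (g / 2 * eta) ^+ 2 = expR s / 128.
      have -> : expR s = expR ((4 * b + 9) * s) * eta ^+ 4 * kappa ^+ 2 * g ^+ 2.
        by rewrite -!expRM_natr -!expRD; congr expR; ring.
      by field.
    by rewrite ltr_pdivlMr//; move: h16; clear; lra.
  apply: (@le_lt_trans _ _ (expR (- (n%:R / 2)) * (8 * expR ((b + 3) * s)))).
    apply: ler_pM; rewrite ?exprn_ge0 ?invr_ge0 ?divr_ge0 ?(ltW he0) ?half_pow_le//.
    rewrite ler_pdivrMr//.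
    apply: (@le_trans _ _ (8 * expR ((b + 3) * s) * (expR (- ((b + 2) * s)) / 2 * eta))); last first.
      by rewrite ler_pM2l ?mulr_gt0 ?expR_gt0// ler_pM2r.
    rewrite le_eqVlt; apply/orP; left; apply/eqP.
    transitivity (4 * (expR ((b + 3) * s) * expR (- ((b + 2) * s)) * eta)); last by field.
    by rewrite -!expRD (_ : _ + _ - _ = 0) ?expR0 ?mulr1//; ring.
  have nW : expR (dlt * s) <= n%:R by apply: (le_trans hW); rewrite ler_nat ltnW.
  have n2 : (2 * b + 4) * s <= n%:R / 2.
    rewrite ler_pdivlMr//; apply: le_trans nW; apply: le_trans hd.
    have -> : 2 * ((2 * b + 4) * (s + 1)) = (2 * b + 4) * s * 2 + 2 * (2 * b + 4) by ring.
    by rewrite lerDl mulr_ge0// addr_ge0// mulr_ge0.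
  apply: (@le_lt_trans _ _ (expR (- ((2 * b + 4) * s)) * (8 * expR ((b + 3) * s)))).
    by rewrite ler_wpM2r ?mulr_ge0 ?expR_ge0// ler_expR lerN2.
  have -> : kappa = expR (- ((2 * b + 4) * s)) * (expR s * expR ((b + 3) * s)).
    by rewrite -!expRD; congr expR; ring.
  by rewrite ltr_pM2l ?expR_gt0// ltr_pM2r ?expR_gt0//; apply: lt_trans h16; rewrite ltr_nat.
rewrite [leRHS]mulrC ler_wpM2l ?(ltW kap0)//.
apply: le_trans (pow_le_expR (ltW he0) (leqnn j)) _.
have -> : h * eta * j%:R = j%:R * h * eta by ring.
by rewrite jh es; exact: expR1_le4.
Qed.

End far_sites.

Section transport_sites.
Context {R : realType} {d : nat}.
Variables (phi : 'rV[R]_d -> R) (alpha : 'rV[R]_d).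
Hypothesis d0 : (0 < d)%N.
Hypothesis Hphi : tame phi.
Hypothesis Halpha : dioph alpha.
Hypothesis L_cont : continuous (fun E : R => lyapunov phi alpha E%:C).
Hypothesis L_pos : forall E : R, 0 < lyapunov phi alpha E%:C.

Local Ltac forget_facts := clear -d0 Hphi Halpha L_cont L_pos.

Lemma window_right (c : int) (k W : nat) : 1 <= c -> c + k%:Z <= 1 + W%:Z ->
  exists a : nat, [/\ (1 <= a)%N, (a + k <= W.+1)%N & a%:Z = c].
Proof. by move=> c1 c2; exists (absz c); split; lia. Qed.

Lemma window_left (c : int) (k W : nat) : - W%:Z <= c -> c + k%:Z <= - W%:Z + W%:Z ->
  exists a : nat, [/\ (1 <= a)%N, (a + k <= W.+1)%N & a%:Z = - (c + k%:Z - 1)].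
Proof. by move=> c1 c2; exists (absz (1 - c - k%:Z)%R); split; lia. Qed.

Lemma nat_approx (x : R) : 1 <= x -> exists n : nat,
  [/\ (0 < n)%N, x <= n%:R, n%:R <= 2 * x & n.+1%:R <= 3 * x].
Proof.
move=> x1; exists (Num.truncn x).+1; have x0 : 0 <= x := le_trans ler01 x1.
have h : (Num.truncn x)%:R <= x by rewrite truncn_le.
split => //; first by apply/ltW/truncnS_gt.
  by rewrite -(natr1 (Num.truncn x)); move: (_%:R) h => y h; lra.
by rewrite -(natr1 (Num.truncn x).+1) -(natr1 (Num.truncn x)); move: (_%:R) h => y h; lra.
Qed.

(** [u] is the Euler approximation, whose norm is under control, and [v] the exact
    evolution, which gives the amplitudes. *)
Lemma transport_sites (m : nat) (dlt : R) : 0 < dlt -> \forall s \near +oo, forall theta,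
  exists (W B : nat) (u v : int -> R[i]),
  [/\ W.+1%:R <= 3 * expR (dlt * s),
      forall n, amplitude phi alpha theta n (expR s) = normc (v n) ^+ 2,
      1 <= sqn B u, forall n, normc (u n) <= 2 &
      forall n, normc (u n - v n) <= expR (- s)] /\
  forall n : int, (W < `|n|)%N ->
    (1 + (`|n|%N)%:R) ^+ m.+2 * normc (u n) ^+ 2 <= expR (- s) /\
    (1 + (`|n|%N)%:R) ^+ m.+2 * normc (v n) ^+ 2 <= expR (- s).
Proof.
move=> dlt0; have [Phi [_ [_ [_ [[P0 _ _ _] [HPhi _]]]]]] := Hphi.
pose b : R := m.+3%:R.
have b1 : 1 <= b by rewrite /b ler1n.
have b0 : 0 <= b by lra.
have C20 := C2_ge0 Phi.
have c4 : 4 <= 4 + Phi by lra.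
have M0 : 0 <= 4 * b + 9 by lra.
have key := large_dirdet d0 Hphi Halpha L_cont L_pos (Phi + 4) M0 dlt0.
have wb := weight_bound m c4.
have params : \forall s \near +oo, [/\ 1 <= s,
    (2 * C2 Phi * expR 2 + 2 * C2 Phi + 1) * (s + 1) ^+ 0 <= expR (1 * s),
    4 * (Phi + 4) ^+ 2 * (s + 1) ^+ 0 <= expR (1 * s), 16385 * (s + 1) ^+ 0 <= expR (1 * s) &
    2 * (2 * b + 4) * (s + 1) ^+ 1 <= expR (dlt * s)].
  near=> s; split; near: s; [|exact: expR_dominates..].
  by apply: nbhs_pinfty_ge; rewrite num_real.
apply: filterS3 key wb params => s kb wb1 [s1 hC hK h16 hd].
rewrite !expr0 !mulr1 !mul1r in hC hK h16; rewrite expr1 in hd.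
have s0 : 0 <= s := le_trans ler01 s1.
have C2e := mulr_ge0 C20 (expR_ge0 2).
have es1 : 1 <= expR s by rewrite -expR0 ler_expR.
have hC1 : 2 * C2 Phi <= expR s.
  apply: le_trans hC; have -> : 2 * C2 Phi * expR 2 + 2 * C2 Phi + 1 = 2 * (C2 Phi * expR 2) + 1 + 2 * C2 Phi by ring.
  by rewrite lerDr addr_ge0// mulr_ge0.
have hC2 : 2 * (C2 Phi * expR 2) <= expR s.
  by apply: le_trans hC; rewrite mulrA -addrA lerDl; apply: addr_ge0 => //; exact: mulr_ge0 (ler0n R 2) C20.
have h16' : 16384 < expR s by move: h16; forget_facts; lra.
have hd' : 2 * ((2 * b + 4) * (s + 1)) <= expR (dlt * s) by rewrite mulrA.
clear hC h16 hd.
have jb1 : 1 <= expR ((b + 3) * s) by rewrite -expR0 ler_expR mulr_ge0// addr_ge0.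
have Wb1 : 1 <= expR (dlt * s) by rewrite -expR0 ler_expR mulr_ge0// ltW.
have [j [j0 j1 j2 _]] := nat_approx jb1.
have [W [_ W1 _ W2]] := nat_approx Wb1.
have jr : (0 : R) < j%:R by rewrite ltr0n.
have [h0 /andP[hl hu]] := euler_step_size s0 j1 j2.
have jh : j%:R * (expR s / j%:R) = expR s by rewrite mulrC divfK// gt_eqF.
move=> theta; pose V n := phi (rotation alpha n theta).
have HV i : `|V i| <= Phi by exact: HPhi.
have t0 : 0 <= expR s by exact: expR_ge0.
have [v [Hv1 Hv2]] := @amplitude_expansion R d phi alpha theta Phi (expR s) HV t0.
have cvg := euler_cvg HV t0 Hv2.
set h : R := expR s / j%:R in h0 hl hu jh.
pose u := iter j (euler V h) (delta_seq 0 : int -> R[i]).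
exists W, j, u, v.
have small : j%:R * h ^+ 2 * C2 Phi <= expR (- (b * s)) * (C2 Phi * expR (- s)).
  have -> : j%:R * h ^+ 2 * C2 Phi = expR s * h * C2 Phi by rewrite -jh; ring.
  apply: (@le_trans _ _ (expR s * expR (- ((b + 2) * s)) * C2 Phi)).
    by apply: ler_wpM2r => //; rewrite ler_pM2l// expR_gt0.
  rewrite le_eqVlt; apply/orP; left; apply/eqP.
  have -> : - ((b + 2) * s) = - (b * s) + - s + - s by ring.
  rewrite !expRD; have := expRxMexpNx_1 s; set w := expR (- (b * s)); set c := C2 Phi; set x := expR s; set y := expR (- s) => xy.
  have -> : x * (w * y * y) * c = (x * y) * (w * (c * y)) by ring.
  by rewrite xy mul1r.
have ees : expR s * expR (- s) = 1 := expRxMexpNx_1 s.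
have ems0 : 0 <= expR (- s) := expR_ge0 _.
have ebs1 : expR (- (b * s)) <= expR (- s) by rewrite ler_expR lerN2 ler_peMl.
have ems1 : expR (- s) <= 1 by rewrite -expR0 ler_expR oppr_le0.
have small2 : 2 * (j%:R * h ^+ 2 * C2 Phi * expR 2) <= expR (- (b * s)).
  apply: (@le_trans _ _ (expR (- (b * s)) * ((2 * (C2 Phi * expR 2)) * expR (- s)))).
    have -> : expR (- (b * s)) * ((2 * (C2 Phi * expR 2)) * expR (- s)) = 2 * (expR (- (b * s)) * (C2 Phi * expR (- s)) * expR 2) by ring.
    by rewrite ler_wpM2l// ler_wpM2r ?expR_ge0.
  apply: ler_piMr; first exact: expR_ge0.
  by apply: (@le_trans _ _ (expR s * expR (- s))); [exact: ler_wpM2r|rewrite ees].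
have small1 : j%:R * h ^+ 2 * C2 Phi <= 1.
  apply: (le_trans small); apply: mulr_ile1; rewrite ?expR_ge0 ?(mulr_ge0 C20)//.
    exact: le_trans ebs1 ems1.
  apply: (@le_trans _ _ (expR s * expR (- s))); last by rewrite ees.
  by apply: ler_wpM2r => //; apply: le_trans hC1; rewrite ler_peMl// ler1n.
have close n : normc (u n - v n) <= expR (- (b * s)).
  exact: le_trans (euler_approx n HV j0 t0 cvg small1) small2.
have growth_h : (1 + h ^+ 2 * C2 Phi) ^+ j <= 4.
  apply: le_trans (pow_le_expR (mulr_ge0 (sqr_ge0 h) C20) (leqnn j)) _.
  by apply: le_trans expR1_le4; rewrite ler_expR [leLHS]mulrC [leLHS]mulrA.
have /andP[sq1 sq2] : 1 <= sqn j u <= 4.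
  have := @sqn_iter_euler R V Phi h 0 j j (delta_seq 0) HV (@supp_in_delta R 0) (leqnn _).
  rewrite sqn_delta// => /andP[-> h2] /=.
  by apply: (le_trans h2); rewrite mulr1.
have u2 n : normc (u n) <= 2.
  have [nj|nj] := leqP (`|n|%N) j.
    rewrite -(@ler_pXn2r _ 2) ?nnegrE ?normc_ge0//.
    by apply: le_trans (sqn_ge u nj) _; apply: (le_trans sq2); rewrite -natrX ler_nat.
  have -> : u n = 0 by exact: (@supp_in_iter_euler R V h j 0 _ (@supp_in_delta R 0) n nj).
  by rewrite normc0.
have yb (y : R) : y <= expR (- s) -> y <= expR (- (s / 2)).
  by move=> hy; apply: (le_trans hy); rewrite ler_expR lerN2 ler_pdivrMr// mulr_natr mulr2n lerDl.
have far n : (W < `|n|)%N -> normc (u n) <= 4 * expR (- (b * s)).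
  case: n => n nW.
    rewrite /u euler_kernel_sym.
    apply: (far_sites HV s0 b0 j1 j2 hC1 hK h16' hd' W1) => // E y EK y0 ys.
    have [c [k [c1 c2 c3]]] := kb theta E y 1 W EK y0 (yb y ys) W1.
    by have [a [a1 a2 a3]] := window_right c1 c2; exists a, k; rewrite a3.
  have -> : u (Negz n) = iter j (euler (refl V) h) (delta_seq n.+1%:Z) 0.
    by rewrite NegzE /u -euler_refl oppr0 euler_kernel_sym.
  apply: (@far_sites R (refl V) Phi b s dlt j W n.+1 (fun i => HV (- i)) s0 b0 j1 j2 hC1 hK h16' hd' W1) => // E y EK y0 ys.
  have [c [k [c1 c2 c3]]] := kb theta E y (- W%:Z) W EK y0 (yb y ys) W1.
  by have [a [a1 a2 a3]] := window_left c1 c2; exists a, k; rewrite a3 dirdet_refl.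
have u_exp n : normc (u n) <= expR (expR s * (4 + Phi)) * 2^-1 ^+ `|n|%N.
  have := @iter_euler_exp_bounded R V Phi h j HV (ltW h0) n; move=> /le_trans; apply.
  rewrite ler_wpM2r ?exprn_ge0 ?invr_ge0//.
  apply: le_trans (pow_le_expR (mulr_ge0 (ltW h0) (le_trans (ler0n R 4) c4)) (leqnn j)) _.
  by rewrite ler_expR mulrAC [h * _]mulrC jh.
have v_exp n : normc (v n) <= 2 * expR (expR s * (4 + Phi)) * 2^-1 ^+ `|n|%N.
  by have := Hv2 n 0%N; rewrite !big_ord0 sub0r normcN subr0 mulrAC.
split; first split => // n; first exact: le_trans (close n) ebs1.
move=> n nW; have far_n := far n nW; have eb0 := expR_ge0 (- (b * s)).
split; apply: wb1 => //; rewrite ?normc_ge0//.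
- by apply: (le_trans far_n); rewrite ler_wpM2r// ler_nat.
- apply: (le_trans (u_exp n)); rewrite -mulrA; apply: ler_peMl; last by rewrite ler1n.
  by apply: mulr_ge0; [exact: expR_ge0|apply: exprn_ge0; rewrite invr_ge0].
- have := le_normcD (u n) (- (u n - v n)); rewrite subKr normcN => hv.
  by apply: (le_trans hv); apply: (le_trans (lerD far_n (close n))); by rewrite le_eqVlt; apply/orP; left; apply/eqP; rewrite -/b; ring.
Unshelve. all: by end_near. Qed.
End transport_sites.

(** * Moments and the transport exponent *)
Section moments.
Context {R : realType} {d : nat}.
Variables (phi : 'rV[R]_d -> R) (alpha : 'rV[R]_d).
Hypothesis d0 : (0 < d)%N.
Hypothesis Hphi : tame phi.
Hypothesis Halpha : dioph alpha.
Hypothesis L_cont : continuous (fun E : R => lyapunov phi alpha E%:C).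
Hypothesis L_pos : forall E : R, 0 < lyapunov phi alpha E%:C.
Variable p : R.
Hypothesis p0 : 0 < p.

Lemma moment_le theta t (m : nat) (Y : R) : p <= m%:R ->
  (forall n : int, (1 + (`|n|%N)%:R) ^+ m.+2 * amplitude phi alpha theta n t <= Y) ->
  (moment phi alpha theta p t <= (4 * Y)%:E)%E.
Proof.
move=> pm H; have a0 n : 0 <= amplitude phi alpha theta n t by exact: sqr_ge0.
apply: esum_int_le => n; first by rewrite mulr_ge0// powR_ge0.
have n1 : 1 <= 1 + `|n|%:~R :> R by rewrite -natr_absz lerDl.
have n0 : 0 < 1 + `|n|%:~R :> R by apply: lt_le_trans n1.
rewrite ler_pdivlMr ?exprn_gt0//; apply: le_trans (H n).
rewrite natr_absz mulrAC ler_wpM2r// -[m.+2]addn2 exprD ler_wpM2r ?sqr_ge0//.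
by rewrite -powR_mulrn ?(ltW n0)// ler_powR.
Qed.

Lemma moment_ge theta t (n : int) :
  ((amplitude phi alpha theta n t)%:E <= moment phi alpha theta p t)%E.
Proof.
have a0 k : 0 <= amplitude phi alpha theta k t by exact: sqr_ge0.
apply: (@le_trans _ _ ((1 + `|n|%:~R) `^ p * amplitude phi alpha theta n t)%:E).
  rewrite lee_fin ler_peMl//; have {1}-> : 1 = 1 `^ p :> R by rewrite powR1.
  by apply: ge0_ler_powR; rewrite ?nnegrE ?(ltW p0) -?natr_absz ?addr_ge0 ?lerDl.
apply: le_trans (@esum_ge _ _ _ _ _ _); last first.
  exists [set n]; first by split.
  by rewrite fsbig_set1.
by [].
Qed.

(** Above, the sites within [W] dominate.  Below, the norm of [u] is at least 1
    while the sites beyond [W] carry little of it, so that some site within [W]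
    carries a value of [u] of modulus at least of order [1 / W]. *)
Lemma moment_bounds (eps : R) : 0 < eps -> \forall s \near +oo, forall theta,
  ((expR (- (eps * s)))%:E <= moment phi alpha theta p (expR s) <= (expR (eps * s))%:E)%E.
Proof.
move=> eps0; pose m := Num.bound p.
have pm : p <= m%:R by apply/ltW/archi_boundP/ltW.
pose dlt := Num.min (1 / 2) (eps / m.+3%:R).
have dlt0 : 0 < dlt by rewrite lt_min; apply/andP; split; rewrite divr_gt0.
have dlt2 : dlt <= 1 / 2 by rewrite ge_min lexx.
have dltm : dlt * m.+3%:R <= eps by rewrite -ler_pdivlMr// ge_min lexx orbT.
have dlt3 : dlt * 3 <= eps by apply: le_trans dltm; rewrite ler_wpM2l ?(ltW dlt0)// ler_nat.
have sites := transport_sites d0 Hphi Halpha L_cont L_pos m dlt0.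
have params : \forall s \near +oo, [/\ 0 <= s, 18 * (s + 1) ^+ 0 <= expR (1 / 2 * s) &
    36 * 9 * 3 ^+ m.+2 * (s + 1) ^+ 0 <= expR (dlt * s)].
  near=> s; split; near: s; [|by apply: expR_dominates|exact: expR_dominates].
  by apply: nbhs_pinfty_ge; rewrite num_real.
apply: filterS2 sites params => s sites [s0 h18 h324] theta.
rewrite !expr0 !mulr1 in h18 h324.
have [W [B [u [v [[W3 Hv sq u2 close] far]]]]] := sites theta.
have W0 : (0 : R) < W.+1%:R by rewrite ltr0n.
have em0 : 0 < expR (- s) by exact: expR_gt0.
have em1 : expR (- s) <= 1 by rewrite -expR0 ler_expR oppr_le0.
have ed0 : 0 < expR (dlt * s) by exact: expR_gt0.
have e18 : expR (1 / 2 * s) <= expR s by rewrite ler_expR ler_piMl//; lra.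
have em9 : expR (- s) <= 1 / 9.
  rewrite expRN ler_pdivlMr// -ler_pdivlMl ?invr_gt0 ?expR_gt0// invrK mulr1.
  by apply: le_trans (le_trans h18 e18); rewrite ler_nat.
have T1 : 1 <= 3 ^+ m.+2 :> R by rewrite exprn_ege1// ler1n.
apply/andP; split.
  have [n Hn] : exists n, (3 * W.+1%:R)^-1 <= normc (u n).
    apply: contrapT => /forallNP H.
    have : sqn B u <= 4 * (1 / 9).
      apply: sqn_le_bound => n; have [nW|nW] := leqP (`|n|%N) W.
        apply: (@le_trans _ _ (W.+1%:R ^+ 2 * ((3 * W.+1%:R)^-1) ^+ 2)).
          apply: ler_pM; rewrite ?sqr_ge0//.
            by rewrite lerXn2r ?nnegrE// addrC natr1 ler_nat.
          rewrite lerXn2r ?nnegrE ?normc_ge0 ?invr_ge0 ?mulr_ge0//.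
          by rewrite leNgt; apply/negP => h; apply: (H n); exact: ltW.
        by rewrite le_eqVlt; apply/orP; left; apply/eqP; field; rewrite gt_eqF.
      apply: le_trans (le_trans (far n nW).1 em9); rewrite ler_wpM2r ?sqr_ge0//.
      by apply: ler_weXn2l => //; rewrite lerDl.
    by move: sq; move: (sqn B u) => x; lra.
  apply: le_trans (moment_ge theta (expR s) n); rewrite lee_fin Hv.
  have r1 : (9 * expR (dlt * s))^-1 <= (3 * W.+1%:R)^-1.
    rewrite lef_pV2 ?posrE ?mulr_gt0//.
    have -> : 9 * expR (dlt * s) = 3 * (3 * expR (dlt * s)) by ring.
    by rewrite ler_pM2l.
  have r2 : expR (- s) <= (18 * expR (dlt * s))^-1.
    rewrite expRN lef_pV2 ?posrE ?mulr_gt0 ?expR_gt0//.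
    apply: (@le_trans _ _ (expR (1 / 2 * s) * expR (1 / 2 * s))).
      by apply: ler_pM; rewrite ?expR_ge0// ler_expR ler_wpM2r.
    by rewrite -expRD ler_expR -mulrDl -splitr mul1r.
  have r3 : (18 * expR (dlt * s))^-1 <= normc (v n).
    have := le_normcD (v n) (u n - v n); rewrite addrC subrK; have := close n.
    have -> : (18 * expR (dlt * s))^-1 = (9 * expR (dlt * s))^-1 - (18 * expR (dlt * s))^-1.
      by field; rewrite gt_eqF.
    move: Hn r1 r2; move: (_^-1) (_^-1) (_^-1) (normc _) (normc _) (normc _) (expR (- s)) => *; lra.
  apply: (@le_trans _ _ ((18 * expR (dlt * s))^-1 ^+ 2)); last first.
    by rewrite lerXn2r ?nnegrE ?normc_ge0 ?invr_ge0 ?mulr_ge0 ?(ltW ed0).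
  rewrite exprVn expRN lef_pV2 ?posrE ?exprn_gt0 ?mulr_gt0 ?expR_gt0//.
  apply: (@le_trans _ _ (expR (dlt * s) ^+ 3)).
    rewrite exprMn [leRHS]exprS ler_wpM2r ?sqr_ge0//; apply: le_trans h324.
    have -> : 18 ^+ 2 = 36 * 9 :> R by ring.
    by rewrite ler_peMr// mulr_ge0.
  by rewrite -expRM_natr ler_expR mulrAC ler_wpM2r.
pose Y : R := 9 * W.+1%:R ^+ m.+2.
apply: (@le_trans _ _ (4 * Y)%:E).
  apply: (moment_le pm) => n; rewrite Hv; have [nW|nW] := leqP (`|n|%N) W.
    rewrite /Y mulrC; apply: ler_pM; rewrite ?sqr_ge0 ?exprn_ge0 ?addr_ge0//; last first.
      by rewrite lerXn2r ?nnegrE// ?addr_ge0// addrC natr1 ler_nat.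
    have -> : 9 = 3 ^+ 2 :> R by rewrite -natrX.
    rewrite lerXn2r ?nnegrE ?normc_ge0//.
    have := le_normcD (u n) (- (u n - v n)); rewrite subKr normcN => hv.
    apply: (le_trans hv); apply: (le_trans (lerD (u2 n) (close n))).
    by move: em1; move: (expR (- s)) => *; lra.
  apply: (le_trans (far n nW).2); apply: (le_trans em1).
  by rewrite /Y mulr_ege1 ?ler1n// exprn_ege1// ler1n.
rewrite lee_fin; apply: (@le_trans _ _ (36 * (3 * expR (dlt * s)) ^+ m.+2)).
  rewrite /Y mulrA -natrM ler_wpM2l// lerXn2r ?nnegrE// mulr_ge0// ltW.
rewrite exprMn mulrA; apply: (@le_trans _ _ (expR (dlt * s) * expR (dlt * s) ^+ m.+2)).
  rewrite ler_wpM2r ?exprn_ge0 ?(ltW ed0)//; apply: le_trans h324.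
  by rewrite ler_wpM2r ?exprn_ge0// -natrM ler_nat.
by rewrite -exprS -expRM_natr ler_expR mulrAC ler_wpM2r.
Unshelve. all: by end_near. Qed.

Lemma beta_plus_eq0 theta : beta_plus phi alpha theta p = 0%E.
Proof.
have bounds (eps : R) : 0 < eps -> exists T : R, forall t, T < t ->
    ((- eps)%:E <= lne (moment phi alpha theta p t) * ((p * ln t)^-1)%:E <= eps%:E)%E.
  move=> eps0; have pe : 0 < p * eps by rewrite mulr_gt0.
  have [s0 [_ Hs]] := moment_bounds pe.
  exists (expR (Num.max s0 1)) => t Tt.
  have t0 : 0 < t by apply: lt_trans Tt; exact: expR_gt0.
  have : Num.max s0 1 < ln t by rewrite -ltr_expR lnK.
  rewrite gt_max => /andP[s0t s1t].
  have /andP[] := Hs _ s0t theta; rewrite lnK//.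
  have pl : 0 < p * ln t by rewrite mulr_gt0// (lt_trans ltr01).
  case: (moment _ _ _ _ _) => [r| |] //; rewrite !lee_fin => h1 h2.
  have r0 : 0 < r by apply: lt_le_trans h1; exact: expR_gt0.
  rewrite lne_EFin// -EFinM !lee_fin ler_pdivrMr// ler_pdivlMr//.
  move: h1 h2; rewrite -[in X in X -> _](lnK r0) -[in X in _ -> X -> _](lnK r0) !ler_expR.
  have -> : p * eps * ln t = eps * (p * ln t) by ring.
  by rewrite mulNr => -> ->.
rewrite /beta_plus limf_esupE; apply/eqP; rewrite eq_le; apply/andP; split.
  apply/lee_addgt0Pr => eps eps0; rewrite add0e.
  have [T HT] := bounds eps eps0.
  apply: (@le_trans _ _ (ereal_sup ((fun t => lne (moment phi alpha theta p t) * ((p * ln t)^-1)%:E)%E @` [set t | T < t]))).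
    by apply: ereal_inf_lbound; exists [set t | T < t] => //; exists T; rewrite num_real.
  by apply: ge_ereal_sup => _ [t /= Tt <-]; have /andP[] := HT t Tt.
apply: le_ereal_inf_tmp => _ [V [M [_ HM]] <-].
apply/lee_addgt0Pr => eps eps0.
have [T HT] := bounds eps eps0.
pose t := Num.max M T + 1.
have tM : M < t by rewrite ltr_pwDr// le_max lexx.
have tT : T < t by rewrite ltr_pwDr// le_max lexx orbT.
apply: (@le_trans _ _ ((- eps)%:E + eps%:E)%E); first by rewrite -EFinD addNr.
rewrite leeD2r//; apply: le_ereal_sup_tmp; exists (lne (moment phi alpha theta p t) * ((p * ln t)^-1)%:E)%E.
  by exists t => //; exact: HM.
by have /andP[] := HT t tT.
Qed.

End moments.

Theorem theorem1p5 (R : realType) (d : nat) (hd : (1 <= d)%N)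
    (tau : R) (htau : 1 < tau)
    (alpha : 'rV[R]_d) (halpha : DC tau alpha)
    (phi : 'rV[R]_d -> R) (phi_periodic : zperiodic phi)
    (phi_holder : piecewise_holder phi)
    (L_cont : continuous (fun E : R => lyapunov phi alpha E%:C))
    (L_pos : forall E : R, 0 < lyapunov phi alpha E%:C) :
  forall (theta : 'rV[R]_d) (p : R), 0 < p ->
    beta_plus phi alpha theta p = 0%E.
Proof.
move=> theta p p0; apply: beta_plus_eq0 => //; first exact: piecewise_holder_tame.
exact: DC_dioph halpha.
Qed.
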